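(* Let $G\subset PSL(3,\mathbb{C})$ be an infinite discrete group. If $G$ is not virtually commutative and $S\subset\mathbb{P}^2_{\mathbb{C}}$ is a complex algebraic curve invariant under $G$, then $S$ is either a finite union of complex lines or, up to a projective transformation, the Veronese curve. Moreover, if $S$ contains at least four lines, then $S$ contains at most three lines in general position.
   Context: $PSL(3,\mathbb{C})$ acts on the complex projective plane $\mathbb{P}^2_{\mathbb{C}}$ by projective transformations. A set $S$ is invariant under $G$ if $g(S)=S$ for all $g\in G$. A group is virtually commutative if it has a commutative subgroup of finite index. The Veronese curve is the image of $\psi:\mathbb{P}^1_{\mathbb{C}}\to\mathbb{P}^2_{\mathbb{C}}$, $\psi([z,w])=[z^2,2zw,w^2]$. Lines are in general position if they are distinct and no three of them pass through a common point. *)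

(* Defs.v *)
From HB Require Import structures.
From mathcomp Require Import all_boot all_order all_algebra complex mpoly.
From mathcomp Require Import all_classical all_reals topology normedtype.
From mathcomp Require Import ring.

Set Implicit Arguments.
Unset Strict Implicit.
Unset Printing Implicit Defensive.

Import Order.TTheory GRing.Theory Num.Theory numFieldNormedType.Exports.

Local Open Scope classical_set_scope.
Local Open Scope ring_scope.
Local Open Scope quotient_scope.

(* The type annotation is what gives access to the norm topology: MathComp-   *)
(* Analysis puts it on every numClosedFieldType, but not on R[i] directly.    *)
Definition CC (R : realType) : numClosedFieldType := R[i].

Section SpecialLinear.
Variable R : realType.
Local Notation C := (CC R).

Record SL3 : Type := MkSL3 { SL3_val : 'M[C]_3; _ : \det SL3_val == 1 }.
HB.instance Definition _ := [isSub of SL3 for SL3_val].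
HB.instance Definition _ := [Choice of SL3 by <:].
HB.instance Definition _ :=
  Topological.copy SL3 (initial_topology (val : SL3 -> 'M[C]_3)).

Implicit Types a b c : SL3.

Fact SL3_mul_subproof a b : \det (val a *m val b) == 1.
Proof. by rewrite det_mulmx (eqP (valP a)) (eqP (valP b)) mulr1. Qed.
Definition SL3_mul a b : SL3 := Sub (val a *m val b) (SL3_mul_subproof a b).

Fact SL3_one_subproof : \det (1%:M : 'M[C]_3) == 1.
Proof. by rewrite det1. Qed.
Definition SL3_one : SL3 := Sub 1%:M SL3_one_subproof.

Fact SL3_unit a : val a \in unitmx.
Proof. by rewrite unitmxE (eqP (valP a)) unitr1. Qed.

Fact SL3_inv_subproof a : \det (invmx (val a)) == 1.
Proof. by rewrite det_inv (eqP (valP a)) invr1. Qed.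
Definition SL3_inv a : SL3 := Sub (invmx (val a)) (SL3_inv_subproof a).

Lemma val_SL3_mul a b : val (SL3_mul a b) = val a *m val b.
Proof. exact: SubK. Qed.
Lemma val_SL3_one : val SL3_one = 1%:M.
Proof. exact: SubK. Qed.
Lemma val_SL3_inv a : val (SL3_inv a) = invmx (val a).
Proof. exact: SubK. Qed.

Fact SL3_mulA : associative SL3_mul.
Proof. by move=> a b c; apply: val_inj; rewrite !val_SL3_mul mulmxA. Qed.
Fact SL3_mul1 : left_id SL3_one SL3_mul.
Proof. by move=> a; apply: val_inj; rewrite val_SL3_mul val_SL3_one mul1mx. Qed.
Fact SL3_mulr1 : right_id SL3_one SL3_mul.
Proof. by move=> a; apply: val_inj; rewrite val_SL3_mul val_SL3_one mulmx1. Qed.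
Fact SL3_mulV : left_inverse SL3_one SL3_inv SL3_mul.
Proof. by move=> a; apply: val_inj; rewrite val_SL3_mul val_SL3_inv val_SL3_one mulVmx ?SL3_unit. Qed.
Fact SL3_mulrV : right_inverse SL3_one SL3_inv SL3_mul.
Proof. by move=> a; apply: val_inj; rewrite val_SL3_mul val_SL3_inv val_SL3_one mulmxV ?SL3_unit. Qed.

HB.instance Definition _ := isGroup.Build SL3
  SL3_mulA SL3_mul1 SL3_mulr1 SL3_mulV SL3_mulrV.

(* Equality modulo the centre of SL(3, C), i.e. the cube roots of unity.      *)
Definition PSL3_rel a b : bool :=
  `[< exists2 w : C, w ^+ 3 = 1 & val a = w *: val b >].

Fact PSL3_rel_refl : reflexive PSL3_rel.
Proof. by move=> a; apply/asboolP; exists 1; rewrite ?expr1n ?scale1r. Qed.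

Fact PSL3_rel_trans : transitive PSL3_rel.
Proof.
move=> b a c /asboolP[w w3 ab] /asboolP[z z3 bc]; apply/asboolP.
by exists (w * z); rewrite ?exprMn ?w3 ?z3 ?mulr1// ab bc scalerA.
Qed.

Fact PSL3_rel_sym : ssrbool.symmetric PSL3_rel.
Proof.
suff H a b : PSL3_rel a b -> PSL3_rel b a by move=> a b; apply/idP/idP => /H.
move=> /asboolP[w w3 ab]; apply/asboolP; exists w^-1.
  by rewrite exprVn w3 invr1.
have w0 : w != 0.
  by apply/eqP => w0; move/eqP: w3; rewrite w0 expr0n/= eq_sym oner_eq0.
by rewrite ab scalerA mulVf// scale1r.
Qed.

Canonical PSL3_equiv :=
  EquivRel PSL3_rel PSL3_rel_refl PSL3_rel_sym PSL3_rel_trans.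

Definition PSL3 : Type := {eq_quot PSL3_equiv}.
HB.instance Definition _ := Topological.copy PSL3 (quotient_topology PSL3).
HB.instance Definition _ := Quotient.on PSL3.

Implicit Types g h k : PSL3.

Definition PSL3_mul g h : PSL3 := \pi_PSL3 (SL3_mul (repr g) (repr h)).
Definition PSL3_one : PSL3 := \pi_PSL3 SL3_one.
Definition PSL3_inv g : PSL3 := \pi_PSL3 (SL3_inv (repr g)).

Lemma PSL3_repr a :
  exists2 w : C, w ^+ 3 = 1 & val (repr (\pi_PSL3 a)) = w *: val a.
Proof.
have /eqmodP/asboolP[w w3 e] : repr (\pi_PSL3 a) = a %[mod {eq_quot PSL3_equiv}].
  exact: reprK.
by exists w.
Qed.

Lemma PSL3_eq a b (w : C) :
  w ^+ 3 = 1 -> val a = w *: val b -> \pi_PSL3 a = \pi_PSL3 b.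
Proof. by move=> w3 ab; apply/eqmodP/asboolP; exists w. Qed.

Lemma PSL3_mul_pi a b :
  PSL3_mul (\pi_PSL3 a) (\pi_PSL3 b) = \pi_PSL3 (SL3_mul a b).
Proof.
have [w w3 aw] := PSL3_repr a; have [z z3 bz] := PSL3_repr b.
apply: (@PSL3_eq _ _ (w * z)); first by rewrite exprMn w3 z3 mulr1.
by rewrite !val_SL3_mul aw bz -scalemxAl -scalemxAr scalerA.
Qed.

Lemma PSL3_inv_pi a : PSL3_inv (\pi_PSL3 a) = \pi_PSL3 (SL3_inv a).
Proof.
have [w w3 aw] := PSL3_repr a.
apply: (@PSL3_eq _ _ w^-1); first by rewrite exprVn w3 invr1.
have w0 : w \is a GRing.unit.
  by rewrite unitfE; apply/eqP => w0; move/eqP: w3;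
     rewrite w0 expr0n/= eq_sym oner_eq0.
by rewrite !val_SL3_inv aw invmxZ ?unitmxZ ?SL3_unit.
Qed.

Lemma PSL3W (P : PSL3 -> Prop) : (forall a, P (\pi_PSL3 a)) -> forall g, P g.
Proof. by move=> Ppi g; rewrite -[g]reprK; exact: Ppi. Qed.

Fact PSL3_mulA : associative PSL3_mul.
Proof.
by elim/PSL3W=> a; elim/PSL3W=> b; elim/PSL3W=> c; rewrite !PSL3_mul_pi SL3_mulA.
Qed.
Fact PSL3_mul1 : left_id PSL3_one PSL3_mul.
Proof. by elim/PSL3W=> a; rewrite PSL3_mul_pi SL3_mul1. Qed.
Fact PSL3_mulr1 : right_id PSL3_one PSL3_mul.
Proof. by elim/PSL3W=> a; rewrite PSL3_mul_pi SL3_mulr1. Qed.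
Fact PSL3_mulV : left_inverse PSL3_one PSL3_inv PSL3_mul.
Proof. by elim/PSL3W=> a; rewrite PSL3_inv_pi PSL3_mul_pi SL3_mulV. Qed.
Fact PSL3_mulrV : right_inverse PSL3_one PSL3_inv PSL3_mul.
Proof. by elim/PSL3W=> a; rewrite PSL3_inv_pi PSL3_mul_pi SL3_mulrV. Qed.

HB.instance Definition _ := isGroup.Build PSL3
  PSL3_mulA PSL3_mul1 PSL3_mulr1 PSL3_mulV PSL3_mulrV.

End SpecialLinear.

Section ProjectiveSpace.
Variables (R : realType) (n : nat).
Local Notation C := (CC R).

Record nzvec : Type := MkNzvec { nzvec_val : 'cV[C]_n.+1; _ : nzvec_val != 0 }.
HB.instance Definition _ := [isSub of nzvec for nzvec_val].
HB.instance Definition _ := [Choice of nzvec by <:].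

Implicit Types u v : nzvec.

Definition proj_rel u v : bool :=
  `[< exists2 k : C, k != 0 & val u = k *: val v >].

Fact proj_rel_refl : reflexive proj_rel.
Proof. by move=> u; apply/asboolP; exists 1; rewrite ?oner_eq0 ?scale1r. Qed.

Fact proj_rel_trans : transitive proj_rel.
Proof.
move=> v u w /asboolP[k k0 uv] /asboolP[l l0 vw]; apply/asboolP.
by exists (k * l); rewrite ?mulf_neq0// uv vw scalerA.
Qed.

Fact proj_rel_sym : ssrbool.symmetric proj_rel.
Proof.
suff H u v : proj_rel u v -> proj_rel v u by move=> u v; apply/idP/idP => /H.
move=> /asboolP[k k0 uv]; apply/asboolP; exists k^-1; first by rewrite invr_eq0.
by rewrite uv scalerA mulVf// scale1r.
Qed.

Canonical proj_equiv :=
  EquivRel proj_rel proj_rel_refl proj_rel_sym proj_rel_trans.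

Definition CP : Type := {eq_quot proj_equiv}.
HB.instance Definition _ := EqQuotient.on CP.
HB.instance Definition _ := Choice.on CP.

Lemma CP_repr v :
  exists2 k : C, k != 0 & val (repr (\pi_CP v)) = k *: val v.
Proof.
have /eqmodP/asboolP[k k0 e] : repr (\pi_CP v) = v %[mod {eq_quot proj_equiv}].
  exact: reprK.
by exists k.
Qed.

Lemma CP_eq u v (k : C) :
  k != 0 -> val u = k *: val v -> \pi_CP u = \pi_CP v.
Proof. by move=> k0 uv; apply/eqmodP/asboolP; exists k. Qed.

End ProjectiveSpace.

Section Action.
Variable R : realType.
Local Notation C := (CC R).
Local Notation P2 := (CP R 2).

Fact mulSL3_subproof (a : SL3 R) (v : nzvec R 2) : val a *m val v != 0.
Proof.
apply: contra (valP v) => /eqP av0.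
by rewrite -[val v](mulKmx (SL3_unit a)) av0 mulmx0.
Qed.
Definition mulSL3 (a : SL3 R) (v : nzvec R 2) : nzvec R 2 :=
  Sub (val a *m val v) (mulSL3_subproof a v).

Lemma val_mulSL3 a v : val (mulSL3 a v) = val a *m val v.
Proof. exact: SubK. Qed.

Definition pact (g : PSL3 R) (p : P2) : P2 := \pi_(P2) (mulSL3 (repr g) (repr p)).

Lemma pact_pi (a : SL3 R) (v : nzvec R 2) :
  pact (\pi_(PSL3 R) a) (\pi_(P2) v) = \pi_(P2) (mulSL3 a v).
Proof.
have [w w3 aw] := PSL3_repr a; have [k k0 vk] := CP_repr v.
have w0 : w != 0.
  by apply/eqP => w0; move/eqP: w3; rewrite w0 expr0n/= eq_sym oner_eq0.
apply: (@CP_eq _ _ _ _ (w * k)); first exact: mulf_neq0.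
by rewrite !val_mulSL3 aw vk -scalemxAl -scalemxAr scalerA.
Qed.

Definition invariant_set (G : set (PSL3 R)) (S : set P2) : Prop :=
  forall g, G g -> pact g @` S = S.

End Action.

Section Curves.
Variable R : realType.
Local Notation C := (CC R).
Local Notation P2 := (CP R 2).

(* Vanishing is tested on the chosen representative; zero_locus_pi shows that *)
(* the choice is irrelevant when F is homogeneous.                            *)
Definition zero_locus (F : {mpoly C[3]}) : set P2 :=
  [set p : P2 | F.@[fun i => val (repr p) i ord0] = 0].

Definition algebraic_curve (S : set P2) : Prop :=
  exists (d : nat) (F : {mpoly C[3]}),
    [/\ (0 < d)%N, F != 0, F \is d.-homog & S = zero_locus F].

Lemma zero_locus_pi (d : nat) (F : {mpoly C[3]}) (v : nzvec R 2) :
  F \is d.-homog ->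
  zero_locus F (\pi_(P2) v) <-> F.@[fun i => val v i ord0] = 0.
Proof.
move=> homF; have [k k0 vk] := CP_repr v; rewrite /zero_locus /=.
suff -> : F.@[fun i => val (repr (\pi_(P2) v)) i ord0] =
    k ^+ d * F.@[fun i => val v i ord0].
  split=> [/eqP|->]; last by rewrite mulr0.
  by rewrite mulf_eq0 expf_eq0 (negPf k0) andbF => /eqP.
have mdegF : {in msupp F, forall m, mdeg m = d} by exact/dhomogP.
rewrite vk !mevalE big_distrr/= big_seq [RHS]big_seq; apply: eq_bigr => m mF.
rewrite mulrCA; congr (_ * _); rewrite -(mdegF _ mF) mdegE.
rewrite -prodrXr -big_split/=; apply: eq_bigr => i _.
by rewrite !mxE exprMn.
Qed.

Definition cline (L : set P2) : Prop :=
  exists2 l : 'rV[C]_3, l != 0 & L = [set p : P2 | l *m val (repr p) = 0].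

Lemma cline_pi (l : 'rV[C]_3) (v : nzvec R 2) :
  l *m val (repr (\pi_(P2) v)) = 0 <-> l *m val v = 0.
Proof.
have [k k0 ->] := CP_repr v; rewrite -scalemxAr.
split=> [/eqP|->]; last by rewrite scaler0.
by rewrite scalemx_eq0 (negPf k0) => /eqP.
Qed.

Definition general_position (n : nat) (L : 'I_n -> set P2) : Prop :=
  injective L /\
  forall i j k, i != j -> i != k -> j != k -> L i `&` L j `&` L k = set0.

Definition veronese_vec (v : 'cV[C]_2) : 'cV[C]_3 :=
  let z := v ord0 ord0 in let w := v ord_max ord0 in
  \col_i [:: z ^+ 2; 2 * z * w; w ^+ 2]`_i.

Fact veronese_subproof (v : nzvec R 1) : veronese_vec (val v) != 0.
Proof.
apply: contra (valP v) => /eqP/matrixP v0.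
have /eqP := v0 ord0 ord0; rewrite !mxE/= sqrf_eq0 => /eqP z0.
have /eqP := v0 ord_max ord0; rewrite !mxE/= sqrf_eq0 => /eqP w0.
apply/eqP/colP => i; rewrite mxE.
by case: (unliftP ord0 i) => [j|] ->//; rewrite [j]ord1 -[RHS]w0; congr (_ _ _);
  apply: val_inj.
Qed.

Definition veronese (p : CP R 1) : P2 :=
  \pi_(P2) (Sub (veronese_vec (val (repr p))) (veronese_subproof (repr p))).

Lemma veronese_pi (v : nzvec R 1) : veronese (\pi_(CP R 1) v) =
  \pi_(P2) (Sub (veronese_vec (val v)) (veronese_subproof v)).
Proof.
have [k k0 vk] := CP_repr v.
apply: (@CP_eq _ _ _ _ (k ^+ 2)); first by rewrite expf_neq0.
rewrite [LHS]SubK [in RHS]SubK vk; apply/colP => i; rewrite !mxE.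
by case: i => -[|[|[|//]]] ? /=; ring.
Qed.

Definition veronese_curve : set P2 := range veronese.

End Curves.

Arguments veronese_curve R : clear implicits.

Section Groups.
Implicit Types gT : groupType.
Local Open Scope group_scope.

Definition subgroup gT (G : set gT) : Prop := group_closed (mem G).

Definition finite_index gT (G H : set gT) : Prop :=
  finite_set [set [set g * h | h in H] | g in G].

Definition virtually_commutative gT (G : set gT) : Prop :=
  exists H : set gT,
    [/\ subgroup H, H `<=` G, {in H &, forall x y, commute x y}
      & finite_index G H].

End Groups.

Definition discrete_subset (T : topologicalType) (A : set T) : Prop :=
  A `<=` isolated A.

(* Main.v *)
Require Import Defs.
From HB Require Import structures.
From mathcomp Require Import all_boot all_order all_algebra complex mpoly.
From mathcomp Require Import all_classical all_reals topology normedtype.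
From mathcomp Require Import perm ring zify.

(* G lifts to a group of matrices in SL(3, C) whose bounded subsets are finite.
   Write an equation of S as a product of linear forms and of a form F without
   linear factors; since the zero locus of F is the closure of S minus the lines,
   it is invariant too. Suppose that F is not constant.

   If some g in G has infinite order, a power of g has eigenvalue ratios that are
   1 or not roots of unity. A polynomial that vanishes along the powers of g then
   vanishes along a one-parameter group containing them, so the curve of F is a
   union of orbits of a unipotent or of a diagonal one-parameter group. Either it
   is a single conic, or a subgroup of finite index preserves so many points and
   lines that G is virtually commutative.

   If every element of G has finite order, all traces are bounded by 3. Rescaled
   limits of elements going to infinity have rank one, and the bound on traces
   yields first a fixed point and then an invariant line through it, up to finite
   index. In triangular form, commutators are unipotent of finite order, hence
   trivial.

   So F defines a conic. If S also contained a line, a subgroup of finite index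
   would fix a point of the conic and act as a discrete group of affine maps of C,
   which is virtually commutative. Finally, a subgroup of finite index fixes each
   line of S, and it is finite if four of these lines are in general position. *)

Set Implicit Arguments.
Unset Strict Implicit.
Unset Printing Implicit Defensive.

Import Order.TTheory GRing.Theory Num.Theory numFieldNormedType.Exports.

Local Open Scope classical_set_scope.
Local Open Scope ring_scope.

(** * Coordinates in dimension three *)

Section Vec3.
Variable K : fieldType.
Implicit Types (u v w : 'cV[K]_3).

(** Intersection theory is avoided: curves are cones in C^3 and are only cut with lines, on which a
    form becomes a polynomial in one variable. A form without linear factors ([noline]) has finitely
    many zeros on each line, and if it is not constant it has zeros off any finite set of lines;
    these two facts carry most arguments. Irreducible components are never separated, so a conic is
    recognized by its set of zeros alone. What makes conics exceptional is [meets_once]: on the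
    other curves found to be invariant under a one-parameter group, only one or two lines meet the
    curve in a single point, so the whole group permutes them, whereas every tangent of a conic is
    such a line. A torsion group contains no element whose powers fill a one-parameter group; there,
    rescaled limits of elements take over. Taking them along ultrafilters makes all limits of
    bounded quantities exist at once, without passing to subsequences. *)

Definition vec3 (x y z : K) : 'cV[K]_3 := \col_i [:: x; y; z]`_i.
Definition row3 (x y z : K) : 'rV[K]_3 := \row_i [:: x; y; z]`_i.
Definition cols3 u v w : 'M[K]_3 := \matrix_(i, j) [:: u i 0; v i 0; w i 0]`_j.

Lemma ord3P (P : 'I_3 -> Prop) :
  P 0 -> P 1 -> P (inord 2) -> forall i, P i.
Proof.
move=> P0 P1 P2 [[|[|[|//]]] i3].
- by rewrite (_ : Ordinal _ = 0)//; apply: val_inj.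
- by rewrite (_ : Ordinal _ = 1)//; apply: val_inj.
- by rewrite (_ : Ordinal _ = inord 2)//; apply: val_inj; rewrite /= inordK.
Qed.

Lemma sum3E (f : 'I_3 -> K) : \sum_i f i = f 0 + f 1 + f (inord 2).
Proof.
rewrite !big_ord_recl big_ord0 addr0 addrA.
by congr (f _ + f _ + f _); apply: val_inj; rewrite /= ?inordK.
Qed.

Lemma mul3E m n (a : 'M[K]_(m, 3)) (b : 'M[K]_(3, n)) i j :
  (a *m b) i j = a i 0 * b 0 j + a i 1 * b 1 j + a i (inord 2) * b (inord 2) j.
Proof. by rewrite mxE sum3E. Qed.

Lemma vec3K v : v = vec3 (v 0 0) (v 1 0) (v (inord 2) 0).
Proof. by apply/colP; apply: ord3P; rewrite mxE ?inordK. Qed.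

Lemma row3K (l : 'rV[K]_3) : l = row3 (l 0 0) (l 0 1) (l 0 (inord 2)).
Proof. by apply/rowP; apply: ord3P; rewrite mxE ?inordK. Qed.

Lemma vec3E x y z : ((vec3 x y z) 0 0 = x) * ((vec3 x y z) 1 0 = y) *
  ((vec3 x y z) (inord 2) 0 = z).
Proof. by rewrite !mxE ?inordK. Qed.

Lemma row3E x y z : ((row3 x y z) 0 0 = x) * ((row3 x y z) 0 1 = y) *
  ((row3 x y z) 0 (inord 2) = z).
Proof. by rewrite !mxE ?inordK. Qed.

Lemma cols3E u v w i : ((cols3 u v w) i 0 = u i 0) *
  ((cols3 u v w) i 1 = v i 0) * ((cols3 u v w) i (inord 2) = w i 0).
Proof. by rewrite !mxE ?inordK. Qed.

Lemma one3E : 1%:M = cols3 (vec3 1 0 0) (vec3 0 1 0) (vec3 0 0 1) :> 'M[K]_3.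
Proof.
apply/matrixP; apply: ord3P; apply: ord3P; rewrite cols3E vec3E;
  by rewrite mxE -val_eqE /= ?inordK.
Qed.

Lemma row3_mul a b c x y z :
  row3 a b c *m vec3 x y z = (a * x + b * y + c * z)%:M.
Proof. by apply/matrixP => i j; rewrite !ord1 mxE sum3E !row3E !vec3E mxE. Qed.

Lemma vec3_inj x y z x' y' z' :
  vec3 x y z = vec3 x' y' z' -> [/\ x = x', y = y' & z = z'].
Proof.
move=> /colP e; split; [have := e 0|have := e 1|have := e (inord 2)];
  by rewrite !vec3E.
Qed.

Lemma vec3_eq0 x y z : vec3 x y z = 0 -> [/\ x = 0, y = 0 & z = 0].
Proof.
move=> e; apply: vec3_inj; rewrite e.
by apply/colP; apply: ord3P; rewrite vec3E mxE.
Qed.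

Lemma scale_vec3 k x y z : k *: vec3 x y z = vec3 (k * x) (k * y) (k * z).
Proof. by apply/colP; apply: ord3P; rewrite mxE !vec3E. Qed.

Lemma add_vec3 x y z x' y' z' :
  vec3 x y z + vec3 x' y' z' = vec3 (x + x') (y + y') (z + z').
Proof. by apply/colP; apply: ord3P; rewrite mxE !vec3E. Qed.

Lemma cols3_mul u v w x y z :
  cols3 u v w *m vec3 x y z = x *: u + y *: v + z *: w.
Proof.
by apply/colP => i; rewrite mxE sum3E !cols3E !vec3E !mxE;
   congr (_ + _ + _); rewrite mulrC.
Qed.

Lemma det3E (A : 'M[K]_3) : \det A =
  A 0 0 * (A 1 1 * A (inord 2) (inord 2) - A 1 (inord 2) * A (inord 2) 1)
  - A 0 1 * (A 1 0 * A (inord 2) (inord 2) - A 1 (inord 2) * A (inord 2) 0)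
  + A 0 (inord 2) * (A 1 0 * A (inord 2) 1 - A 1 1 * A (inord 2) 0).
Proof.
have e0 : lift 0 0 = 1 :> 'I_3 by apply: val_inj.
have e1 : lift 0 1 = inord 2 :> 'I_3 by apply: val_inj; rewrite /= inordK.
have e2 : lift 1 0 = 0 :> 'I_3 by apply: val_inj.
have e3 : lift 1 1 = inord 2 :> 'I_3 by apply: val_inj; rewrite /= inordK.
have e4 : lift (inord 2) 0 = 0 :> 'I_3 by apply: val_inj; rewrite /= /bump inordK.
have e5 : lift (inord 2) 1 = 1 :> 'I_3 by apply: val_inj; rewrite /= /bump inordK.
have f0 : lift 0 0 = 1 :> 'I_2 by apply: val_inj.
have f1 : lift 1 0 = 0 :> 'I_2 by apply: val_inj.
have det2 (B : 'M[K]_2) : \det B = B 0 0 * B 1 1 - B 0 1 * B 1 0.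
  rewrite (expand_det_row _ 0) !big_ord_recl big_ord0 addr0 /cofactor.
  by rewrite !det_mx11 !mxE !f0 !f1 /=; ring.
rewrite (expand_det_row _ 0) sum3E /cofactor !det2 !mxE.
by rewrite !e0 !e1 !e2 !e3 !e4 !e5 /= ?inordK//=; ring.
Qed.

Lemma independent_det u v : u != 0 -> (forall k, v <> k *: u) ->
  exists w, cols3 u v w \in unitmx.
Proof.
move=> u0 vNu.
(* The 2 x 2 minors of u and v: a nonzero one is, up to sign, the determinant obtained with a basis
   vector as third column; if all vanish, v is a multiple of u. *)
pose m i j := u i 0 * v j 0 - u j 0 * v i 0.
have [m01|m01] := eqVneq (m 0 1) 0; last first.
  exists (vec3 0 0 1); rewrite unitmxE unitfE det3E !cols3E !vec3E.
  by apply: contra m01 => /eqP <-; apply/eqP; rewrite /m; ring.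
have [m02|m02] := eqVneq (m 0 (inord 2)) 0; last first.
  exists (vec3 0 1 0); rewrite unitmxE unitfE det3E !cols3E !vec3E.
  by apply: contra m02; rewrite -oppr_eq0 => /eqP <-; apply/eqP; rewrite /m; ring.
have [m12|m12] := eqVneq (m 1 (inord 2)) 0; last first.
  exists (vec3 1 0 0); rewrite unitmxE unitfE det3E !cols3E !vec3E.
  by apply: contra m12 => /eqP <-; apply/eqP; rewrite /m; ring.
have mm i : m i i = 0 by rewrite /m; ring.
have mN i j : m j i = - m i j by rewrite /m; ring.
have mE i j : m i j = 0.
  move: i j; apply: ord3P; apply: ord3P; rewrite ?mm ?m01 ?m02 ?m12 //;
  by rewrite mN ?m01 ?m02 ?m12 oppr0.
have [i ui0] : exists i, u i 0 != 0.
  apply/existsP; apply: contraR u0 => /existsPn ui.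
  by apply/eqP/colP => i; rewrite mxE; apply/eqP; move: (ui i); rewrite negbK.
case: (vNu (v i 0 / u i 0)); apply/colP => j; rewrite mxE.
have /eqP := mE i j; rewrite subr_eq0 => /eqP e.
by apply: (mulfI ui0); rewrite e; field.
Qed.

End Vec3.

(** * Ternary forms and their cones *)

Section Forms.
Variable C : numClosedFieldType.
Implicit Types (F : {mpoly C[3]}) (u v w e : 'cV[C]_3) (l : 'rV[C]_3).

Definition ev F v : C := F.@[fun i => v i 0].

Lemma ev_scale d F k v : F \is d.-homog -> ev F (k *: v) = k ^+ d * ev F v.
Proof.
move=> homF0; have homF : {in msupp F, forall m, mdeg m = d} by exact/dhomogP.
rewrite /ev !mevalE big_distrr/= big_seq [RHS]big_seq.
apply: eq_bigr => m mF; rewrite mulrCA -(homF _ mF) mdegE -prodrXr -big_split/=.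
by congr (_ * _); apply: eq_bigr => i _; rewrite !mxE exprMn.
Qed.

Lemma ev0 d F : (0 < d)%N -> F \is d.-homog -> ev F 0 = 0.
Proof. by move=> d0 /(ev_scale 0 0); rewrite scale0r expr0n eqn0Ngt d0 mul0r. Qed.

(** Here r is an evaluation map: substituting polynomials into F and then evaluating gives F at the
    values. [curveE] uses it in one variable, [two_eigenvalues_case] in two. *)
Lemma rmorph_mmap (A : comNzRingType) (i : {rmorphism C -> A})
    (r : {rmorphism A -> C}) (h : 'I_3 -> A) F :
  (forall c, r (i c) = c) -> r (mmap i h F) = F.@[fun j => r (h j)].
Proof.
move=> ri; rewrite mevalE /mmap rmorph_sum/=; apply: eq_bigr => m _.
rewrite rmorphM ri /mmap1 rmorph_prod; congr (_ * _).
by apply: eq_bigr => j _; rewrite rmorphXn.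
Qed.

Definition curve F (q : 'cV[{poly C}]_3) : {poly C} := mmap polyC (fun i => q i 0) F.

Lemma curveE F q t : (curve F q).[t] = ev F (\col_i (q i 0).[t]).
Proof.
rewrite -[_.[t]]/(horner_eval t _) rmorph_mmap.
  by apply: meval_eq => i; rewrite mxE.
by move=> c; exact: hornerC.
Qed.

Definition linep F u w : {poly C} := curve F (\col_i ((u i 0)%:P + w i 0 *: 'X)).

Lemma linepE F u w t : (linep F u w).[t] = ev F (u + t *: w).
Proof.
rewrite curveE; apply: meval_eq => i.
by rewrite !mxE !hornerE mulrC.
Qed.

(** The bound does not depend on the line, so the exponent in [roots_away] can be fixed while the
    line moves. *)
Lemma size_linep F u w : (size (linep F u w) <= (msize F).+1)%N.
Proof.
rewrite /linep /curve /mmap (leq_trans (size_sum _ _ _))//.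
rewrite big_seq; apply/bigmax_leqP_seq => m _ mF.
rewrite (leq_trans (size_polyMleq _ _))// size_polyC.
set p := mmap1 _ _; suff : (size p <= (mdeg m).+1)%N.
  have := msize_mdeg_lt mF; case: (_ != 0); rewrite /= ?add1n ?add0n /=; move: (mdeg m) (mmeasure _ F) (size p) => a b c; lia.
pose L i := (u i 0)%:P + w i 0 *: 'X.
have -> : p = \prod_i L i ^+ m i.
  by apply: eq_bigr => i _; rewrite mxE.
have H i : (size (L i ^+ m i) <= (m i).+1)%N.
  rewrite (leq_trans (size_poly_exp_leq _ _))// ltnS.
  rewrite -[leqRHS]mul1n leq_mul2r -subn1 leq_subLR addn1.
  rewrite (leq_trans (size_polyD _ _))// ?orbT// geq_max size_polyC.
  by rewrite (leq_trans (size_scale_leq _ _)) ?size_polyX ?orbT//; case: eqP.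
rewrite (leq_trans (size_poly_prod_leq _ _))// card_ord leq_subLR.
have : (\sum_(i < 3) size (L i ^+ m i)%R <= \sum_(i < 3) (m i).+1)%N.
  by apply: leq_sum => i _; exact: H.
under [X in (_ <= X)%N]eq_bigr do rewrite -addn1.
by rewrite big_split/= sum_nat_const card_ord -mdegE muln1 addSn addnS ltnS addnC.
Qed.

Lemma poly_inj_eq0 (f : nat -> C) (p : {poly C}) : injective f ->
  (forall n, p.[f n] = 0) -> p = 0.
Proof.
move=> f_inj pf; apply/eqP; apply/negPn/negP => pn0.
pose s := [seq f i | i <- iota 0 (size p)].
have us : uniq s by rewrite map_inj_uniq ?iota_uniq.
have rs : all (root p) s by apply/allP => x /mapP[n _ ->]; apply/rootP.
by have := max_poly_roots pn0 rs us; rewrite size_map size_iota ltnn.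
Qed.

Lemma poly_eq0 (p : {poly C}) : (forall t, p.[t] = 0) -> p = 0.
Proof. by move=> p0; apply: (@poly_inj_eq0 (fun n => n%:R)) => //; exact: (mulrIn (oner_neq0 C)). Qed.

Lemma poly_eq0_but (p : {poly C}) (bad : seq C) :
  (forall t, t \notin bad -> p.[t] = 0) -> p = 0.
Proof.
move=> p0; pose q := \prod_(z <- bad) ('X - z%:P).
have q0 : q != 0 by rewrite monic_neq0// monic_prod_XsubC.
have /eqP : p * q = 0.
  apply: poly_eq0 => t; rewrite hornerM.
  have [tb|/p0->] := boolP (t \in bad); last by rewrite mul0r.
  by have /rootP-> : root q t; [rewrite root_prod_XsubC|rewrite mulr0].
by rewrite mulf_eq0 (negPf q0) orbF => /eqP.
Qed.

Lemma fresh (bad : seq C) : exists t : C, t \notin bad.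
Proof.
apply: contrapT => h; suff /eqP : (1 : {poly C}) = 0 by rewrite oner_eq0.
by apply: (@poly_eq0_but _ bad) => t tb; case: h; exists t.
Qed.

Lemma eq_digits N a b a' b' : (a < N)%N -> (a' < N)%N ->
  (a + b * N = a' + b' * N)%N -> a = a' /\ b = b'.
Proof.
move=> aN a'N e; have N0 : (0 < N)%N by exact: leq_ltn_trans aN.
have := congr1 (modn^~ N) e; have := congr1 (divn^~ N) e; rewrite /=.
by rewrite ![(_ + _ * _)%N]addnC !divnMDl// !modnMDl !divn_small// !modn_small// !addn0.
Qed.

(** Kronecker substitution: with N above every exponent of F, replacing the i-th variable by X^(N^i)
    turns the exponents of a monomial into base N digits, so distinct monomials of F stay
    distinct. *)
Lemma ev_poly_eq0 F : (forall v, ev F v = 0) -> F = 0.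
Proof.
move=> F0; pose N := msize F; pose e (m : 'X_{1..3}) := (\sum_i m i * N ^ i)%N.
have inj_e : {in msupp F &, injective e}.
  have lt k : k \in msupp F -> forall i, (k i < N)%N.
    move=> kF i; apply: leq_ltn_trans (msize_mdeg_lt kF).
    by rewrite mdegE (bigD1 i)//= leq_addr.
  have eE k : e k = (k ord0 + (k (lift ord0 ord0) +
      k (lift ord0 (lift ord0 ord0)) * N) * N)%N.
    rewrite /e !big_ord_recl big_ord0 /= /bump /= addn0 expn0 muln1 expn1.
    by rewrite mulnDl -mulnA mulnn addn0.
  move=> m m' mF mF'; rewrite !eE.
  move=> /(eq_digits (lt _ mF _) (lt _ mF' _))[e0].
  move=> /(eq_digits (lt _ mF _) (lt _ mF' _))[e1 e2].
  apply/mnmP; move=> [[|[|[|//]]] i3].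
  - by move: e0; congr (m _ = m' _); apply: val_inj.
  - by move: e1; congr (m _ = m' _); apply: val_inj.
  - by move: e2; congr (m _ = m' _); apply: val_inj.
have p0 : curve F (\col_i 'X^(N ^ i)) = 0.
  by apply: poly_eq0 => t; rewrite curveE F0.
have monoE k : mmap1 (fun i => (\col_i 'X^(N ^ i)) i 0) k = 'X^(e k) :> {poly C}.
  by rewrite /e -prodrXr; apply: eq_bigr => i _; rewrite mxE -exprM mulnC.
apply/mpolyP => m; rewrite mcoeff0; apply/eqP; apply: contraT.
rewrite -mcoeff_msupp => mF.
have := congr1 (fun p : {poly C} => p`_(e m)) p0.
rewrite coef0 /curve /mmap coef_sum (bigD1_seq m)//= big1_seq => [|k /andP[km kF]].
  rewrite addr0 coefCM monoE coefXn eqxx mulr1 => Fm0.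
  by move: mF; rewrite mcoeff_msupp Fm0 eqxx.
rewrite coefCM monoE coefXn eq_sym [_ == _](_ : _ = false) ?mulr0//.
by apply: contraNF km => /eqP /inj_e ->.
Qed.

(** Each linear factor satisfies |x1 - r| <= |x0 - r| + |x1 - x0| <= (1 + |x1 - x0| / d) |x0 -
    r|. *)
Lemma roots_away (p : {poly C}) (x0 x1 d : C) : 0 < d ->
  (forall r, root p r -> d <= `|x0 - r|) ->
  `|p.[x1]| <= (1 + `|x1 - x0| / d) ^+ size p * `|p.[x0]|.
Proof.
move=> d0 far; have [->|p0] := eqVneq p 0.
  by rewrite !horner0 normr0 mulr0.
have [r pE] := closed_field_poly_normal p.
have sr : (size r <= size p)%N.
  by rewrite pE size_scale ?lead_coef_eq0// size_prod_XsubC.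
set K := 1 + _; have K1 : 1 <= K by rewrite lerDl divr_ge0// ltW.
apply: (@le_trans _ _ (K ^+ size r * `|p.[x0]|)); last first.
  by rewrite ler_wpM2r// ler_weXn2l.
have {}far z : z \in r -> d <= `|x0 - z|.
  by move=> zr; apply: far; rewrite pE rootZ ?lead_coef_eq0// root_prod_XsubC.
rewrite pE !hornerZ !normrM mulrCA ler_wpM2l// {pE sr}.
elim: r far => [|z r IH] far; first by rewrite !big_nil !hornerC expr0 mul1r.
rewrite !big_cons !hornerM !normrM !hornerXsubC exprS mulrACA.
apply: ler_pM => //; last by apply: IH => y yr; apply: far; rewrite inE yr orbT.
have dz : d <= `|x0 - z| by apply: far; rewrite inE eqxx.
have -> : x1 - z = (x0 - z) + (x1 - x0) by ring.
rewrite (le_trans (ler_normD _ _))// /K mulrDl mul1r lerD2l.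
by rewrite mulrAC ler_pdivlMr// ler_wpM2l.
Qed.

(** Homogeneity gives a <> 0; the point w at infinity follows because a polynomial in a that
    vanishes off 0 is zero. *)
Lemma ev_line0 d F u w : F \is d.-homog -> (forall t, ev F (u + t *: w) = 0) ->
  forall a b, ev F (a *: u + b *: w) = 0.
Proof.
move=> homF F0 a b; suff p0 : linep F (b *: w) u = 0.
  by have := linepE F (b *: w) u a; rewrite p0 horner0 addrC.
apply: (poly_eq0_but (bad := [:: 0])) => t; rewrite inE => t0; rewrite linepE.
rewrite addrC (_ : _ + _ = t *: (u + (b / t) *: w)).
  by rewrite (ev_scale _ _ homF) F0 mulr0.
by rewrite scalerDr scalerA mulrC divfK.
Qed.

Definition noline F := forall u w, (forall t, ev F (u + t *: w) = 0) ->
  w = 0 \/ exists k, u = k *: w.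

Lemma finite_zeros d F u w : F \is d.-homog -> noline F ->
  w != 0 -> (forall k, u <> k *: w) ->
  exists2 s : seq (C * C), (forall c, c \in s -> c != 0) &
   forall a b, (a, b) != 0 -> ev F (a *: u + b *: w) = 0 ->
     exists2 c, c \in s & a * c.2 = b * c.1.
Proof.
move=> homF nl w0 uNw; set p := linep F u w.
have p0 : p != 0.
  apply/eqP => p0; have [] := nl u w; last 2 first.
  - by apply/eqP.
  - by case=> k /uNw.
  by move=> t; rewrite -linepE -/p p0 horner0.
have [r pE] := closed_field_poly_normal p.
(* The pair (0, 1) stands for the point w, which u + t w misses. *)
exists ((0, 1) :: [seq (1, z) | z <- r]).
  move=> c; rewrite inE => /orP[/eqP->|/mapP[z _ ->]]; rewrite xpair_eqE/=.
    by rewrite oner_eq0 andbF.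
  by rewrite oner_eq0.
move=> a b ab0 Fab; have [a0|a0] := eqVneq a 0.
  by exists (0, 1); rewrite ?inE ?eqxx// a0 mul0r mulr0.
exists (1, b / a); last by rewrite /= mulr1 mulrC divfK.
rewrite inE; apply/orP; right; apply/mapP; exists (b / a) => //.
rewrite -root_prod_XsubC -(rootZ _ _ (_ : lead_coef p != 0)) ?lead_coef_eq0// -pE.
apply/rootP; rewrite linepE (_ : _ + _ = a^-1 *: (a *: u + b *: w)).
  by rewrite (ev_scale _ _ homF) Fab mulr0.
by rewrite scalerDr !scalerA mulVf// scale1r mulrC.
Qed.

Definition lin_subst F (A : 'M[C]_3) : {mpoly C[3]} :=
  F \mPo [tuple \sum_j A i j *: 'X_j | i < 3].

Lemma ev_lin_subst F A v : ev (lin_subst F A) v = ev F (A *m v).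
Proof.
rewrite /ev comp_mpoly_meval; apply: meval_eq => i.
rewrite tnth_mktuple mxE raddf_sum/=; apply: eq_bigr => j _.
by rewrite mevalZ mevalXU.
Qed.

Lemma lin_subst_homog d F A : F \is d.-homog -> lin_subst F A \is d.-homog.
Proof.
move=> homF0; have homF : {in msupp F, forall m, mdeg m = d} by exact/dhomogP.
rewrite /lin_subst comp_mpolyEX big_seq; apply: rpred_sum => m mF.
apply: rpredZ; rewrite comp_mpolyX -(homF _ mF) mdegE.
apply: (big_ind2 (fun (p : {mpoly C[3]}) n => p \is n.-homog)).
- exact: dhomog1.
- by move=> p n q k hp hq; exact: dhomogM.
- move=> i _; rewrite tnth_mktuple -[X in X.-homog]mul1n; apply: dhomogMn.
  by apply: rpred_sum => j _; apply: rpredZ; rewrite dhomogX /= mdeg1.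
Qed.

Lemma div_coord d F (i : 'I_3) : F \is d.+1.-homog ->
  (forall v, v i 0 = 0 -> ev F v = 0) ->
  exists2 H : {mpoly C[3]}, H \is d.-homog & forall v, ev F v = v i 0 * ev H v.
Proof.
move=> homF0 F0; have homF : {in msupp F, forall m, mdeg m = d.+1} by exact/dhomogP.
pose G := \sum_(m <- msupp F | m i == 0%N) F@_m *: 'X_[m].
pose H := \sum_(m <- msupp F | m i != 0%N) F@_m *: 'X_[(m - U_(i))%MM].
have FE : F = G + 'X_i * H.
  rewrite [LHS]mpolyE (bigID (fun m : 'X_{1..3} => m i == 0%N))/=; congr (_ + _).
  rewrite /H mulr_sumr; apply: eq_bigr => m mi.
  by rewrite -scalerAr -mpolyXD addmC submK// lep1mP.
(* G collects the monomials without the i-th variable; its value at v is that of F at v with the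
   i-th coordinate erased, hence 0. *)
have G0 : G = 0.
  apply: ev_poly_eq0 => v.
  pose v' := \col_j (if j == i then 0 else v j 0).
  have v'i : v' i 0 = 0 by rewrite mxE eqxx.
  have <- : ev G v' = ev G v.
    rewrite /ev /G !raddf_sum/=; apply: eq_bigr => m /eqP mi.
    rewrite !mevalZ !mevalX; congr (_ * _); apply: eq_bigr => j _.
    by rewrite mxE; case: eqP => [->|//]; rewrite mi.
  have := F0 _ v'i; rewrite {1}FE /ev mevalD mevalM mevalXU v'i mul0r addr0.
  by [].
exists H => [|v].
  rewrite /H big_seq_cond; apply: rpred_sum => m /andP[mF mi].
  apply: rpredZ; rewrite dhomogX /=; have := homF _ mF.
  have /submK {1}<- : (U_(i) <= m)%MM by rewrite lep1mP.
  by rewrite mdegD mdeg1 addn1 => -[->].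
by rewrite {1}FE G0 add0r /ev mevalM mevalXU.
Qed.

Lemma noline_const F : F != 0 -> F \is 0.-homog -> noline F.
Proof.
move=> F0 homF u w Fuw; case/eqP: F0; apply: ev_poly_eq0 => v.
have evE x : ev F x = ev F 0.
  by have := ev_scale 0 x homF; rewrite scale0r expr0 mul1r.
by rewrite evE -(evE (u + 0 *: w)).
Qed.

(** Induction on the degree: a line on which F vanishes is moved to the plane where the third
    coordinate is 0, and [div_coord] splits off that coordinate. *)
Lemma extract_lines d F : F != 0 -> F \is d.-homog ->
  exists (ls : seq 'rV[C]_3) (e : nat) (F2 : {mpoly C[3]}),
  [/\ (forall l, l \in ls -> l != 0), F2 != 0, F2 \is e.-homog, noline F2 &
   forall v, ev F v = \prod_(l <- ls) (l *m v) 0 0 * ev F2 v].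
Proof.
elim: d F => [|d IH] F F0 homF.
  exists [::], 0%N, F; split => //; first exact: noline_const.
  by move=> v; rewrite big_nil mul1r.
have [nl|] := pselect (noline F).
  by exists [::], d.+1, F; split => // v; rewrite big_nil mul1r.
move=> /existsNP[u /existsNP[w /not_implyP[Fuw /not_orP[/eqP w0 uNw]]]].
have {}uNw k : u <> k *: w by move=> uw; apply: uNw; exists k.
have [q Q] := independent_det w0 uNw; set A := cols3 w u q in Q.
have FA v : v (inord 2) 0 = 0 -> ev (lin_subst F A) v = 0.
  move=> v2; rewrite ev_lin_subst (vec3K v) v2 cols3_mul scale0r addr0 addrC.
  exact: ev_line0 homF Fuw _ _.
have [H homH HE] := div_coord (lin_subst_homog A homF) FA.
have H0 : lin_subst H (invmx A) != 0.
  apply: contra F0 => /eqP H0; apply/eqP/ev_poly_eq0 => v.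
  rewrite -(mulKVmx Q v) -ev_lin_subst HE -ev_lin_subst H0.
  by rewrite /ev meval0 mulr0.
have [ls [e [F2 [ls0 F20 homF2 nl FE]]]] := IH _ H0 (lin_subst_homog _ homH).
exists (row (inord 2) (invmx A) :: ls), e, F2; split => // [l|v].
  rewrite inE => /orP[/eqP->|/ls0//]; apply/eqP => /(congr1 (mulmx^~ A)).
  rewrite -row_mul mulVmx// mul0mx => /rowP/(_ (inord 2)).
  by rewrite !mxE eqxx => /eqP; rewrite oner_eq0.
rewrite big_cons -mulrA -FE ev_lin_subst -row_mul mxE -HE ev_lin_subst.
by rewrite mulKVmx.
Qed.

Lemma row_basis l : l != 0 -> exists2 A, A \in unitmx & l *m A = row3 1 0 0.
Proof.
move=> l0; have l0' : l 0 0 != 0 \/ l 0 1 != 0 \/ l 0 (inord 2) != 0.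
  have [e0|] := eqVneq (l 0 0) 0; last by left.
  have [e1|] := eqVneq (l 0 1) 0; last by right; left.
  right; right; apply: contra l0 => /eqP e2; apply/eqP/rowP.
  by apply: ord3P; rewrite mxE.
pose B (a b : 'cV[C]_3) : 'M[C]_3 := cols3 (vec3 (l 0 0) (a 0 0) (b 0 0))
  (vec3 (l 0 1) (a 1 0) (b 1 0)) (vec3 (l 0 (inord 2)) (a (inord 2) 0) (b (inord 2) 0)).
have H a b : B a b \in unitmx -> exists2 A, A \in unitmx & l *m A = row3 1 0 0.
  move=> Bu; exists (invmx (B a b)); first by rewrite unitmx_inv.
  have -> : l = row 0 (B a b).
    by apply/rowP; apply: ord3P; rewrite mxE cols3E vec3E.
  rewrite -row_mul mulmxV//; apply/rowP.
  by apply: ord3P; rewrite row3E !mxE -?val_eqE /= ?inordK.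
case: l0' => [x|[x|x]].
- apply: (H (vec3 0 1 0) (vec3 0 0 1)); rewrite unitmxE unitfE det3E !cols3E !vec3E.
  by apply: contra x => /eqP <-; apply/eqP; ring.
- apply: (H (vec3 1 0 0) (vec3 0 0 1)); rewrite unitmxE unitfE det3E !cols3E !vec3E.
  by apply: contra x; rewrite -oppr_eq0 => /eqP <-; apply/eqP; ring.
- apply: (H (vec3 1 0 0) (vec3 0 1 0)); rewrite unitmxE unitfE det3E !cols3E !vec3E.
  by apply: contra x => /eqP <-; apply/eqP; ring.
Qed.

Lemma complete_basis e : e != 0 -> exists u w, cols3 e u w \in unitmx.
Proof.
move=> e0; suff [u eu] : exists u, forall k, u <> k *: e.
  by have [w W] := independent_det e0 eu; exists u, w.
apply: contrapT => h.
have {}h u : exists k, u = k *: e.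
  by apply: contrapT => hk; apply: h; exists u => k uk; apply: hk; exists k.
have [a ea] := h (vec3 1 0 0); have [b eb] := h (vec3 0 1 0).
have /colP ea' := ea; have /colP eb' := eb.
have := ea' 0; have := ea' 1; have := eb' 1; rewrite !mxE /= => b1 a1 a0.
have /eqP : b * e 1 0 != 0 by rewrite -b1 oner_eq0.
have a0' : a != 0 by apply/eqP => a0'; move/eqP: a0; rewrite a0' mul0r oner_eq0.
move/eqP: a1; rewrite eq_sym mulf_eq0 (negPf a0')/= => /eqP ->.
by rewrite mulr0.
Qed.

Lemma line_zeros d F l : F \is d.-homog -> noline F -> l != 0 ->
  exists2 s : seq 'cV[C]_3, (forall x, x \in s -> x != 0 /\ l *m x = 0) &
   forall v, v != 0 -> l *m v = 0 -> ev F v = 0 ->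
     exists2 x, x \in s & exists2 k, k != 0 & v = k *: x.
Proof.
move=> homF nl l0; have [A Au lA] := row_basis l0.
have colA i : col i A = A *m delta_mx i 0 by rewrite colE.
have AE a b : a *: col 1 A + b *: col (inord 2) A = A *m vec3 0 a b.
  by apply/colP => i; rewrite !mxE sum3E !vec3E mulr0 add0r [a * _]mulrC [b * _]mulrC.
have inj (x : 'cV_3) : A *m x = 0 -> x = 0.
  by move=> /(congr1 (mulmx (invmx A))); rewrite mulKmx// mulmx0.
have [||s s0 sP] := finite_zeros (u := col 1 A) (w := col (inord 2) A) homF nl.
- apply/eqP => h; have := AE 0 1; rewrite h scale1r scale0r addr0 => /esym/inj.
  by move=> /vec3_eq0[_ _ /eqP]; rewrite oner_eq0.
- move=> k h; have := AE 1 (- k); rewrite h scale1r scaleNr subrr => /esym/inj.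
  by move=> /vec3_eq0[_ /eqP]; rewrite oner_eq0.
have lE x y z : l *m (A *m vec3 x y z) = x%:M.
  by rewrite mulmxA lA row3_mul mul1r !mul0r !addr0.
exists [seq A *m vec3 0 c.1 c.2 | c <- s].
  move=> x /mapP[c cs ->]; rewrite lE; split.
    apply: contra (s0 _ cs) => /eqP/inj/vec3_eq0[_ c1 c2].
    by case: (c) c1 c2 => /= _ _ -> ->.
  by apply/matrixP => i j; rewrite !mxE mul0rn.
move=> v v0 lv Fv; pose y := invmx A *m v.
have vE : v = A *m vec3 0 (y 1 0) (y (inord 2) 0).
  have yE : v = A *m y by rewrite mulKVmx.
  have y0 : y 0 0 = 0.
    have := lE (y 0 0) (y 1 0) (y (inord 2) 0); rewrite -vec3K -yE lv.
    by move=> /matrixP/(_ 0 0); rewrite !mxE eqxx.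
  by rewrite yE {1}(vec3K y) y0.
have y0 : (y 1 0, y (inord 2) 0) != 0.
  apply: contra v0 => /eqP[y1 y2]; rewrite vE y1 y2 (_ : vec3 0 0 0 = 0) ?mulmx0//.
  by apply/colP; apply: ord3P; rewrite vec3E mxE.
have := sP _ _ y0; rewrite AE -vE => /(_ Fv)[c cs e]; exists (A *m vec3 0 c.1 c.2).
  by apply/mapP; exists c.
have [c1|c1] := eqVneq c.1 0.
  have c2 : c.2 != 0 by apply: contra (s0 _ cs); case: (c) c1 => /= _ b -> /eqP ->.
  have y1 : y 1 0 = 0.
    by move/eqP: e; rewrite c1 mulr0 mulf_eq0 (negPf c2) orbF => /eqP.
  exists (y (inord 2) 0 / c.2).
    by rewrite mulf_neq0 ?invr_eq0//; apply: contra y0 => /eqP ->; rewrite y1.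
  by rewrite vE scalemxAr scale_vec3 y1 c1 !mulr0 divfK.
exists (y 1 0 / c.1).
  rewrite mulf_neq0 ?invr_eq0//; apply: contra y0 => /eqP y1; move/eqP: e.
  by rewrite y1 mul0r eq_sym mulf_eq0 (negPf c1) orbF => /eqP ->.
rewrite vE scalemxAr scale_vec3 mulr0 divfK// [_ * c.2]mulrAC e mulfK//.
Qed.

(** The lines joining e to u + t w form a pencil. Each l meets the curve in finitely many points,
    and each of these other than e lies on at most one line of the pencil, so only finitely many t
    are bad. *)
Lemma curve_avoid d F e u w (ls : seq 'rV[C]_3) : F \is d.-homog -> noline F ->
  cols3 e u w \in unitmx -> (forall l, l \in ls -> l != 0) ->
  exists bad : seq C, forall t x, t \notin bad -> ev F (u + t *: w + x *: e) = 0 ->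
    forall l, l \in ls -> l *m (u + t *: w + x *: e) != 0.
Proof.
move=> homF nl Au; elim: ls => [|l ls IH] ls0; first by exists [::].
have [bad badP] := IH (fun m mls => ls0 m (mem_behead (s := l :: ls) mls)).
have [s s0 sP] := line_zeros homF nl (ls0 l (mem_head _ _)).
pose A := cols3 e u w; pose c (x : 'cV[C]_3) i := (invmx A *m x) i 0.
exists ([seq c x (inord 2) / c x 1 | x <- s] ++ bad) => t x.
rewrite mem_cat negb_or => /andP[ts tb] Fv m; rewrite inE => /orP[/eqP->|]; last first.
  exact: badP.
set v := u + _ + _; have vE : v = A *m vec3 x 1 t.
  by rewrite /v cols3_mul scale1r [LHS]addrC addrA.
apply: contra ts => /eqP lv.
have v0 : v != 0.
  apply/eqP; rewrite vE => /(congr1 (mulmx (invmx A))); rewrite mulKmx// mulmx0.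
  by move=> /vec3_eq0[_ /eqP]; rewrite oner_eq0.
have [y ys [k k0 vy]] := sP _ v0 lv Fv; apply/mapP; exists y => //.
have : vec3 x 1 t = k *: (invmx A *m y) by rewrite scalemxAr -vy vE mulKmx.
rewrite (vec3K (invmx A *m y)) scale_vec3 => /vec3_inj[_ e1 ->].
have cy0 : c y 1 != 0.
  by apply/eqP => cy; move/eqP: e1; rewrite -/(c y 1) cy mulr0 oner_eq0.
by rewrite -/(c y _); apply: (mulIf cy0); rewrite divfK// mulrAC -e1 mul1r.
Qed.

(** If F(u + x e) were a nonzero constant c, homogeneity would give F(e + t u) = c t^d, and t = 0
    contradicts F(e) <> 0. *)
Lemma line_root d F e u : (0 < d)%N -> F \is d.-homog -> ev F e != 0 ->
  exists x, ev F (u + x *: e) = 0.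
Proof.
move=> d0 homF Fe; set p := linep F u e.
have [/size_poly1P[c c0 pc]|/closed_rootP[x /rootP]] := boolP (size p == 1%N); last first.
  by rewrite linepE => ?; exists x.
case/eqP: Fe; suff q0 : linep F e u - c *: 'X^d = 0.
  have := congr1 (fun q : {poly C} => q.[0]) q0.
  rewrite !hornerE linepE scale0r addr0 => /eqP; rewrite subr_eq0 => /eqP ->.
  by rewrite expr0n eqn0Ngt d0 mulr0.
apply: (poly_eq0_but (bad := [:: 0])) => t; rewrite inE => t0; rewrite !hornerE linepE.
have -> : e + t *: u = t *: (u + t^-1 *: e).
  by rewrite scalerDr scalerA mulfV// scale1r addrC.
by rewrite (ev_scale _ _ homF) -linepE -/p pc hornerC mulrC subrr.
Qed.

(** On a generic line through a point e off the cone, [line_root] finds a zero of F and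
    [curve_avoid] keeps it off the given lines. *)
Lemma avoid_lines d F (ls : seq 'rV[C]_3) : (0 < d)%N -> F \is d.-homog ->
  F != 0 -> noline F -> (forall l, l \in ls -> l != 0) ->
  exists v, [/\ v != 0, ev F v = 0 & forall l, l \in ls -> l *m v != 0].
Proof.
move=> d0 homF F0 nl ls0.
have [e Fe] : exists e, ev F e != 0.
  apply: contrapT => h; case/eqP: F0; apply: ev_poly_eq0 => v.
  by apply: contrapT => /eqP Fv; apply: h; exists v.
have e0 : e != 0 by apply: contra Fe => /eqP ->; rewrite (ev0 d0 homF).
have [u [w Au]] := complete_basis e0.
have [bad badP] := curve_avoid homF nl Au ls0; have [t tb] := fresh bad.
have [x Fx] := line_root (u + t *: w) d0 homF Fe.
exists (u + t *: w + x *: e); split => //; last exact: badP Fx.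
apply/eqP; have -> : u + t *: w + x *: e = cols3 e u w *m vec3 x 1 t.
  by rewrite cols3_mul scale1r [LHS]addrC addrA.
move=> /(congr1 (mulmx (invmx (cols3 e u w)))); rewrite mulKmx// mulmx0.
by move=> /vec3_eq0[_ /eqP]; rewrite oner_eq0.
Qed.

(** With f b = e / |b| the witness t satisfies f t = 1 + the sum of f over [bad], which exceeds
    every f b with b in [bad]. *)
Lemma fresh_small (bad : seq C) (e : C) : 0 < e ->
  exists t : C, [/\ 0 < t, t <= e & t \notin bad].
Proof.
move=> e0; pose f (b : C) := e / `|b|.
have f0 b : 0 <= f b by rewrite divr_ge0// ltW.
have S0 : 0 <= \sum_(b <- bad) f b by rewrite sumr_ge0.
have D0 : 0 < 1 + \sum_(b <- bad) f b by rewrite ltr_wpDr.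
exists (e / (1 + \sum_(b <- bad) f b)); split; first by rewrite divr_gt0.
  by rewrite ler_pdivrMr// ler_peMr ?lerDl// ltW.
set t := _ / _; have t0 : 0 < t by rewrite divr_gt0.
apply/negP => tb; have : f t <= \sum_(b <- bad) f b.
  by rewrite (big_rem _ tb)/= lerDl sumr_ge0.
rewrite /f gtr0_norm// /t invfM invrK mulrA divff ?gt_eqF// mul1r.
by rewrite gerDr ler10.
Qed.

Lemma poly_lipschitz0 (p : {poly C}) : exists2 B, 0 <= B &
  forall t, `|t| <= 1 -> `|p.[t] - p.[0]| <= B * `|t|.
Proof.
elim/poly_ind: p => [|p c [B B0 pB]].
  by exists 0 => // t _; rewrite !horner0 subrr normr0 mul0r.
exists (B + `|p.[0]|); first by rewrite addr_ge0.
move=> t t1; rewrite !hornerE ?mulr0 ?add0r addrK normrM ler_wpM2r//.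
have -> : p.[t] = (p.[t] - p.[0]) + p.[0] by ring.
rewrite (le_trans (ler_normD _ _))// lerD2r (le_trans (pB _ t1))//.
by rewrite ler_piMr.
Qed.

(* Moving the line through v0 and a point e off the cone, one of the roots on the
   nearby line stays close to v0, for otherwise roots_away bounds F away from 0. *)
Lemma cone_perfect d F v0 (ls : seq 'rV[C]_3) (dl : C) : F \is d.-homog -> F != 0 ->
  noline F -> (forall l, l \in ls -> l != 0) -> v0 != 0 -> ev F v0 = 0 -> 0 < dl ->
  exists v, [/\ v != 0, ev F v = 0, forall l, l \in ls -> l *m v != 0 &
                forall i, `|v i 0 - v0 i 0| < dl].
Proof.
move=> homF F0 nl ls0 v00 Fv0 dl0.
have [e Fe] : exists e, ev F e != 0.
  apply: contrapT => h; case/eqP: F0; apply: ev_poly_eq0 => v.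
  by apply: contrapT => /eqP Fv; apply: h; exists v.
have v0Ne k : v0 <> k *: e.
  move=> v0E; have := Fv0; rewrite v0E (ev_scale _ _ homF) => /eqP.
  rewrite mulf_eq0 (negPf Fe) orbF expf_eq0 => /andP[_ /eqP k0].
  by move: v00; rewrite v0E k0 scale0r eqxx.
have e0 : e != 0.
  apply/eqP => e0; have := ev_scale 0 v0 homF; rewrite scale0r Fv0 mulr0 -e0.
  by move/eqP; rewrite (negPf Fe).
have [w Au] := independent_det e0 v0Ne.
have [bad badP] := curve_avoid homF nl Au ls0.
have [x1 Fx1] : exists x1, ev F (v0 + x1 *: e) != 0.
  apply: contrapT => h; have H t : ev F (v0 + t *: e) = 0.
    by apply: contrapT => /eqP ?; apply: h; exists t.
  have := ev_line0 homF H 0 1; rewrite scale0r scale1r add0r.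
  by move/eqP; rewrite (negPf Fe).
have [B B0 pB] := poly_lipschitz0 (linep F v0 w).
have [B' B'0 GB] := poly_lipschitz0 (linep F (v0 + x1 *: e) w).
set g := `|ev F (v0 + x1 *: e)|; have g0 : 0 < g by rewrite normr_gt0.
(* M controls the displacement: |t w_i + r e_i| < eta M = dl as soon as t <= eta and |r| < eta. *)
pose M := 1 + (\sum_i `|e i 0| + \sum_i `|w i 0|).
have M0 : 0 < M by rewrite ltr_wpDr// addr_ge0// sumr_ge0.
pose eta := dl / M; have eta0 : 0 < eta by rewrite divr_gt0.
pose K := (1 + `|x1| / eta) ^+ (msize F).+1.
have K1 : 1 <= 1 + `|x1| / eta by rewrite lerDl divr_ge0// ltW.
have K0 : 0 <= K by rewrite exprn_ge0// (le_trans ler01).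
(* The single condition t D <= 1 yields t <= 1, t <= eta and t (B' + K B) < g. *)
pose D := 1 + (1 / eta + (B' + K * B + 1) / g).
have B20 : 0 < B' + K * B + 1 by rewrite ltr_wpDl// addr_ge0// mulr_ge0.
have D1 : 0 <= 1 / eta by rewrite divr_ge0// ltW.
have D2 : 0 <= (B' + K * B + 1) / g by rewrite divr_ge0// ltW.
have D0 : 0 < D by rewrite ltr_wpDr// addr_ge0.
have D'0 : 0 < D^-1 by rewrite invr_gt0.
have [t [t0 tD tb]] := fresh_small bad D'0.
have {}tD : t * D <= 1 by rewrite -ler_pdivlMr// div1r.
have t1 : `|t| <= 1.
  rewrite gtr0_norm// (le_trans _ tD)// ler_peMr ?(ltW t0)// lerDl addr_ge0//.
have teta : t <= eta.
  rewrite -[leRHS]mul1r -ler_pdivrMr// (le_trans _ tD)// ler_wpM2l ?(ltW t0)//.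
  by rewrite -[leLHS]div1r /D addrCA lerDl addr_ge0.
have tg : t * (B' + K * B) < g.
  apply: (@lt_le_trans _ _ (t * (B' + K * B + 1))).
    by rewrite ltr_pM2l// ltrDl.
  rewrite -[leRHS]mul1r -ler_pdivrMr// (le_trans _ tD)// -mulrA ler_wpM2l ?(ltW t0)//.
  by rewrite /D addrA lerDr addr_ge0.
have [r Fr re] : exists2 r, ev F (v0 + t *: w + r *: e) = 0 & `|r| < eta.
  apply: contrapT => h.
  have far r : root (linep F (v0 + t *: w) e) r -> eta <= `|0 - r|.
    move=> /rootP; rewrite linepE sub0r normrN => Fr.
    rewrite (real_leNgt (gtr0_real eta0) (normr_real _)); apply/negP => re.
    by apply: h; exists r.
  have := roots_away x1 eta0 far; rewrite !linepE scale0r addr0 subr0.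
  apply/negP; rewrite -real_ltNge ?normr_real//; last first.
    by rewrite ger0_real// mulr_ge0// exprn_ge0// (le_trans ler01).
  have Gt : g - B' * t <= `|ev F (v0 + t *: w + x1 *: e)|.
    have := GB _ t1; rewrite !linepE scale0r addr0 distrC (gtr0_norm t0) => h1.
    rewrite lerBlDl -lerBlDr (le_trans (lerB_dist _ _))// addrAC//.
  apply: (lt_le_trans _ Gt); rewrite ltrBrDl.
  have pt : `|ev F (v0 + t *: w)| <= B * t.
    by have := pB _ t1; rewrite !linepE scale0r addr0 Fv0 subr0 (gtr0_norm t0).
  apply: (le_lt_trans _ tg); rewrite mulrDr [t * B']mulrC lerD2l.
  have -> : t * (K * B) = K * (B * t) by ring.
  apply: ler_pM => //.
    by rewrite exprn_ge0// (le_trans ler01).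
  by rewrite /K ler_weXn2l// size_linep.
exists (v0 + t *: w + r *: e); split => //.
- have -> : v0 + t *: w + r *: e = cols3 e v0 w *m vec3 r 1 t.
    by rewrite cols3_mul scale1r [RHS]addrC addrA [RHS]addrC [RHS]addrA.
  apply/eqP => /(congr1 (mulmx (invmx (cols3 e v0 w)))); rewrite mulKmx// mulmx0.
  by move=> /vec3_eq0[_ /eqP]; rewrite oner_eq0.
- exact: badP Fr.
move=> i; rewrite !mxE.
have -> : v0 i 0 + t * w i 0 + r * e i 0 - v0 i 0 = t * w i 0 + r * e i 0 by ring.
rewrite (le_lt_trans (ler_normD _ _))// !normrM (gtr0_norm t0).
have -> : dl = eta * M by rewrite /eta divfK// gt_eqF.
have le_sum (x : 'cV[C]_3) : `|x i 0| <= \sum_j `|x j 0|.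
  by rewrite (bigD1 i)//= lerDl sumr_ge0.
apply: (@le_lt_trans _ _ (eta * (\sum_j `|e j 0| + \sum_j `|w j 0|))).
  rewrite mulrDr addrC lerD// ler_pM// ?normr_ge0 ?(ltW t0)// ltW//.
by rewrite ltr_pM2l// ltrDr.
Qed.

Lemma cvg_exp (T : Type) (G : set_system T) {FG : Filter G} (f : T -> C) (a : C) n :
  f @ G --> a -> (fun x => f x ^+ n) @ G --> a ^+ n.
Proof.
move=> fa; elim: n => [|n IH]; first by rewrite expr0; exact: cvg_cst.
rewrite exprS; under eq_fun do rewrite exprS; exact: cvgM.
Qed.

Lemma cvg_ev (T : Type) (G : set_system T) {FG : Filter G} F
    (f : T -> 'cV[C]_3) (a : 'cV[C]_3) :
  (forall i, (fun x => f x i 0) @ G --> a i 0) ->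
  (fun x => ev F (f x)) @ G --> ev F a.
Proof.
move=> fa; elim/mpolyind: F => [|c m p _ _ IH].
  rewrite /ev meval0; under eq_fun do rewrite meval0; exact: cvg_cst.
have E v : ev (c *: 'X_[m] + p) v = c * \prod_i v i 0 ^+ m i + ev p v.
  by rewrite /ev mevalD mevalZ mevalX.
rewrite E; under eq_fun do rewrite E; apply: cvgD => //; apply: cvgM; first exact: cvg_cst.
rewrite !big_ord_recl big_ord0; under eq_fun do rewrite !big_ord_recl big_ord0.
apply: cvgM; first exact: cvg_exp.
apply: cvgM; first exact: cvg_exp.
apply: cvgM; [exact: cvg_exp|exact: cvg_cst].
Qed.

Lemma ev_continuous F v (e : C) : 0 < e -> exists2 dl : C, 0 < dl &
  forall u, (forall i, `|u i 0 - v i 0| < dl) -> `|ev F u - ev F v| < e.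
Proof.
move=> e0; have : (fun u : 'cV[C]_3 => ev F u) @ v --> ev F v.
  by apply: (cvg_ev (G := nbhs v)) => i; exact: coord_continuous.
move=> /cvgr_distC_lt/(_ e e0); move=> /nbhs_ballP[dl /= dl0 H].
exists dl => // u hu; apply: H; split => // i j.
by rewrite ord1 /ball/= distrC.
Qed.

(* The cone of F minus finitely many planes is dense in the cone of F. *)
Lemma vanish_on_cone d F P (ls : seq 'rV[C]_3) : F \is d.-homog -> F != 0 ->
  noline F -> (forall l, l \in ls -> l != 0) ->
  (forall v, v != 0 -> ev F v = 0 -> (forall l, l \in ls -> l *m v != 0) -> ev P v = 0) ->
  forall v, v != 0 -> ev F v = 0 -> ev P v = 0.
Proof.
move=> homF F0 nl ls0 P0 v v0 Fv; apply: contrapT => /eqP Pv.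
have [dl dl0 H] : exists2 dl : C, 0 < dl &
    forall u, (forall i, `|u i 0 - v i 0| < dl) -> `|ev P u - ev P v| < `|ev P v|.
  by apply: ev_continuous; rewrite normr_gt0.
have [u [u0 Fu lu /H]] := cone_perfect homF F0 nl ls0 v0 Fv dl0.
by rewrite P0// sub0r normrN ltxx.
Qed.

End Forms.

(** * Matrix groups *)

Section MatrixGroups.
Variable C : numClosedFieldType.
Implicit Types (G D : set 'M[C]_3) (a b P : 'M[C]_3) (v : 'cV[C]_3) (l : 'rV[C]_3).

Lemma invmxM a b : a \in unitmx -> b \in unitmx -> invmx (a *m b) = invmx b *m invmx a.
Proof.
move=> au bu; have abu : a *m b \in unitmx by rewrite unitmx_mul au.
by apply: (can_inj (mulKmx abu)); rewrite mulmxV// -mulmxA mulKVmx// mulmxV.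
Qed.

Definition mxgroup G := [/\ G 1%:M, (forall a b, G a -> G b -> G (a *m b)),
  (forall a, G a -> G (invmx a)) & (forall a, G a -> \det a = 1)].

Definition mxfinite G := exists s : seq 'M[C]_3, forall a, G a -> a \in s.

Definition mxindex G D := exists s : seq 'M[C]_3, forall a, G a ->
  exists2 b, b \in s & G b /\ D (invmx b *m a).

Definition mxvabelian G := exists D, [/\ mxgroup D, D `<=` G,
  (forall a b, D a -> D b -> a *m b = b *m a) & mxindex G D].

(** For a subgroup of SL(3, C) this amounts to topological discreteness;
    [isolated_identity_discrete] proves the direction that is applied. *)
Definition mxdiscrete G := forall M : C, mxfinite [set a | G a /\ forall i j, `|a i j| <= M].

Lemma mxgroup_unit G a : mxgroup G -> G a -> a \in unitmx.
Proof. by case=> _ _ _ dG /dG da; rewrite unitmxE da unitr1. Qed.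

(** The tool for finite index: elements of G receive finitely many labels, those sharing a label lie
    in one left coset, and one element per label is chosen as representative. *)
Lemma mxindex_rel (I : eqType) (s : seq I) (r : 'M[C]_3 -> I -> Prop) G D :
  (forall a, G a -> exists2 i, i \in s & r a i) ->
  (forall a b i, G a -> G b -> r a i -> r b i -> D (invmx b *m a)) -> mxindex G D.
Proof.
move=> rs rD.
pose g i := if pselect (exists b, G b /\ r b i) is left e then projT1 (cid e) else 1%:M.
exists [seq g i | i <- s] => a Ga; have [i si rai] := rs a Ga.
exists (g i); first by apply/mapP; exists i.
rewrite /g; case: pselect => [e|[]]; last by exists a.
by case: cid => b /= [Gb rbi]; split => //; exact: rD rai rbi.
Qed.

Lemma mxvabelian_index G D : mxgroup G -> D `<=` G -> mxindex G D ->
  mxvabelian D -> mxvabelian G.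
Proof.
move=> gG DG [s sP] [E [gE ED cE [t tP]]]; exists E; split => //.
  by move=> a /ED/DG.
exists [seq b *m c | b <- s, c <- t] => a Ga.
have [b bs [Gb /tP[c ct [Dc Ec]]]] := sP a Ga.
exists (b *m c); first by apply/allpairsP; exists (b, c).
have [_ mG _ _] := gG; split; first exact: mG (DG _ Dc).
by rewrite invmxM ?(mxgroup_unit gG Gb) ?(mxgroup_unit gG (DG _ Dc))// -mulmxA.
Qed.

Lemma mxfinite_vabelian G : mxgroup G -> mxfinite G -> mxvabelian G.
Proof.
move=> gG [s sP]; exists [set 1%:M]; split.
- split => //.
  + by move=> a b -> ->; rewrite mulmx1.
  + by move=> a ->; rewrite invmx1.
  + by move=> a ->; rewrite det1.
- by move=> a ->; case: gG.
- by move=> a b -> ->.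
- by exists s => a Ga; exists a; [exact: sP|rewrite mulVmx// (mxgroup_unit gG)].
Qed.

Lemma mxdiscrete_sub G D : D `<=` G -> mxdiscrete G -> mxdiscrete D.
Proof. by move=> DG dG M; have [s sP] := dG M; exists s => a [/DG Ga aM]; exact: sP. Qed.

Definition mxconj P G := [set a | G (P *m a *m invmx P)].

Lemma mxconjK P a : P \in unitmx -> P *m (invmx P *m a *m P) *m invmx P = a.
Proof. by move=> Pu; rewrite !mulmxA mulmxV// mul1mx -mulmxA mulmxV// mulmx1. Qed.

Lemma mxconjVK P a : P \in unitmx -> invmx P *m (P *m a *m invmx P) *m P = a.
Proof. by move=> Pu; rewrite !mulmxA mulVmx// mul1mx -mulmxA mulVmx// mulmx1. Qed.

Lemma mxconjM P a b : P \in unitmx ->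
  P *m (a *m b) *m invmx P = P *m a *m invmx P *m (P *m b *m invmx P).
Proof. by move=> Pu; rewrite !mulmxA mulmxKV. Qed.

Lemma mxconj_inv P a : P \in unitmx -> a \in unitmx ->
  P *m invmx a *m invmx P = invmx (P *m a *m invmx P).
Proof.
by move=> Pu au; rewrite !invmxM ?unitmx_mul ?unitmx_inv ?Pu// invmxK mulmxA.
Qed.

Lemma mxconj_det P a : P \in unitmx -> \det (P *m a *m invmx P) = \det a.
Proof.
move=> Pu; rewrite !det_mulmx det_inv mulrAC mulfV ?mul1r//.
by move: Pu; rewrite unitmxE unitfE.
Qed.

Lemma mxconj_unit P a : P \in unitmx -> P *m a *m invmx P \in unitmx -> a \in unitmx.
Proof. by move=> Pu; rewrite !unitmxE mxconj_det. Qed.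

Lemma mxconj_group P G : P \in unitmx -> mxgroup G -> mxgroup (mxconj P G).
Proof.
move=> Pu gG; have [G1 mG iG dG] := gG; split; rewrite /mxconj /=.
- by rewrite mulmx1 mulmxV.
- by move=> a b Ga Gb; rewrite mxconjM//; exact: mG.
- move=> a Ga; rewrite mxconj_inv//; first exact: iG.
  by apply: mxconj_unit Pu _; exact: mxgroup_unit gG Ga.
- by move=> a /dG; rewrite mxconj_det.
Qed.

Lemma mxconj_vabelian P G : P \in unitmx -> mxgroup G ->
  mxvabelian (mxconj P G) -> mxvabelian G.
Proof.
move=> Pu gG [D [gD DG cD [s sP]]].
have Qu : invmx P \in unitmx by rewrite unitmx_inv.
have DE b : mxconj (invmx P) D b <-> D (invmx P *m b *m P) by rewrite /mxconj /= invmxK.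
exists (mxconj (invmx P) D); split.
- exact: mxconj_group.
- by move=> a /DE/DG; rewrite /mxconj /= mxconjK.
- move=> a b /DE Da /DE Db; have := cD _ _ Da Db.
  move=> /(congr1 (fun x => P *m x *m invmx P)).
  rewrite (mxconjM (invmx P *m a *m P))// (mxconjM (invmx P *m b *m P))//.
  by rewrite !mxconjK.
exists [seq P *m b *m invmx P | b <- s] => a Ga.
have [|b bs [Gb Db]] := sP (invmx P *m a *m P); first by rewrite /mxconj /= mxconjK.
exists (P *m b *m invmx P); first by apply/mapP; exists b.
have bu : b \in unitmx by apply: mxconj_unit Pu _; exact: mxgroup_unit gG Gb.
split => //; apply/DE; rewrite -mxconj_inv// !mulmxA mulVmx// mul1mx.
by move: Db; rewrite !mulmxA.
Qed.

Lemma mxconj_discrete P G : P \in unitmx -> mxdiscrete G -> mxdiscrete (mxconj P G).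
Proof.
move=> Pu dG M.
pose N := \sum_i \sum_j \sum_k \sum_h `|P i k| * `|M| * `|invmx P h j|.
have [s sP] := dG N; exists [seq invmx P *m b *m P | b <- s] => a [Ga aM].
apply/mapP; exists (P *m a *m invmx P); last by rewrite mxconjVK.
apply: sP; split => // i j.
rewrite /N (bigD1 i)//= (bigD1 j)//= mxE.
apply: (@le_trans _ _ (\sum_k \sum_h `|P i k| * `|M| * `|invmx P h j|)); last first.
  rewrite -addrA lerDl addr_ge0// sumr_ge0// => *.
    by rewrite !sumr_ge0// => *; rewrite sumr_ge0// => *; rewrite !mulr_ge0.
  by rewrite !sumr_ge0// => *; rewrite sumr_ge0// => *; rewrite sumr_ge0// => *;
     rewrite !mulr_ge0.
rewrite exchange_big/= (le_trans (ler_norm_sum _ _ _))// ler_sum// => h _.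
rewrite normrM mxE -mulr_suml ler_wpM2r// (le_trans (ler_norm_sum _ _ _))// ler_sum// => k _.
rewrite normrM ler_wpM2l//; have aM0 := aM k h.
by rewrite (le_trans aM0)// real_ler_norm// (ger0_real (le_trans _ aM0)).
Qed.

Definition stabv v G := [set a | G a /\ exists k, a *m v = k *: v].
Definition stabl l G := [set a | G a /\ exists k, l *m a = k *: l].

Lemma stabv_neq0 v G a k : mxgroup G -> v != 0 -> G a -> a *m v = k *: v -> k != 0.
Proof.
move=> gG v0 Ga av; apply: contra v0 => /eqP k0.
by rewrite -(mulKmx (mxgroup_unit gG Ga) v) av k0 scale0r mulmx0.
Qed.

Lemma stabl_neq0 l G a k : mxgroup G -> l != 0 -> G a -> l *m a = k *: l -> k != 0.
Proof.
move=> gG l0 Ga la; apply: contra l0 => /eqP k0.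
by rewrite -(mulmxK (mxgroup_unit gG Ga) l) la k0 scale0r mul0mx.
Qed.

Lemma stabv_group v G : v != 0 -> mxgroup G -> mxgroup (stabv v G).
Proof.
move=> v0 gG; have [G1 mG iG dG] := gG; split.
- by split => //; exists 1; rewrite mul1mx scale1r.
- move=> a b [Ga [k av]] [Gb [h bv]]; split; first exact: mG.
  by exists (h * k); rewrite -mulmxA bv -scalemxAr av scalerA.
- move=> a [Ga [k av]]; split; first exact: iG.
  exists k^-1; apply: (canLR (mulKmx (mxgroup_unit gG Ga))).
  by rewrite -scalemxAr av scalerA mulVf ?scale1r// (stabv_neq0 gG v0 Ga).
- by move=> a [/dG].
Qed.

Lemma stabl_group l G : l != 0 -> mxgroup G -> mxgroup (stabl l G).
Proof.
move=> l0 gG; have [G1 mG iG dG] := gG; split.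
- by split => //; exists 1; rewrite mulmx1 scale1r.
- move=> a b [Ga [k la]] [Gb [h lb]]; split; first exact: mG.
  by exists (k * h); rewrite mulmxA la -scalemxAl lb scalerA.
- move=> a [Ga [k la]]; split; first exact: iG.
  exists k^-1; apply: (canLR (mulmxK (mxgroup_unit gG Ga))).
  by rewrite -scalemxAl la scalerA mulVf ?scale1r// (stabl_neq0 gG l0 Ga).
- by move=> a [/dG].
Qed.

Lemma stabv_index v G (s : seq 'cV[C]_3) : mxgroup G -> v != 0 ->
  (forall a, G a -> exists2 x, x \in s & exists k, a *m v = k *: x) ->
  mxindex G (stabv v G).
Proof.
move=> gG v0 sP; have [G1 mG iG dG] := gG.
apply: (mxindex_rel (r := fun a x => exists k, a *m v = k *: x) sP).
move=> a b x Ga Gb [k av] [h bv]; split; first by apply: mG => //; exact: iG.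
have h0 : h != 0.
  apply: contra v0 => /eqP h0.
  by rewrite -(mulKmx (mxgroup_unit gG Gb) v) bv h0 scale0r mulmx0.
exists (k / h); rewrite -mulmxA av; apply: (canLR (mulKmx (mxgroup_unit gG Gb))).
by rewrite -scalemxAr bv scalerA divfK.
Qed.

Lemma stabl_index l G (s : seq 'rV[C]_3) : mxgroup G -> l != 0 ->
  (forall a, G a -> exists2 x, x \in s & exists k, l *m a = k *: x) ->
  mxindex G (stabl l G).
Proof.
move=> gG l0 sP; have [G1 mG iG dG] := gG.
(* Rows are acted on from the right, so left cosets are labelled by l a^-1 instead of l a. *)
apply: (mxindex_rel (s := s) (r := fun a x => exists k, l *m invmx a = k *: x)).
  by move=> a /iG/sP.
move=> a b x Ga Gb [k la] [h lb]; split; first by apply: mG => //; exact: iG.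
have k0 : k != 0.
  apply: contra l0 => /eqP k0.
  have := mulmxKV (mxgroup_unit gG Ga) l.
  by rewrite la k0 scale0r mul0mx => <-.
exists (h / k); rewrite mulmxA lb.
have -> : x = k^-1 *: (l *m invmx a) by rewrite la scalerA mulVf// scale1r.
by rewrite scalerA -scalemxAl mulmxKV// (mxgroup_unit gG Ga).
Qed.

End MatrixGroups.

(** * Stabilizer of a conic and a point on it *)

Section ParabolicConic.
Variable C : numClosedFieldType.
Implicit Types (G D : set 'M[C]_3) (a b P : 'M[C]_3) (v : 'cV[C]_3).

Lemma matrix3P a b : (forall i, [/\ a i 0 = b i 0, a i 1 = b i 1 &
  a i (inord 2) = b i (inord 2)]) -> a = b.
Proof.
by move=> ab; apply/matrixP => i; apply: ord3P; case: (ab i).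
Qed.

Definition conicq v : C := 2 * v 0 0 * v (inord 2) 0 - v 1 0 ^+ 2.

(* The projective transformation that acts on the points (t^2/2, t, 1) of the
   conic 2xz = y^2 as t |-> r t + s. *)
Definition aff (r s : C) : 'M[C]_3 :=
  cols3 (vec3 (r ^+ 2) 0 0) (vec3 (r * s) r 0) (vec3 (s ^+ 2 / 2) s 1).

Lemma affM r s r' s' : aff r s *m aff r' s' = aff (r * r') (r * s' + s).
Proof.
by apply: matrix3P; apply: ord3P; split; rewrite mul3E !cols3E !vec3E; field.
Qed.

Lemma aff10 : aff 1 0 = 1%:M.
Proof.
by rewrite one3E /aff expr1n expr0n mulr0 mul0r.
Qed.

Lemma scale_affM g r s g' r' s' :
  (g *: aff r s) *m (g' *: aff r' s') = (g * g') *: aff (r * r') (r * s' + s).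
Proof. by rewrite -scalemxAl -scalemxAr scalerA affM. Qed.

Lemma scale_aff_inj g r s g' r' s' : g != 0 -> g *: aff r s = g' *: aff r' s' ->
  [/\ g = g', r = r' & s = s'].
Proof.
move=> g0 /matrixP e; have eg : g = g'.
  by have := e (inord 2) (inord 2); rewrite mxE [RHS]mxE !cols3E !vec3E !mulr1.
split => //; [have := e 1 1|have := e 1 (inord 2)];
  by rewrite mxE [RHS]mxE !cols3E !vec3E -eg => /(mulfI g0).
Qed.

Lemma poly_coef0 (s : seq C) : (forall t, (Poly s).[t] = 0) -> forall i, s`_i = 0.
Proof. by move=> /poly_eq0 s0 i; rewrite -coef_Poly s0 coef0. Qed.

(** The image of (t^2 / 2, t, 1) satisfies the conic equation for all t. This is a polynomial of
    degree at most 3 in t, and its vanishing coefficients leave only the parameters g, r, s. *)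
Lemma conic_stabilizer_form a : \det a = 1 ->
  (exists k, a *m vec3 1 0 0 = k *: vec3 1 0 0) ->
  (forall v, conicq v = 0 -> conicq (a *m v) = 0) ->
  exists g r s, [/\ g != 0, r != 0 & a = g *: aff r s].
Proof.
move=> da [al a1] aQ.
have {}a1 i : a i 0 = (al *: vec3 1 0 0) i 0.
  by rewrite -a1 mul3E !vec3E mulr1 !mulr0 !addr0.
have a00 : a 0 0 = al by rewrite a1 mxE vec3E mulr1.
have a10 : a 1 0 = 0 by rewrite a1 mxE vec3E mulr0.
have a20 : a (inord 2) 0 = 0 by rewrite a1 mxE vec3E mulr0.
set u := a 0 1; set v := a 0 (inord 2); set be := a 1 1; set w := a 1 (inord 2).
set m := a (inord 2) 1; set ga := a (inord 2) (inord 2).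
have E t : (Poly [:: 2 * v * ga - w ^+ 2; 2 * (u * ga + v * m - be * w);
    al * ga + 2 * u * m - be ^+ 2; al * m]).[t] = 0.
  have := aQ (vec3 (t ^+ 2 / 2) t 1); rewrite horner_Poly /=.
  rewrite /conicq !mul3E !vec3E a00 a10 a20 -/u -/v -/be -/w -/m -/ga => h.
  rewrite -[RHS]h; last by field.
  by field.
have c := poly_coef0 E.
have := c 0%N; have := c 1%N; have := c 2%N; have := c 3%N => /= {c E}.
move: da; rewrite det3E a00 a10 a20 -/u -/v -/be -/w -/m -/ga => da amE.
have {}da : al * (be * ga - w * m) = 1 by rewrite -da; ring.
have al0 : al != 0.
  by apply/eqP => al0; move/eqP: da; rewrite al0 mul0r eq_sym oner_eq0.
have m0 : m = 0 by move/eqP: amE; rewrite mulf_eq0 (negPf al0) => /eqP.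
rewrite m0 !mulr0 !addr0 => e2 e1 e0.
move: da; rewrite m0 mulr0 subr0 => da.
have g0 : ga != 0.
  by apply/eqP => g0; move/eqP: da; rewrite g0 !mulr0 eq_sym oner_eq0.
have b0 : be != 0.
  by apply/eqP => b0; move/eqP: da; rewrite b0 mul0r mulr0 eq_sym oner_eq0.
have {e2} e2 : al = be ^+ 2 / ga by apply: (mulIf g0); rewrite divfK//; apply/eqP; rewrite -subr_eq0 e2.
have {e1} e1 : u = be * w / ga.
  apply: (mulIf g0); rewrite divfK//; apply/eqP; rewrite -subr_eq0.
  by move/eqP: e1; rewrite mulf_eq0 pnatr_eq0.
have {e0} e0 : v = w ^+ 2 / 2 / ga.
  apply: (mulIf g0); rewrite divfK//; apply: (@mulfI _ 2); first by rewrite pnatr_eq0.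
  rewrite [RHS]mulrC divfK ?pnatr_eq0// mulrA.
  by apply/eqP; rewrite -subr_eq0 e0.
exists ga, (be / ga), (w / ga); split => //; first by rewrite mulf_neq0 ?invr_eq0.
apply: matrix3P; apply: ord3P; split; rewrite [RHS]mxE !cols3E !vec3E.
all: rewrite ?a00 ?a10 ?a20 -/u -/v -/be -/w -/m -/ga ?m0 ?e2 ?e1 ?e0.
all: try by field.
Qed.

Lemma aff_unit (g r s : C) : g != 0 -> r != 0 -> (g *: aff r s : 'M[C]_3) \in unitmx.
Proof.
move=> g0 r0; rewrite unitmxE detZ unitfE mulf_neq0 ?expf_neq0//.
rewrite det3E !cols3E !vec3E (_ : _ + _ = r ^+ 3); last by ring.
by rewrite expf_neq0.
Qed.

Lemma inv_scale_aff (g r s : C) : g != 0 -> r != 0 ->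
  invmx (g *: aff r s) = g^-1 *: aff r^-1 (- (s / r)).
Proof.
move=> g0 r0; apply: (can_inj (mulKmx (aff_unit s g0 r0))).
rewrite mulmxV ?aff_unit// scale_affM !mulfV// mulrN mulrC divfK// addNr.
by rewrite scale1r aff10.
Qed.

(* Without translations the group is commutative. With a translation, conjugation
   multiplies its length by r, so discreteness leaves finitely many values of r. *)
Lemma aff_discrete_vabelian G : mxgroup G -> mxdiscrete G ->
  (forall a, G a -> exists g r s, [/\ g != 0, r != 0 & a = g *: aff r s]) ->
  mxvabelian G.
Proof.
move=> gG dG GE; have [G1 mG iG detG] := gG.
have [[g0 [s0 [g00 s00 Gg]]]|noT] :=
  pselect (exists g s, [/\ g != 0, s != 0 & G (g *: aff 1 s)]); last first.
  exists G; split => //; last first.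
    by exists [:: 1%:M] => a Ga; exists 1%:M; rewrite ?inE// invmx1 mul1mx.
  move=> a b Ga Gb.
  have [g [r [s [g0 r0 aE]]]] := GE _ Ga; have [g' [r' [s' [g0' r0' bE]]]] := GE _ Gb.
  rewrite aE bE !scale_affM [r' * r]mulrC [g' * g]mulrC; congr (_ *: aff _ _).
  (* If the two compositions differ, the commutator of a and b is a translation by their
     difference. *)
  apply: contrapT => /eqP; rewrite -subr_eq0 => d0; apply: noT.
  exists 1, (r * s' + s - (r' * s + s')); split; rewrite ?oner_eq0//.
  suff -> : 1 *: aff 1 (r * s' + s - (r' * s + s')) = a *m b *m invmx (b *m a).
    by apply: (mG); [exact: mG|apply: (iG); exact: mG].
  have bau : b *m a \in unitmx by rewrite unitmx_mul !(mxgroup_unit gG).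
  apply: (canRL (mulmxK bau)).
  rewrite aE bE !scale_affM; congr (_ *: aff _ _); try by ring.
have conjE g r s : g != 0 -> r != 0 ->
    (g *: aff r s) *m (g0 *: aff 1 s0) *m invmx (g *: aff r s) = g0 *: aff 1 (r * s0).
  move=> gn rn; apply: (canLR (mulmxK (aff_unit s gn rn))).
  by rewrite !scale_affM; congr (_ *: aff _ _); ring.
have conjG g r s : g != 0 -> r != 0 -> G (g *: aff r s) -> G (g0 *: aff 1 (r * s0)).
  by move=> gn rn Ga; rewrite -(conjE g r s)//; apply: (mG); [exact: mG|exact: iG].
(* M bounds the entries of g0 times any translation no longer than s0, so [dG M] lists all those
   that lie in G. *)
pose M := `|g0| * (1 + (`|s0| + `|s0| ^+ 2)).
have bdd x : `|x| <= `|s0| -> forall i j, `|(g0 *: aff 1 x) i j| <= M.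
  move=> xs i j; rewrite mxE normrM ler_wpM2l//.
  have h1 : `|x ^+ 2 / 2| <= `|s0| ^+ 2.
    rewrite normrM normfV normrX ler_pdivrMr; last by rewrite normr_gt0 pnatr_eq0.
    rewrite (@ger0_norm _ 2)// -[leLHS]mulr1 ler_pM ?exprn_ge0 ?ler1n//.
    by rewrite lerXn2r// nnegrE.
  move: i j; apply: ord3P; apply: ord3P; rewrite cols3E vec3E;
    rewrite ?expr1n ?mul1r ?normr0 ?normr1 ?addr_ge0 ?exprn_ge0// ?lerDl ?addr_ge0 ?exprn_ge0//.
  - by rewrite (le_trans xs)// addrCA lerDl addr_ge0// exprn_ge0.
  - by rewrite (le_trans h1)// addrA lerDr addr_ge0.
  - by rewrite (le_trans xs)// addrCA lerDl addr_ge0// exprn_ge0.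
have [sM sMP] := dG M.
(* If |r| < 1, repeated conjugation shrinks the translation and produces infinitely many bounded
   elements of G. *)
have norm1 g r s : g != 0 -> r != 0 -> G (g *: aff r s) -> ~ `|r| < 1.
  move=> gn rn Ga r1.
  have Gn n : G (g0 *: aff 1 (r ^+ n * s0)).
    elim: n => [|n IH]; first by rewrite expr0 mul1r.
    rewrite exprS -mulrA.
    suff -> : g0 *: aff 1 (r * (r ^+ n * s0)) =
        (g *: aff r s) *m (g0 *: aff 1 (r ^+ n * s0)) *m invmx (g *: aff r s).
      by apply: (mG); [exact: mG|exact: iG].
    apply: (canRL (mulmxK (aff_unit s gn rn))).
    by rewrite !scale_affM; congr (_ *: aff _ _); ring.
  pose f n := g0 *: aff 1 (r ^+ n * s0).
  have f_inj : injective f.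
    move=> m n /(scale_aff_inj g00)[_ _ /(mulIf s00)] /(congr1 Num.norm).
    rewrite !normrX => e; apply/eqP; rewrite eqn_leq.
    by rewrite -!(ler_iXn2l (_ : 0 < `|r|) r1) ?normr_gt0// e lexx.
  have := uniq_leq_size (s1 := [seq f n | n <- iota 0 (size sM).+1]) (s2 := sM).
  rewrite map_inj_uniq// iota_uniq size_map size_iota ltnn => /(_ isT) h.
  suff : false by []; apply: h => x /mapP[n _ ->]; apply: sMP; split; first exact: Gn.
  apply: bdd; rewrite normrM ler_piMl// normrX exprn_ile1// ltW//.
have norm2 g r s : g != 0 -> r != 0 -> G (g *: aff r s) -> `|r| = 1.
  move=> gn rn Ga; apply/eqP; rewrite eq_le !real_leNgt ?normr_real ?real1//.
  apply/andP; split; apply/negP; last exact: norm1 gn rn Ga.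
  move=> r1; have /iG := Ga; rewrite inv_scale_aff// => /norm1; apply.
  - by rewrite invr_eq0.
  - by rewrite invr_eq0.
  - by rewrite normfV invf_lt1// normr_gt0.
pose D := [set a | G a /\ exists g s, g != 0 /\ a = g *: aff 1 s].
apply: (mxvabelian_index (D := D)) => //.
- by move=> a [].
(* The label of an element is the conjugate of the fixed translation by it. Since |r| = 1 the length
   is kept, so the label lies in [sM]; equal labels mean equal r. *)
- apply: (mxindex_rel (s := sM) (r := fun a x => a *m (g0 *: aff 1 s0) *m invmx a = x)).
    move=> a Ga; have [g [r [s [gn rn aE]]]] := GE _ Ga.
    eexists; last by []; rewrite aE conjE//; apply: sMP; split.
      by apply: (conjG g r s) => //; rewrite -aE.
    by apply: bdd; rewrite normrM (norm2 g r s) ?mul1r// -aE.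
  move=> a b x Ga Gb; have [g [r [s [gn rn aE]]]] := GE _ Ga.
  have [g' [r' [s' [gn' rn' bE]]]] := GE _ Gb; rewrite aE bE !conjE// => <-.
  move=> /(scale_aff_inj g00)[_ _ /(mulIf s00) rr]; rewrite -aE -bE; split.
    by apply: (mG) => //; exact: iG.
  exists (g / g'), ((s - s') / r); split; first by rewrite mulf_neq0 ?invr_eq0.
  apply: (canLR (mulKmx (mxgroup_unit gG Gb))); rewrite aE bE scale_affM rr mulr1.
  by congr (_ *: aff _ _); field.
exists D; split => //.
- split.
  + by split => //; exists 1, 0; rewrite oner_eq0 scale1r aff10.
  + move=> a b [Ga [g [s [gn aE]]]] [Gb [g' [s' [gn' bE]]]]; split; first exact: mG.
    exists (g * g'), (s' + s); rewrite mulf_neq0//; split => //.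
    by rewrite aE bE scale_affM !mul1r.
  + move=> a [Ga [g [s [gn aE]]]]; split; first exact: iG.
    exists g^-1, (- s); rewrite invr_eq0; split => //.
    by rewrite aE inv_scale_aff ?oner_eq0// invr1 mulr1.
  + by move=> a [/detG].
- move=> a b [Ga [g [s [gn ->]]]] [Gb [g' [s' [gn' ->]]]].
  by rewrite !scale_affM; congr (_ *: aff _ _); ring.
- by exists [:: 1%:M] => a Da; exists 1%:M; rewrite ?inE// invmx1 mul1mx; split => //;
     split => //; exists 1, 0; rewrite oner_eq0 scale1r aff10.
Qed.

Lemma parabolic_conic_vabelian G : mxgroup G -> mxdiscrete G ->
  (forall a, G a -> exists k, a *m vec3 1 0 0 = k *: vec3 1 0 0) ->
  (forall a v, G a -> conicq v = 0 -> conicq (a *m v) = 0) ->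
  mxvabelian G.
Proof.
move=> gG dG Ge Gq; apply: aff_discrete_vabelian => // a Ga.
have [_ _ _ detG] := gG.
by apply: conic_stabilizer_form; [exact: detG|exact: Ge|move=> v; exact: Gq].
Qed.

End ParabolicConic.

(** * Stabilizers of curves without lines *)

Section CurveStabilizer.
Variable C : numClosedFieldType.
Implicit Types (F : {mpoly C[3]}) (G D : set 'M[C]_3) (a b P : 'M[C]_3) (v : 'cV[C]_3).

Record curve_stabilizer d F G : Prop := CurveStabilizer {
  cs_group : mxgroup G;
  cs_discrete : mxdiscrete G;
  cs_deg : (0 < d)%N;
  cs_homog : F \is d.-homog;
  cs_neq0 : F != 0;
  cs_noline : noline F;
  cs_inv : forall a v, G a -> v != 0 -> ev F v = 0 -> ev F (a *m v) = 0 }.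

(** Only zeros are compared, since F may be a power of a quadratic form. *)
Definition conic_form F := exists2 P, P \in unitmx &
  forall v, v != 0 -> (ev F (P *m v) = 0 <-> conicq v = 0).

Lemma mulmx_eq0 n (P : 'M[C]_n) (v : 'cV[C]_n) : P \in unitmx -> (P *m v == 0) = (v == 0).
Proof.
move=> Pu; apply/eqP/eqP => [Pv|->]; last by rewrite mulmx0.
by rewrite -(mulKmx Pu v) Pv mulmx0.
Qed.

Lemma cs_conj d F G P : P \in unitmx -> curve_stabilizer d F G ->
  curve_stabilizer d (lin_subst F P) (mxconj P G).
Proof.
move=> Pu [gG dG d0 homF F0 nl inv]; split => //.
- exact: mxconj_group.
- exact: mxconj_discrete.
- exact: lin_subst_homog.
- apply: contra F0 => /eqP F0; apply/eqP/ev_poly_eq0 => v.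
  by rewrite -(mulKVmx Pu v) -ev_lin_subst F0 /ev meval0.
- move=> u w Fuw; have [|Pw|[k Pu']] := nl (P *m u) (P *m w).
  + by move=> t; rewrite -(Fuw t) ev_lin_subst mulmxDr -scalemxAr.
  + by left; apply/eqP; rewrite -(mulmx_eq0 _ Pu) Pw.
  + right; exists k; apply: (can_inj (mulKmx Pu)).
    by rewrite Pu' scalemxAr.
- move=> a v Ga v0; rewrite !ev_lin_subst => Fv.
  have := inv _ _ Ga _ Fv; rewrite mulmx_eq0// => /(_ v0).
  by rewrite -!mulmxA mulKmx.
Qed.

Lemma conic_form_subst F P : P \in unitmx -> conic_form (lin_subst F P) -> conic_form F.
Proof.
move=> Pu [Q Qu FQ]; exists (P *m Q); first by rewrite unitmx_mul Pu.
by move=> v v0; rewrite -mulmxA -ev_lin_subst; exact: FQ.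
Qed.

Lemma cs_sub d F G D : mxgroup D -> D `<=` G -> curve_stabilizer d F G ->
  curve_stabilizer d F D.
Proof.
move=> gD DG [gG dG d0 homF F0 nl inv]; split => //; first exact: mxdiscrete_sub dG.
by move=> a v /DG; exact: inv.
Qed.

(** A substitute for tangency that is visibly preserved by the group: by [cs_meets_once] such lines
    are permuted. *)
Definition meets_once F (l : 'rV[C]_3) := exists x, [/\ x != 0, ev F x = 0, l *m x = 0 &
  forall v, v != 0 -> ev F v = 0 -> l *m v = 0 -> exists k, v = k *: x].

Lemma cs_meets_once d F G l a : curve_stabilizer d F G -> meets_once F l -> G a ->
  meets_once F (l *m a).
Proof.
move=> cs [x [x0 Fx lx lP]] Ga; have gG := cs_group cs.
have au := mxgroup_unit gG Ga; have [_ _ iG _] := gG.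
exists (invmx a *m x); split.
- by rewrite mulmx_eq0 ?unitmx_inv.
- by apply: (cs_inv cs) => //; exact: iG.
- by rewrite -mulmxA mulKVmx.
move=> v v0 Fv lav; have [||k avE] := lP (a *m v) _ (cs_inv cs Ga v0 Fv).
- by rewrite mulmx_eq0.
- by rewrite mulmxA.
by exists k; rewrite scalemxAr -avE mulKmx.
Qed.

End CurveStabilizer.

(** * Curves invariant under a unipotent one-parameter group *)

Section Unipotent.
Variable C : numClosedFieldType.
Implicit Types (F : {mpoly C[3]}) (G D : set 'M[C]_3) (a b P : 'M[C]_3) (v : 'cV[C]_3).

Definition affset : set 'M[C]_3 :=
  [set a | exists g r s, [/\ g != 0, r != 0 & a = g *: aff r s]].

Lemma affset_mul a b : affset a -> affset b -> affset (a *m b).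
Proof.
move=> [g [r [s [g0 r0 ->]]]] [g' [r' [s' [g0' r0' ->]]]].
by exists (g * g'), (r * r'), (r * s' + s); rewrite scale_affM !mulf_neq0.
Qed.

Lemma affset_inv a : affset a -> affset (invmx a).
Proof.
move=> [g [r [s [g0 r0 ->]]]]; rewrite inv_scale_aff//.
by exists g^-1, r^-1, (- (s / r)); rewrite !invr_eq0.
Qed.

Lemma affset1 : affset 1%:M.
Proof. by exists 1, 1, 0; rewrite oner_eq0 scale1r aff10. Qed.

(** In the plane z = 1 this carries the parabola x = y^2 / 2 to x = y^2 / 2 + c. *)
Definition shift (c : C) : 'M[C]_3 := cols3 (vec3 1 0 0) (vec3 0 1 0) (vec3 c 0 1).

Lemma shift_mul c x y z : shift c *m vec3 x y z = vec3 (x + c * z) y z.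
Proof.
rewrite cols3_mul !scale_vec3 !add_vec3 !mulr0 !mulr1 !addr0 add0r.
by rewrite [z * c]mulrC add0r.
Qed.

Lemma shift_det c : \det (shift c) = 1.
Proof. by rewrite det3E !cols3E !vec3E; ring. Qed.

Lemma shift_unit c : shift c \in unitmx.
Proof. by rewrite unitmxE shift_det unitr1. Qed.

Lemma inv_shift_mul c x y z : invmx (shift c) *m vec3 x y z = vec3 (x - c * z) y z.
Proof.
by apply: (canLR (mulKmx (shift_unit c))); rewrite shift_mul subrK.
Qed.

Lemma vec3_neq0 (x y z : C) : (x != 0) || (y != 0) || (z != 0) -> vec3 x y z != 0.
Proof.
by apply: contraL => /eqP/vec3_eq0[-> -> ->]; rewrite eqxx.
Qed.

(** A nonconstant q takes every value, while p has finitely many roots. This forces a group element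
    to send a whole parabola into a single one. *)
Lemma poly_finite_range (p q : {poly C}) : p != 0 ->
  (forall t, p.[q.[t]] = 0) -> exists c, q = c%:P.
Proof.
move=> p0 pq; have [|h] := leqP (size q) 1.
  by move=> /size1_polyC ->; eexists.
case/eqP: p0; apply: poly_eq0 => y.
have [x /rootP] : exists x, root (q - y%:P) x.
  apply: closed_rootP; rewrite size_polyDl ?size_polyN.
    by case: (size q) h => [|[]].
  by rewrite (leq_ltn_trans (size_polyC_leq1 _)).
by rewrite !hornerE => /eqP; rewrite subr_eq0 => /eqP <-.
Qed.

(* The orbits in the plane z = 1 are the parabolas x - y^2 / 2 = c. One parabola is
   a conic; several of them are permuted by the group, which then fixes e1. *)
Lemma unipotent_curve d F G : curve_stabilizer d F G ->
  (forall x y z t, vec3 x y z != 0 -> ev F (vec3 x y z) = 0 ->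
     ev F (vec3 (x + t * y + t ^+ 2 / 2 * z) (y + t * z) z) = 0) ->
  mxvabelian G \/ conic_form F.
Proof.
move=> cs orb; have homF := cs_homog cs; have nl := cs_noline cs.
have evZ k x y z : ev F (vec3 (k * x) (k * y) (k * z)) = k ^+ d * ev F (vec3 x y z).
  by rewrite -scale_vec3 (ev_scale _ _ homF).
(* For y <> 0 the orbit of (x, y, 0) is the line z = 0 without e1, and F cannot vanish on a line. *)
have z0 x y : ev F (vec3 x y 0) = 0 -> y = 0.
  move=> Fxy; apply: contrapT => /eqP y0.
  have [t||[k]] := nl (vec3 x y 0) (vec3 y 0 0).
  - have := orb x y 0 t (vec3_neq0 _) Fxy; rewrite y0 orbT => /(_ isT).
    by rewrite scale_vec3 add_vec3 !mulr0 !addr0.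
  - by move=> /vec3_eq0[/eqP]; rewrite (negPf y0).
  - by rewrite scale_vec3 => /vec3_inj[_ /eqP]; rewrite mulr0 (negPf y0).
have orbE x y : ev F (vec3 x y 1) = 0 <-> ev F (vec3 (x - y ^+ 2 / 2) 0 1) = 0.
  have n1 (x' y' : C) : vec3 x' y' 1 != 0 by apply: vec3_neq0; rewrite oner_eq0 orbT.
  split=> h.
    have := orb _ _ _ (- y) (n1 _ _) h; rewrite !mulr1 addrN.
    by congr (ev F (vec3 _ _ _) = _); field.
  have := orb _ _ _ y (n1 _ _) h; rewrite !mulr1 add0r.
  by congr (ev F (vec3 _ _ _) = _); field.
pose p := linep F (vec3 0 0 1) (vec3 1 0 0).
have pE c : p.[c] = ev F (vec3 c 0 1).
  by rewrite linepE scale_vec3 add_vec3 !mulr0 !addr0 add0r mulr1.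
have p0 : p != 0.
  apply/eqP => p0; have [t||[k]] := nl (vec3 0 0 1) (vec3 1 0 0).
  - by rewrite -linepE -/p p0 horner0.
  - by move=> /vec3_eq0[/eqP]; rewrite oner_eq0.
  - by rewrite scale_vec3 => /vec3_inj[_ _ /eqP]; rewrite mulr0 oner_eq0.
have norm1 x y z : z != 0 -> ev F (vec3 x y z) = 0 ->
    p.[x / z - (y / z) ^+ 2 / 2] = 0.
  move=> zn Fv; rewrite pE -orbE.
  have := evZ z^-1 x y z; rewrite Fv mulr0 mulVf// ![z^-1 * _]mulrC.
  by [].
have l00 : row3 0 0 1 != 0 :> 'rV[C]_3.
  by apply/eqP => /rowP/(_ (inord 2)); rewrite row3E mxE => /eqP; rewrite oner_eq0.
have [c1 pc1] : exists c, p.[c] = 0.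
  have [|v [v0 Fv lv]] :=
    avoid_lines (ls := [:: row3 0 0 1]) (cs_deg cs) homF (cs_neq0 cs) nl.
    by move=> l; rewrite inE => /eqP ->.
  have := lv _ (mem_head _ _); rewrite (vec3K v) row3_mul !mul0r !add0r mul1r => vz.
  exists (v 0 0 / v (inord 2) 0 - (v 1 0 / v (inord 2) 0) ^+ 2 / 2).
  apply: norm1; last by rewrite -vec3K.
  by apply: contra vz => /eqP ->; apply/eqP/matrixP => i j; rewrite !mxE mul0rn.
(* Every parabola passes through e1 at infinity: its point with y = 1 / s, rescaled by s^2, is
   polynomial in s and equals (1/2, 0, 0) at s = 0. *)
have Fe1 x : ev F (vec3 x 0 0) = 0.
  have s0 : curve F (\col_i [:: c1 *: 'X^2 + (1 / 2)%:P; 'X; 'X^2]`_i) = 0.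
    apply: (poly_eq0_but (bad := [:: 0])) => s; rewrite inE => sn; rewrite curveE.
    rewrite (_ : \col_i _ = vec3 (c1 * s ^+ 2 + 1 / 2) s (s ^+ 2)); last first.
      by apply/colP; apply: ord3P; rewrite !mxE ?inordK//= !hornerE.
    have -> : vec3 (c1 * s ^+ 2 + 1 / 2) s (s ^+ 2) =
        s ^+ 2 *: vec3 (c1 + s^-1 ^+ 2 / 2) s^-1 1.
      by rewrite scale_vec3; congr vec3; field.
    rewrite (ev_scale _ _ homF) (_ : ev F _ = 0) ?mulr0//.
    by apply/orbE; rewrite addrK -pE.
  have := congr1 (fun q : {poly C} => q.[0]) s0; rewrite /= horner0 curveE.
  rewrite (_ : \col_i _ = vec3 (1 / 2) 0 0); last first.
    by apply/colP; apply: ord3P; rewrite !mxE ?inordK//= !hornerE ?expr0n /= ?mulr0 ?add0r.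
  move=> h; have := evZ (2 * x) (1 / 2) 0 0; rewrite h !mulr0.
  by congr (ev F (vec3 _ _ _) = _); field.
have [one|] := pselect (forall c, p.[c] = 0 -> c = c1).
  right; exists (shift c1); first exact: shift_unit.
  move=> v; rewrite (vec3K v) shift_mul.
  set x := v 0 0; set y := v 1 0; set z := v (inord 2) 0 => v0.
  rewrite /conicq !vec3E; have [zz|zn] := eqVneq z 0.
    rewrite zz !mulr0 addr0 sub0r; split=> [/z0->|/eqP].
      by rewrite expr0n oppr0.
    by rewrite oppr_eq0 expf_eq0 => /andP[_ /eqP->]; exact: Fe1.
  split=> [/(norm1 _ _ _ zn)/one e|e].
    have -> : x = (c1 - c1 + (y / z) ^+ 2 / 2) * z.
      by rewrite -[X in X - _]e; field.
    by field.
  have := evZ z ((x + c1 * z) / z) (y / z) 1; rewrite mulr1 !(mulrC z) !divfK//.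
  move=> ->; rewrite (_ : ev F _ = 0) ?mulr0//; apply/orbE.
  rewrite -pE (_ : _ - _ = c1) //.
  have -> : x = y ^+ 2 / (2 * z).
    apply: (@mulfI _ (2 * z)); first by rewrite mulf_neq0 ?pnatr_eq0.
    rewrite [RHS]mulrC divfK ?mulf_neq0 ?pnatr_eq0//.
    by apply/eqP; rewrite -subr_eq0 -e; apply/eqP; ring.
  by field.
move=> /existsNP[c2 /not_implyP[pc2 /eqP c21]]; left.
have [r pr] := closed_field_poly_normal p.
have rootr c : p.[c] = 0 -> c \in r.
  move=> pc; rewrite -root_prod_XsubC -(rootZ _ _ (_ : lead_coef p != 0)) ?lead_coef_eq0//.
  by rewrite -pr; apply/rootP.
have point c y : p.[c] = 0 -> ev F (vec3 (c + y ^+ 2 / 2) y 1) = 0.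
  by move=> pc; apply/orbE; rewrite addrK -pE.
have once0 : meets_once F (row3 0 0 1).
  exists (vec3 1 0 0); split.
  - by rewrite vec3_neq0// oner_eq0.
  - exact: Fe1.
  - by rewrite row3_mul !mulr0 !mul0r !addr0; apply/matrixP => i j; rewrite !mxE mul0rn.
  - move=> v; rewrite (vec3K v); move: (v 0 0) (v 1 0) (v (inord 2) 0) => x y z _ Fv.
    move=> /matrixP/(_ 0 0); rewrite row3_mul !mxE eqxx mulr1n.
    rewrite !mul0r !add0r mul1r => zz; move: Fv; rewrite zz => /z0 ->.
    by exists x; rewrite scale_vec3 mulr1 !mulr0.
(* A line with al <> 0 meets both parabolas c1 and c2; one with al = 0 and be <> 0 meets a parabola
   and passes through e1. Only z = 0 remains. *)
have once_only l : meets_once F l -> exists k, l = k *: row3 0 0 1.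
  rewrite (row3K l); set al := l 0 0; set be := l 0 1; set ga := l 0 (inord 2).
  move=> [x [x0 _ _ xP]].
  have on_l c y : p.[c] = 0 -> al * (c + y ^+ 2 / 2) + be * y + ga = 0 ->
      exists k, vec3 (c + y ^+ 2 / 2) y 1 = k *: x.
    move=> pc e; apply: xP; first by rewrite vec3_neq0// oner_eq0 !orbT.
      exact: point.
    by rewrite row3_mul mulr1 e; apply/matrixP => i j; rewrite !mxE mul0rn.
  have al0 : al = 0.
    apply: contrapT => /eqP aln.
    have root_l c : exists y, al * (c + y ^+ 2 / 2) + be * y + ga = 0.
      pose q := sqrtC (be ^+ 2 - 2 * al * (al * c + ga)); exists ((q - be) / al).
      have -> : al * (c + ((q - be) / al) ^+ 2 / 2) + be * ((q - be) / al) + ga =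
        al * c + ga + (q ^+ 2 - be ^+ 2) / (2 * al) by field.
      by rewrite /q sqrtCK; field.
    have [y1 /(on_l _ _ pc1)[k1 e1]] := root_l c1.
    have [y2 /(on_l _ _ pc2)[k2 e2]] := root_l c2.
    have k20 : k2 != 0.
      apply/eqP => k20; move: e2; rewrite k20 scale0r => /vec3_eq0[_ _ /eqP].
      by rewrite oner_eq0.
    have : vec3 (c1 + y1 ^+ 2 / 2) y1 1 = (k1 / k2) *: vec3 (c2 + y2 ^+ 2 / 2) y2 1.
      by rewrite e1 e2 scalerA divfK.
    rewrite scale_vec3 mulr1 => /vec3_inj[+ + kk]; rewrite -kk !mul1r => + y12.
    by rewrite y12 => /addIr/eqP; rewrite eq_sym (negPf c21).
  have be0 : be = 0.
    apply: contrapT => /eqP ben.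
    have [|k e] := on_l c1 (- ga / be) pc1; first by rewrite al0 mul0r add0r; field.
    have [||k' e'] := xP (vec3 1 0 0) _ (Fe1 1).
    - by rewrite vec3_neq0// oner_eq0.
    - by rewrite row3_mul al0 !mulr0 mul0r !addr0; apply/matrixP => i j; rewrite !mxE mul0rn.
    move: e e'; rewrite (vec3K x) !scale_vec3.
    move=> /vec3_inj[_ _ e1] /vec3_inj[e2 _ /eqP].
    rewrite eq_sym mulf_eq0 => /orP[] /eqP z'.
      by move/eqP: e2; rewrite z' mul0r oner_eq0.
    by move/eqP: e1; rewrite z' mulr0 oner_eq0.
  exists ga; rewrite al0 be0; apply/matrixP => i; rewrite ord1; apply: ord3P; rewrite [RHS]mxE !row3E;
    by rewrite ?mulr0 ?mulr1.
have G_form a : G a -> exists2 c, p.[c] = 0 &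
    affset (invmx (shift c) *m a *m shift c1).
  move=> Ga; have [k ka] := once_only _ (cs_meets_once cs once0 Ga).
  have a20 : a (inord 2) 0 = 0.
    by move/matrixP/(_ 0 0): ka; rewrite mul3E [RHS]mxE !row3E !mul0r !add0r mul1r mulr0.
  have a21 : a (inord 2) 1 = 0.
    by move/matrixP/(_ 0 1): ka; rewrite mul3E [RHS]mxE !row3E !mul0r !add0r mul1r mulr0.
  have e10 : vec3 1 0 0 != 0 :> 'cV[C]_3 by rewrite vec3_neq0// oner_eq0.
  have ae1 : a *m vec3 1 0 0 = vec3 (a 0 0) (a 1 0) 0.
    by apply/colP; apply: ord3P; rewrite mul3E !vec3E ?a20; ring.
  have a10 : a 1 0 = 0.
    by have := cs_inv cs Ga e10 (Fe1 1); rewrite ae1 => /z0.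
  have [_ _ _ detG] := cs_group cs.
  have ga0 : a (inord 2) (inord 2) != 0.
    apply/eqP => g0; have := detG _ Ga; rewrite det3E a20 a21 g0 !mulr0 !subrr.
    by rewrite !mulr0 !addr0 subr0 => /eqP; rewrite eq_sym oner_eq0.
  set al := a 0 0 in ae1; set u := a 0 1; set v := a 0 (inord 2).
  set be := a 1 1; set w := a 1 (inord 2); set ga := a (inord 2) (inord 2) in ga0.
  have aE x y z : a *m vec3 x y z = vec3 (al * x + u * y + v * z) (be * y + w * z) (ga * z).
    by apply/colP; apply: ord3P; rewrite mul3E !vec3E ?a20 ?a21 ?a10 -/al -/u -/v -/be -/w -/ga; ring.
  (* q t is the parameter of the parabola through the image of (c1 + t^2 / 2, t, 1). It is always a
     root of p, hence constant. *)
  pose q := Poly [:: (al * c1 + v) / ga - (w / ga) ^+ 2 / 2;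
    u / ga - be * w / ga ^+ 2; al / (2 * ga) - (be / ga) ^+ 2 / 2].
  have qE t : q.[t] = (al * (c1 + t ^+ 2 / 2) + u * t + v) / ga - ((be * t + w) / ga) ^+ 2 / 2.
    by rewrite horner_Poly /=; field.
  have pq t : p.[q.[t]] = 0.
    rewrite qE; apply: norm1 => //.
    have := cs_inv cs Ga (_ : vec3 (c1 + t ^+ 2 / 2) t 1 != 0) (point _ _ pc1).
    rewrite aE !mulr1; apply.
    by rewrite vec3_neq0// oner_eq0 !orbT.
  have [c qc] := poly_finite_range p0 pq.
  exists c; first by have := pq 0; rewrite qc hornerC.
  have He1 x : invmx (shift c) *m a *m shift c1 *m vec3 x 0 0 = vec3 (al * x) 0 0.
    by rewrite -2!mulmxA shift_mul aE inv_shift_mul !mulr0 !addr0 subr0.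
  apply: conic_stabilizer_form.
  - by rewrite !det_mulmx det_inv !shift_det invr1 !mul1r mulr1 detG.
  - by exists al; rewrite He1 scale_vec3 mulr1 !mulr0.
  move=> x; rewrite (vec3K x); move: (x 0 0) (x 1 0) (x (inord 2) 0) => {}x y z.
  rewrite /conicq !vec3E; have [->|zn] := eqVneq z 0.
    rewrite mulr0 sub0r => /eqP; rewrite oppr_eq0 expf_eq0 => /andP[_ /eqP ->].
    by rewrite He1 !vec3E mulr0 expr0n subr0.
  move=> xyz; rewrite -!mulmxA shift_mul aE inv_shift_mul !vec3E.
  have xE : x = y ^+ 2 / (2 * z).
    apply: (@mulfI _ (2 * z)); first by rewrite mulf_neq0 ?pnatr_eq0.
    rewrite [RHS]mulrC divfK ?mulf_neq0 ?pnatr_eq0//.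
    by apply/eqP; rewrite -subr_eq0 -xyz; apply/eqP; ring.
  have cE : c = (al * (c1 + (y / z) ^+ 2 / 2) + u * (y / z) + v) / ga -
      ((be * (y / z) + w) / ga) ^+ 2 / 2 by rewrite -qE qc hornerC.
  by rewrite xE cE; field; rewrite ga0 zn.
pose D := [set a | G a /\ affset (invmx (shift c1) *m a *m shift c1)].
have [G1 mG iG detG] := cs_group cs.
have Su := shift_unit c1.
have gD : mxgroup D.
  split.
  - by split => //; rewrite mulmx1 mulVmx//; exact: affset1.
  - move=> a b [Ga Da] [Gb Db]; split; first exact: mG.
    by have := affset_mul Da Db; rewrite !mulmxA mulmxK.
  - move=> a [Ga Da]; split; first exact: iG.
    have := affset_inv Da; have au := mxgroup_unit (cs_group cs) Ga.
    by rewrite !invmxM ?unitmx_mul ?unitmx_inv ?Su ?au// invmxK mulmxA.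
  - by move=> a [/detG].
apply: (mxvabelian_index (D := D)) => //.
- by move=> a [].
- apply: (mxindex_rel (s := r) (r := fun a c => affset (invmx (shift c) *m a *m shift c1))).
    by move=> a /G_form[c /rootr cr ac]; exists c.
  move=> a b c Ga Gb ac bc; split; first by apply: (mG) => //; exact: iG.
  have bu := mxgroup_unit (cs_group cs) Gb; have Scu := shift_unit c.
  have := affset_mul (affset_inv bc) ac.
  rewrite !invmxM ?unitmx_mul ?unitmx_inv ?Su ?Scu ?bu// invmxK !mulmxA.
  by rewrite mulmxK.
apply: (mxconj_vabelian Su) => //; apply: aff_discrete_vabelian.
- exact: mxconj_group.
- apply: mxconj_discrete => //; apply: mxdiscrete_sub (cs_discrete cs).
  by move=> a [].
- by move=> a [_]; rewrite mxconjVK.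
Qed.

End Unipotent.

(** * Curves invariant under a diagonal one-parameter group *)

Section Torus.
Variable C : numClosedFieldType.
Implicit Types (F : {mpoly C[3]}) (G D : set 'M[C]_3) (g h P : 'M[C]_3) (v : 'cV[C]_3).

(** The curve X^a Y^b = 1 is parametrized by (t^b, t^-a); Bezout coefficients of a and b express t
    through X and Y. *)
Lemma coprime_param (a b : nat) (X Y : C) : (0 < a)%N -> coprime a b ->
  X != 0 -> Y != 0 -> X ^+ a * Y ^+ b = 1 ->
  exists2 t, t != 0 & t ^+ b = X /\ t ^+ a = Y^-1.
Proof.
move=> a0 cab X0 Y0 XY; case: (egcdnP b a0) => km kn e _.
rewrite (eqP cab) in e.
set W := Y^-1; have W0 : W != 0 by rewrite invr_eq0.
have Xa : X ^+ a = W ^+ b.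
  by apply: (mulIf (expf_neq0 b Y0)); rewrite XY exprVn mulVf// expf_neq0.
exists (X^-1 ^+ kn * W ^+ km); first by rewrite mulf_neq0// expf_neq0// invr_eq0.
rewrite !exprMn -!exprM; split.
  have -> : W ^+ (km * b) = X ^+ (km * a) by rewrite mulnC exprM -Xa -exprM mulnC.
  by rewrite e exprD expr1 exprVn mulrA mulVf ?mul1r// expf_neq0.
rewrite e exprD expr1 mulrA [(kn * b)%N]mulnC [W ^+ _]exprM -Xa.
by rewrite -exprM [(a * kn)%N]mulnC exprVn mulVf ?mul1r// expf_neq0.
Qed.

Lemma coprime_inj (a b : nat) (s t : C) : (0 < a)%N -> coprime a b ->
  s != 0 -> t != 0 -> s ^+ a = t ^+ a -> s ^+ b = t ^+ b -> s = t.
Proof.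
move=> a0 cab s0 t0 ea eb; case: (egcdnP b a0) => km kn e _.
rewrite (eqP cab) in e.
have : s ^+ (km * a) = t ^+ (km * a) by rewrite mulnC !exprM ea.
by rewrite e !exprD !expr1 ![(kn * b)%N]mulnC !exprM eb; apply: mulfI; rewrite !expf_neq0.
Qed.

Lemma coef1_XsubC_exp (c : C) n :
  (('X - c%:P) ^+ n)`_0 = (- c) ^+ n /\ (('X - c%:P) ^+ n.+1)`_1 = n.+1%:R * (- c) ^+ n.
Proof.
have c0 m : (('X - c%:P) ^+ m)`_0 = (- c) ^+ m.
  by rewrite -horner_coef0 horner_exp !hornerE.
split => //; elim: n => [|n IH]; first by rewrite expr1 expr0 coefB coefX coefC subr0 mulr1.
rewrite exprS mulrBl coefB coefXM coefCM /= c0 IH exprS -[n.+2]addn1 natrD.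
by ring.
Qed.

Lemma coef_top_XsubC_exp (c : C) n : (('X - c%:P) ^+ n.+1)`_n = - (n.+1%:R * c).
Proof.
have top m : (('X - c%:P) ^+ m)`_m = 1.
  have /monicP := monic_exp m (monicXsubC c).
  by rewrite lead_coefE size_exp_XsubC.
elim: n => [|n IH]; first by rewrite expr1 coefB coefX coefC sub0r mul1r.
rewrite exprS mulrBl coefB coefXM coefCM /= IH top -[n.+2]addn1 natrD.
by ring.
Qed.

Section TorusCurve.
Variables (a b d : nat) (F : {mpoly C[3]}) (G : set 'M[C]_3).
Hypothesis (a0 : (0 < a)%N) (b0 : (0 < b)%N) (cab : coprime a b).
Hypothesis cs : curve_stabilizer d F G.
Hypothesis orb : forall x y z t, t != 0 -> vec3 x y z != 0 -> ev F (vec3 x y z) = 0 ->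
  ev F (vec3 (t ^+ (a + b) * x) y (t ^+ a * z)) = 0.

Let evZ k x y z : ev F (vec3 (k * x) (k * y) (k * z)) = k ^+ d * ev F (vec3 x y z).
Proof. by rewrite -scale_vec3 (ev_scale _ _ (cs_homog cs)). Qed.

Let line_all u w : (forall s, s != 0 -> ev F (u + s *: w) = 0) ->
  w = 0 \/ exists k, u = k *: w.
Proof.
move=> h; apply: (cs_noline cs) => t; rewrite -linepE.
suff -> : linep F u w = 0 by rewrite horner0.
by apply: (poly_eq0_but (bad := [:: 0])) => s; rewrite inE linepE; exact: h.
Qed.

Let abN0 : (0 < a + b)%N. Proof. by rewrite addn_gt0 a0. Qed.

(** On a side of the coordinate triangle the points other than the two vertices form one orbit, so
    one of them on the curve would put the whole line on it. The next two lemmas treat the other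
    sides alike. *)
Lemma torus_z0 x y : ev F (vec3 x y 0) = 0 -> x = 0 \/ y = 0.
Proof.
move=> Fxy; have [->|x0] := eqVneq x 0; first by left.
have [->|y0] := eqVneq y 0; first by right.
have [s s0||[k]] := line_all (u := vec3 0 y 0) (w := vec3 x 0 0).
- have t0 : (a + b).-root s != 0 by rewrite rootC_eq0.
  have := orb t0 _ Fxy; rewrite rootCK// mulr0 scale_vec3 add_vec3 !mulr0 !addr0 add0r.
  by apply; apply: vec3_neq0; rewrite x0.
- by move=> /vec3_eq0[/eqP]; rewrite (negPf x0).
- by rewrite scale_vec3 => /vec3_inj[_ /eqP]; rewrite mulr0 (negPf y0).
Qed.

Lemma torus_y0 x z : ev F (vec3 x 0 z) = 0 -> x = 0 \/ z = 0.
Proof.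
move=> Fxz; have [->|x0] := eqVneq x 0; first by left.
have [->|z0] := eqVneq z 0; first by right.
have [s s0||[k]] := line_all (u := vec3 0 0 z) (w := vec3 x 0 0).
- have t0 : b.-root s != 0 by rewrite rootC_eq0.
  have := orb t0 _ Fxz; set t := b.-root s in t0 *.
  have -> : vec3 (t ^+ (a + b) * x) 0 (t ^+ a * z) =
      t ^+ a *: (vec3 0 0 z + s *: vec3 x 0 0).
    rewrite scale_vec3 add_vec3 scale_vec3 !mulr0 !addr0 add0r mulr0 exprD -mulrA.
    by rewrite /t rootCK.
  rewrite (ev_scale _ _ (cs_homog cs)) => /(_ _)/eqP.
  rewrite mulf_eq0 !expf_eq0 (negPf t0) !andbF /= => h; apply/eqP/h.
  by apply: vec3_neq0; rewrite x0.
- by move=> /vec3_eq0[/eqP]; rewrite (negPf x0).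
- by rewrite scale_vec3 => /vec3_inj[_ _ /eqP]; rewrite mulr0 (negPf z0).
Qed.

Lemma torus_x0 y z : ev F (vec3 0 y z) = 0 -> y = 0 \/ z = 0.
Proof.
move=> Fyz; have [->|y0] := eqVneq y 0; first by left.
have [->|z0] := eqVneq z 0; first by right.
have [s s0||[k]] := line_all (u := vec3 0 y 0) (w := vec3 0 0 z).
- have t0 : a.-root s != 0 by rewrite rootC_eq0.
  have := orb t0 _ Fyz; rewrite rootCK// mulr0 scale_vec3 add_vec3 !mulr0 !addr0 add0r.
  by apply; apply: vec3_neq0; rewrite y0 orbT.
- by move=> /vec3_eq0[_ _ /eqP]; rewrite (negPf z0).
- by rewrite scale_vec3 => /vec3_inj[_ /eqP]; rewrite mulr0 (negPf y0).
Qed.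

Lemma torus_move x y x' y' : x != 0 -> y != 0 -> x' != 0 -> y' != 0 ->
  x ^+ a * y ^+ b = x' ^+ a * y' ^+ b ->
  ev F (vec3 x y 1) = 0 -> ev F (vec3 x' y' 1) = 0.
Proof.
move=> x0 y0 x'0 y'0 e Fxy.
have [||| t t0 [tb ta]] := coprime_param (X := x' / x) (Y := y' / y) a0 cab.
- by rewrite mulf_neq0 ?invr_eq0.
- by rewrite mulf_neq0 ?invr_eq0.
- by rewrite !expr_div_n mulf_div -e divff// mulf_neq0// expf_neq0.
have := orb t0 _ Fxy; have -> : vec3 (t ^+ (a + b) * x) y (t ^+ a * 1) =
    t ^+ a *: vec3 x' y' 1.
  rewrite scale_vec3 exprD tb ta; congr vec3; field; rewrite ?x0 ?y0 ?y'0 //.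
rewrite (ev_scale _ _ (cs_homog cs)) => /(_ _)/eqP.
rewrite mulf_eq0 !expf_eq0 (negPf t0) !andbF /= => h; apply/eqP/h.
by apply: vec3_neq0; rewrite x0.
Qed.

(** The orbits off the coordinate lines are x^a y^b = k z^(a + b); the one of parameter k is tested
    at its point with x = z = 1 and y = [b.-root k]. *)
Definition torus_param k := k != 0 /\ ev F (vec3 1 (b.-root k) 1) = 0.

Lemma torus_paramP x y k : k != 0 -> x ^+ a * y ^+ b = k ->
  torus_param k <-> ev F (vec3 x y 1) = 0.
Proof.
move=> k0 e; have x0 : x != 0.
  by apply: contra k0; rewrite -e => /eqP ->; rewrite expr0n eqn0Ngt a0 mul0r.
have y0 : y != 0.
  by apply: contra k0; rewrite -e => /eqP ->; rewrite expr0n eqn0Ngt b0 mulr0.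
split=> [[_]|h]; last split => //.
- by apply: torus_move => //; rewrite ?oner_eq0 ?rootC_eq0// expr1n mul1r rootCK.
- by apply: torus_move h => //; rewrite ?oner_eq0 ?rootC_eq0// expr1n mul1r rootCK.
Qed.

Lemma torus_param_of x y z : x != 0 -> y != 0 -> z != 0 -> ev F (vec3 x y z) = 0 ->
  torus_param ((x / z) ^+ a * (y / z) ^+ b).
Proof.
move=> x0 y0 z0 Fv; apply/(torus_paramP (x := x / z) (y := y / z)) => //.
  by rewrite mulf_neq0// expf_neq0// mulf_neq0 ?invr_eq0.
by have := evZ z^-1 x y z; rewrite Fv mulr0 mulVf// ![z^-1 * _]mulrC.
Qed.

Let rowneq0 (x y z : C) : (x != 0) || (y != 0) || (z != 0) -> row3 x y z != 0.
Proof.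
apply: contraL => /eqP/matrixP e; have := e 0 0; have := e 0 1; have := e 0 (inord 2).
by rewrite !row3E !mxE => -> -> ->; rewrite eqxx.
Qed.

Lemma torus_exists : exists k, torus_param k.
Proof.
have [|v [v0 Fv lv]] := avoid_lines (ls := [:: row3 1 0 0; row3 0 1 0; row3 0 0 1])
  (cs_deg cs) (cs_homog cs) (cs_neq0 cs) (cs_noline cs).
  by move=> l; rewrite !inE => /or3P[]/eqP->; apply: rowneq0; rewrite oner_eq0 ?orbT.
move: v0 Fv lv; rewrite (vec3K v); move: (v 0 0) (v 1 0) (v (inord 2) 0) => x y z v0 Fv lv.
have nz (w : C) : w%:M != 0 :> 'M_1 -> w != 0.
  by apply: contra => /eqP ->; apply/eqP/matrixP => i j; rewrite !mxE mul0rn.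
exists ((x / z) ^+ a * (y / z) ^+ b); apply: torus_param_of => //; apply: nz.
- by have := lv (row3 1 0 0); rewrite row3_mul !inE eqxx !mul0r !addr0 mul1r; apply.
- by have := lv (row3 0 1 0); rewrite row3_mul !inE eqxx !mul0r add0r addr0 mul1r orbT; apply.
- by have := lv (row3 0 0 1); rewrite row3_mul !inE eqxx !mul0r !add0r mul1r !orbT; apply.
Qed.

(** These vertices are the limits of an orbit for t tending to infinity and to 0. Both are values at
    0 of polynomial curves on which F vanishes, the first one after rescaling. *)
Lemma torus_vertices x : ev F (vec3 x 0 0) = 0 /\ ev F (vec3 0 x 0) = 0.
Proof.
have [k [k0 Fk]] := torus_exists; set c := b.-root k in Fk.
have c0 : c != 0 by rewrite rootC_eq0.
have n1 : vec3 1 c 1 != 0 by apply: vec3_neq0; rewrite oner_eq0.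
have Ft t : t != 0 -> ev F (vec3 (t ^+ (a + b)) c (t ^+ a)) = 0.
  by move=> t0; have := orb t0 n1 Fk; rewrite !mulr1.
have P1 : curve F (\col_i [:: 'X^(a + b); c%:P; 'X^a]`_i) = 0.
  apply: (poly_eq0_but (bad := [:: 0])) => t; rewrite inE => t0; rewrite curveE -(Ft t t0).
  by congr ev; apply/colP; apply: ord3P; rewrite !mxE ?inordK//= !hornerE.
have P2 : curve F (\col_i [:: 1%:P; c *: 'X^(a + b); 'X^b]`_i) = 0.
  apply: (poly_eq0_but (bad := [:: 0])) => t; rewrite inE => t0; rewrite curveE.
  rewrite (_ : \col_i _ = t ^+ (a + b) *: vec3 (t^-1 ^+ (a + b)) c (t^-1 ^+ a)).
    by rewrite (ev_scale _ _ (cs_homog cs)) Ft ?mulr0// invr_eq0.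
  apply/colP; apply: ord3P; rewrite !mxE ?inordK//= !hornerE ?exprVn.
  - by rewrite mulfV// expf_neq0.
  - by rewrite mulrC.
  - by rewrite exprD mulrAC mulfV ?mul1r// expf_neq0.
have h1 := congr1 (fun q : {poly C} => q.[0]) P1.
have h2 := congr1 (fun q : {poly C} => q.[0]) P2.
move: h1 h2; rewrite !curveE !horner0.
have -> : \col_i ((\col_i0 [:: 'X^(a + b); c%:P; 'X^a]`_i0) i 0).[0] = vec3 0 c 0.
  apply/colP; apply: ord3P; rewrite !mxE ?inordK//= !hornerE// expr0n eqn0Ngt.
    by rewrite addn_gt0 a0.
  by rewrite a0.
have -> : \col_i ((\col_i0 [:: 1%:P; c *: 'X^(a + b); 'X^b]`_i0) i 0).[0] = vec3 1 0 0.
  apply/colP; apply: ord3P; rewrite !mxE ?inordK//= !hornerE// expr0n eqn0Ngt.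
    by rewrite addn_gt0 a0 mulr0.
  by rewrite b0.
move=> h1 h2; split.
  by have := evZ x 1 0 0; rewrite h2 !mulr0 mulr1.
by have := evZ (x / c) 0 c 0; rewrite h1 !mulr0 divfK.
Qed.

Lemma torus_params_finite : exists ks : seq C, forall k, torus_param k -> k \in ks.
Proof.
pose p := linep F (vec3 1 0 1) (vec3 0 1 0).
have pE c : p.[c] = ev F (vec3 1 c 1).
  by rewrite linepE scale_vec3 add_vec3 !mulr0 !addr0 add0r mulr1.
have p0 : p != 0.
  apply/eqP => p0; have [t||[k]] := cs_noline cs (u := vec3 1 0 1) (w := vec3 0 1 0).
  - by rewrite -linepE -/p p0 horner0.
  - by move=> /vec3_eq0[_ /eqP]; rewrite oner_eq0.
  - by rewrite scale_vec3 => /vec3_inj[/eqP]; rewrite mulr0 oner_eq0.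
have [r pr] := closed_field_poly_normal p.
exists [seq c ^+ b | c <- r] => k [k0 Fk]; apply/mapP; exists (b.-root k).
  rewrite -root_prod_XsubC -(rootZ _ _ (_ : lead_coef p != 0)) ?lead_coef_eq0//.
  by rewrite -pr; apply/rootP; rewrite pE.
by rewrite rootCK.
Qed.

(** This excludes an isolated zero at the third vertex. The product P of the equations of the orbits
    on the curve vanishes on the curve off x = 0, hence everywhere on it by [vanish_on_cone], but
    not at this vertex. *)
Lemma torus_origin z : z != 0 -> ev F (vec3 0 0 z) != 0.
Proof.
move=> z0; apply/eqP => Fz; have [ks ksP] := torus_params_finite.
have [k0 kP] := torus_exists.
pose P : {mpoly C[3]} := \prod_(k <- ks | k != 0)
  ('X_0 ^+ a * 'X_1 ^+ b - k%:MP * 'X_(inord 2) ^+ (a + b)).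
have PE x y w : ev P (vec3 x y w) =
    \prod_(k <- ks | k != 0) (x ^+ a * y ^+ b - k * w ^+ (a + b)).
  rewrite /ev /P rmorph_prod; apply: eq_bigr => k _.
  by rewrite rmorphB !rmorphM !rmorphXn /= mevalC !mevalXU !vec3E.
pose ls : seq 'rV[C]_3 := [:: row3 1 0 0].
have ls0 l : l \in ls -> l != 0.
  by rewrite inE => /eqP ->; apply: rowneq0; rewrite oner_eq0.
have Pv v : v != 0 -> ev F v = 0 -> (forall l, l \in ls -> l *m v != 0) -> ev P v = 0.
  rewrite (vec3K v); move: (v 0 0) (v 1 0) (v (inord 2) 0) => x y w v0 Fv lv.
  have x0 : x != 0.
    apply: contra (lv _ (mem_head _ _)) => /eqP ->; rewrite row3_mul mulr0 !mul0r !addr0.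
    by apply/eqP/matrixP => i j; rewrite !mxE mul0rn.
  apply/eqP; rewrite PE prodf_seq_eq0; apply/hasP.
  have [w0|w0] := eqVneq w 0.
    exists k0; first exact: ksP kP.
    move: Fv; rewrite w0 => /torus_z0[/eqP|->]; first by rewrite (negPf x0).
    rewrite !expr0n !eqn0Ngt addn_gt0 a0 b0 !mulr0 subrr eqxx andbT.
    by case: kP.
  have y0 : y != 0.
    apply/eqP => y0; move: Fv; rewrite y0 => /torus_y0[] /eqP.
      by rewrite (negPf x0).
    by rewrite (negPf w0).
  have kv := torus_param_of x0 y0 w0 Fv; exists ((x / w) ^+ a * (y / w) ^+ b).
    exact: ksP.
  have [-> _] := kv; rewrite /= !expr_div_n mulf_div -exprD divfK ?expf_neq0//.
  by rewrite subrr.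
have n0 : vec3 0 0 z != 0 by apply: vec3_neq0; rewrite z0 !orbT.
have /eqP := vanish_on_cone (cs_homog cs) (cs_neq0 cs) (cs_noline cs) ls0 Pv n0 Fz.
rewrite PE prodf_seq_eq0 => /hasP[k _ /andP[kn]].
rewrite !expr0n !eqn0Ngt a0 b0 /= mul0r sub0r oppr_eq0 mulf_eq0 (negPf kn) /=.
by rewrite expf_eq0 (negPf z0) andbF.
Qed.

Lemma torus_conic k : a = 1%N -> b = 1%N -> torus_param k ->
  (forall k', torus_param k' -> k' = k) -> conic_form F.
Proof.
move=> a1 b1 kP k1; have [kn _] := kP.
(* This matrix sends (x, y, z) to (x, 2 k z, y), which satisfies the equation of the orbit k exactly
   when 2 x z = y^2. *)
exists (cols3 (vec3 1 0 0) (vec3 0 0 1) (vec3 0 (2 * k) 0)).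
  rewrite unitmxE unitfE det3E !cols3E !vec3E (_ : _ + _ = - (2 * k)); last by ring.
  by rewrite oppr_eq0 mulf_neq0 ?pnatr_eq0.
move=> v; rewrite (vec3K v); move: (v 0 0) (v 1 0) (v (inord 2) 0) => x y z v0.
rewrite cols3_mul !scale_vec3 !add_vec3 !mulr0 !mulr1 !addr0 !add0r /conicq !vec3E.
have [->|y0] := eqVneq y 0.
  rewrite expr0n subr0; split=> [/torus_z0[->|/eqP]|/eqP].
  - by rewrite mulr0 mul0r.
  - rewrite mulf_eq0 => /orP[/eqP ->|]; first by rewrite mulr0.
    by rewrite mulf_eq0 pnatr_eq0 (negPf kn).
  - rewrite !mulf_eq0 pnatr_eq0 /= => /orP[]/eqP->.
      by have [] := torus_vertices (z * (2 * k)).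
    by rewrite mul0r; have [] := torus_vertices x.
split=> [Fv|e].
  have x0 : x != 0.
    apply/eqP => x0; move: Fv; rewrite x0 => Fv.
    have [zk|/eqP] := torus_x0 Fv; last by rewrite (negPf y0).
    by move: Fv; rewrite zk => /eqP; rewrite (negPf (torus_origin y0)).
  have z0 : z * (2 * k) != 0.
    apply/eqP => zk; move: Fv; rewrite zk => /torus_y0[]/eqP.
      by rewrite (negPf x0).
    by rewrite (negPf y0).
  have := k1 _ (torus_param_of x0 z0 y0 Fv); rewrite a1 b1 !expr1 mulf_div.
  move=> /(congr1 (fun w => w * (y * y))); rewrite divfK ?mulf_neq0// => h.
  apply: (mulfI kn); rewrite mulr0.
  have -> : k * (2 * x * z - y ^+ 2) = x * (z * (2 * k)) - k * (y * y) by ring.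
  by rewrite h subrr.
have e' : 2 * x * z = y ^+ 2 by apply/eqP; rewrite -subr_eq0 e.
have := evZ y (x / y) (z * (2 * k) / y) 1; rewrite mulr1 ![y * (_ / _)]mulrC !divfK//.
move=> ->; rewrite (_ : ev F _ = 0) ?mulr0//; apply/(torus_paramP kn) => //.
rewrite a1 b1 !expr1 mulf_div (_ : x * _ = k * y ^+ 2) ?mulfK ?expf_neq0//.
by rewrite -e'; ring.
Qed.

Let scal0 (w : C) : w%:M = 0 :> 'M_1 -> w = 0.
Proof. by move=> /matrixP/(_ 0 0); rewrite !mxE eqxx mulr1n. Qed.

Let scal0' : (0 : C)%:M = 0 :> 'M_1.
Proof. by apply/matrixP => i j; rewrite !mxE mul0rn. Qed.

Lemma torus_meets_once_x0 v : v != 0 -> ev F v = 0 -> row3 1 0 0 *m v = 0 ->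
  exists k, v = k *: vec3 0 1 0.
Proof.
rewrite (vec3K v); move: (v 0 0) (v 1 0) (v (inord 2) 0) => x y z v0 Fv.
rewrite row3_mul mul1r !mul0r !addr0 => /scal0 x0; exists y.
rewrite scale_vec3 mulr1 !mulr0; move: v0 Fv; rewrite x0 => v0 Fv.
have [y0|->//] := torus_x0 Fv; have z0 : z != 0.
  by apply: contra v0 => /eqP ->; rewrite y0; apply/eqP/colP; apply: ord3P; rewrite vec3E mxE.
by move: Fv; rewrite y0 => /eqP; rewrite (negPf (torus_origin z0)).
Qed.

Lemma torus_meets_once_y0 v : v != 0 -> ev F v = 0 -> row3 0 1 0 *m v = 0 ->
  exists k, v = k *: vec3 1 0 0.
Proof.
rewrite (vec3K v); move: (v 0 0) (v 1 0) (v (inord 2) 0) => x y z v0 Fv.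
rewrite row3_mul mul1r !mul0r add0r addr0 => /scal0 y0; exists x.
rewrite scale_vec3 mulr1 !mulr0; move: v0 Fv; rewrite y0 => v0 Fv.
have [x0|->//] := torus_y0 Fv; have z0 : z != 0.
  by apply: contra v0 => /eqP ->; rewrite x0; apply/eqP/colP; apply: ord3P; rewrite vec3E mxE.
by move: Fv; rewrite x0 => /eqP; rewrite (negPf (torus_origin z0)).
Qed.

(** A line lacking x or y in its equation passes through a vertex on the curve and, unless it is x =
    0 or y = 0, through another point of the curve. On any other line, the roots of [q c] are the
    intersections with an orbit; a single one for all orbits forces one k and [q c] = al (X - t)^(a
    + b). *)
Lemma torus_meets_once l :
  (forall k, torus_param k -> (forall k', torus_param k' -> k' = k) ->
     a = 1%N /\ b = 1%N -> False) ->
  meets_once F l -> (exists k, l = k *: row3 1 0 0) \/ (exists k, l = k *: row3 0 1 0).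
Proof.
move=> notconic; rewrite (row3K l); move: (l 0 0) (l 0 1) (l 0 (inord 2)) => al be ga.
move=> [x [x0 _ _ xP]].
have unique x1 y1 z1 x2 y2 z2 : ev F (vec3 x1 y1 z1) = 0 -> ev F (vec3 x2 y2 z2) = 0 ->
    al * x1 + be * y1 + ga * z1 = 0 -> al * x2 + be * y2 + ga * z2 = 0 ->
    vec3 x2 y2 z2 != 0 -> exists k, vec3 x1 y1 z1 = k *: vec3 x2 y2 z2.
  move=> F1 F2 l1 l2 n2.
  have [k2 e2] := xP _ n2 F2 (etrans (row3_mul _ _ _ _ _ _) (etrans (congr1 _ l2) scal0')).
  have [z|n1] := eqVneq (vec3 x1 y1 z1) 0; first by exists 0; rewrite scale0r z.
  have [k1 e1] := xP _ n1 F1 (etrans (row3_mul _ _ _ _ _ _) (etrans (congr1 _ l1) scal0')).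
  have k20 : k2 != 0 by apply: contra n2 => /eqP k20; rewrite e2 k20 scale0r.
  by exists (k1 / k2); rewrite e1 e2 scalerA divfK.
have e1n : vec3 1 0 0 != 0 :> 'cV[C]_3 by apply: vec3_neq0; rewrite oner_eq0.
have e2n : vec3 0 1 0 != 0 :> 'cV[C]_3 by apply: vec3_neq0; rewrite oner_eq0 orbT.
have [Fe1 Fe2] := torus_vertices 1.
have [k kP] := torus_exists; have [kn Fk] := kP.
have [al0|aln] := eqVneq al 0.
  right; have [be0|ben] := eqVneq be 0.
    have [||k' e] := unique _ _ _ _ _ _ Fe2 Fe1 _ _ e1n.
    - by rewrite al0 be0; ring.
    - by rewrite al0 be0; ring.
    by move: e; rewrite scale_vec3 => /vec3_inj[_ /eqP]; rewrite mulr0 oner_eq0.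
  have [ga0|gan] := eqVneq ga 0.
    exists be; rewrite al0 ga0; apply/matrixP => i; rewrite ord1.
    by apply: ord3P; rewrite [RHS]mxE !row3E ?mulr0 ?mulr1.
  pose y := - ga / be; have yn : y != 0 by rewrite mulf_neq0 ?oppr_eq0 ?invr_eq0.
  have Fp : ev F (vec3 (a.-root (k / y ^+ b)) y 1) = 0.
    by apply/(torus_paramP kn) => //; rewrite rootCK// divfK ?expf_neq0.
  have [||k' e] := unique _ _ _ _ _ _ Fp Fe1 _ _ e1n.
  - by rewrite al0 /y; field.
  - by rewrite al0; ring.
  by move: e; rewrite scale_vec3 => /vec3_inj[_ _ /eqP]; rewrite mulr0 oner_eq0.
have [be0|ben] := eqVneq be 0.
  left; have [ga0|gan] := eqVneq ga 0.
    exists al; rewrite be0 ga0; apply/matrixP => i; rewrite ord1.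
    by apply: ord3P; rewrite [RHS]mxE !row3E ?mulr0 ?mulr1.
  pose y := - ga / al; have yn : y != 0 by rewrite mulf_neq0 ?oppr_eq0 ?invr_eq0.
  have Fp : ev F (vec3 y (b.-root (k / y ^+ a)) 1) = 0.
    by apply/(torus_paramP kn) => //; rewrite rootCK// mulrC divfK ?expf_neq0.
  have [||k' e] := unique _ _ _ _ _ _ Fp Fe2 _ _ e2n.
  - by rewrite be0 /y; field.
  - by rewrite be0; ring.
  by move: e; rewrite scale_vec3 => /vec3_inj[_ _ /eqP]; rewrite mulr0 oner_eq0.
pose q c : {poly C} := al *: 'X^(a + b) + ga *: 'X^a + (be * c)%:P.
have qE c t : (q c).[t] = al * t ^+ (a + b) + ga * t ^+ a + be * c.
  by rewrite /q !hornerE.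
have root_neq0 c t : c != 0 -> (q c).[t] = 0 -> t != 0.
  move=> c0 qt; apply/eqP => t0; move: qt; rewrite qE t0 !expr0n !eqn0Ngt abN0 a0.
  by rewrite !mulr0 !add0r => /eqP; rewrite mulf_eq0 (negPf ben) (negPf c0).
have on_l c t : c != 0 -> ev F (vec3 1 c 1) = 0 -> (q c).[t] = 0 ->
    ev F (vec3 (t ^+ b) (c / t ^+ a) 1) = 0 /\
    al * t ^+ b + be * (c / t ^+ a) + ga * 1 = 0.
  move=> c0 Fc qt; have t0 := root_neq0 _ _ c0 qt; split.
    apply/(torus_paramP (k := c ^+ b)); rewrite ?expf_neq0//.
      rewrite expr_div_n -!exprM mulnC mulrC divfK// expf_neq0//.
    by apply/(torus_paramP (x := 1) (y := c)); rewrite ?expf_neq0// expr1n mul1r.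
  apply: (mulIf (expf_neq0 a t0)); rewrite mul0r -qt qE exprD.
  by field; rewrite ?expf_neq0 ?t0.
have size_q c : size (q c) = (a + b).+1.
  have lt_ab : (a < a + b)%N by rewrite -{1}[a]addn0 ltn_add2l.
  rewrite /q -addrA size_polyDl size_scale ?size_polyXn//.
  rewrite (leq_ltn_trans (size_polyD _ _))// gtn_max; apply/andP; split.
    by rewrite (leq_ltn_trans (size_scale_leq _ _))// size_polyXn ltnS.
  by rewrite (leq_ltn_trans (size_polyC_leq1 _))// ltnS.
have has_root c : exists t, (q c).[t] = 0.
  have /closed_rootP[t /rootP] : size (q c) != 1%N by rewrite size_q eqSS -lt0n.
  by exists t.
have n3 x1 y1 : vec3 x1 y1 1 != 0 :> 'cV[C]_3.
  by apply: vec3_neq0; rewrite oner_eq0 !orbT.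
have one_point c t c' t' : c != 0 -> c' != 0 -> ev F (vec3 1 c 1) = 0 ->
    ev F (vec3 1 c' 1) = 0 -> (q c).[t] = 0 -> (q c').[t'] = 0 ->
    t ^+ b = t' ^+ b /\ c / t ^+ a = c' / t' ^+ a.
  move=> c0 c'0 Fc Fc' qt qt'.
  have [F1 l1] := on_l _ _ c0 Fc qt; have [F2 l2] := on_l _ _ c'0 Fc' qt'.
  have [k' e] := unique _ _ _ _ _ _ F1 F2 l1 l2 (n3 _ _).
  by move: e; rewrite scale_vec3 mulr1 => /vec3_inj[-> -> <-]; rewrite !mul1r.
case: (notconic k kP).
  move=> k' [k'n Fk']; have c0 : b.-root k != 0 by rewrite rootC_eq0.
  have c'0 : b.-root k' != 0 by rewrite rootC_eq0.
  have [t qt] := has_root (b.-root k); have [t' qt'] := has_root (b.-root k').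
  have t0 := root_neq0 _ _ c0 qt; have t'0 := root_neq0 _ _ c'0 qt'.
  have [eb ea] := one_point _ _ _ _ c0 c'0 Fk Fk' qt qt'.
  have kE (c s : C) : s != 0 -> (s ^+ b) ^+ a * (c / s ^+ a) ^+ b = c ^+ b.
    by move=> s0; rewrite expr_div_n -!exprM [(b * a)%N]mulnC mulrC divfK// expf_neq0.
  have := kE (b.-root k) t t0; rewrite eb ea kE// !rootCK//.
set c := b.-root k in Fk; have c0 : c != 0 by rewrite rootC_eq0.
have [t qt] := has_root c; have t0 := root_neq0 _ _ c0 qt.
have allt s : (q c).[s] = 0 -> s = t.
  move=> qs; have s0 := root_neq0 _ _ c0 qs.
  have [eb /(mulfI c0)/invr_inj ea] := one_point _ _ _ _ c0 c0 Fk Fk qs qt.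
  exact: coprime_inj a0 cab s0 t0 ea eb.
have qXn : q c = al *: ('X - t%:P) ^+ (a + b).
  have q0 : q c != 0 by rewrite -size_poly_eq0 size_q.
  have [r qr] := closed_field_poly_normal (q c).
  have lq : lead_coef (q c) = al.
    rewrite lead_coefE size_q /= /q !coefD !coefZ !coefXn coefC eqxx mulr1.
    have -> : (a + b == a)%N = false by rewrite -[X in _ == X]addn0 eqn_add2l eqn0Ngt b0.
    by rewrite (gtn_eqF abN0) mulr0 !addr0.
  have rt z : z \in r -> z = t.
    move=> zr; apply: allt; apply/rootP.
    by rewrite qr rootZ ?lead_coef_eq0// root_prod_XsubC.
  have rE : \prod_(z <- r) ('X - z%:P) = ('X - t%:P) ^+ size r.
    rewrite (eq_big_seq (fun=> 'X - t%:P)) => [|z /rt ->//].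
    by rewrite big_const_seq count_predT iter_mulr_1.
  have sr : size r = (a + b)%N.
    by apply/eq_add_S; rewrite -(size_q c) qr size_scale ?lead_coef_eq0// size_prod_XsubC.
  by rewrite qr lq rE sr.
have [m mE] : exists m, (a + b = m.+2)%N.
  exists (a + b - 2)%N; move: a0 b0; clear; lia.
(* In al (X - t)^(a + b) the coefficients of X and of X^(a + b - 1) are nonzero, but the only
   intermediate degree in [q c] is a. Hence a = 1 and a = a + b - 1. *)
have c1 := congr1 (fun p : {poly C} => p`_1) qXn.
have cm := congr1 (fun p : {poly C} => p`_m.+1) qXn.
move: c1 cm; rewrite mE coefZ (proj2 (coef1_XsubC_exp t m.+1)) coefZ coef_top_XsubC_exp.
rewrite !coefD !coefZ !coefXn !coefC /= mE.
have nz (u : C) (e : bool) : u != 0 -> ga * e%:R = al * u -> e.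
  move=> u0; case: e => //; rewrite mulr0 => /esym/eqP.
  by rewrite mulf_eq0 (negPf aln) (negPf u0).
have -> : (1%N == m.+2) = false by [].
have -> : (m.+1 == m.+2) = false by rewrite ltn_eqF.
rewrite !mulr0 !addr0 !add0r => c1 cm.
have a1 : a = 1%N.
  apply/esym/eqP; apply: nz c1; rewrite mulf_neq0 ?pnatr_eq0// expf_neq0//.
  by rewrite oppr_eq0.
have am : a = m.+1.
  apply/esym/eqP; apply: nz cm; rewrite oppr_eq0 mulf_neq0 ?pnatr_eq0//.
split => //; move: mE; rewrite -am -[a.+1]addn1 => /addnI.
by [].
Qed.

Lemma torus_curve : mxvabelian G \/ conic_form F.
Proof.
have [[k [kP [k1 [a1 b1]]]]|notconic] := pselect (exists k, torus_param k /\
    (forall k', torus_param k' -> k' = k) /\ a = 1%N /\ b = 1%N).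
  by right; exact: torus_conic kP k1.
have {}notconic k : torus_param k -> (forall k', torus_param k' -> k' = k) ->
     a = 1%N /\ b = 1%N -> False.
  by move=> kP k1 ab; apply: notconic; exists k.
left; have [Fe1 Fe2] := torus_vertices 1.
have r10 : row3 1 0 0 != 0 :> 'rV[C]_3 by apply: rowneq0; rewrite oner_eq0.
have r20 : row3 0 1 0 != 0 :> 'rV[C]_3 by apply: rowneq0; rewrite oner_eq0 orbT.
have e10 : vec3 1 0 0 != 0 :> 'cV[C]_3 by apply: vec3_neq0; rewrite oner_eq0.
have e20 : vec3 0 1 0 != 0 :> 'cV[C]_3 by apply: vec3_neq0; rewrite oner_eq0 orbT.
have once1 : meets_once F (row3 1 0 0).
  exists (vec3 0 1 0); split => //; last exact: torus_meets_once_x0.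
  by rewrite row3_mul (_ : _ + _ = 0) ?scal0'//; ring.
have once2 : meets_once F (row3 0 1 0).
  exists (vec3 1 0 0); split => //; last exact: torus_meets_once_y0.
  by rewrite row3_mul (_ : _ + _ = 0) ?scal0'//; ring.
have gG := cs_group cs; have [G1 mG iG detG] := gG.
pose D := stabl (row3 1 0 0) G.
have gD : mxgroup D by exact: stabl_group.
have row_nz (x y : C) : row3 1 0 0 <> x *: row3 0 1 0 :> 'rV[C]_3.
  by move=> /matrixP/(_ 0 0); rewrite [RHS]mxE !row3E mulr0 => /eqP; rewrite oner_eq0.
(* Fixing the line x = 0 forces g to fix the other line y = 0 too, and with them e2 and e1, their
   only points on the curve. *)
have Ddiag g : D g -> exists x y z, g = cols3 (vec3 x 0 0) (vec3 0 y 0) (vec3 0 0 z).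
  move=> [Gg [x gx]]; have gu := mxgroup_unit gG Gg.
  have x0 := stabl_neq0 gG r10 Gg gx.
  have [y gy] : exists y, row3 0 1 0 *m g = y *: row3 0 1 0.
    have [[y gy]|//] := torus_meets_once notconic (cs_meets_once cs once2 Gg).
    exfalso; have : row3 0 1 0 = (y / x) *: row3 1 0 0 :> 'rV[C]_3.
      by apply: (can_inj (mulmxK gu)); rewrite gy -scalemxAl gx scalerA divfK.
    by move=> /matrixP/(_ 0 1); rewrite [RHS]mxE !row3E mulr0 => /eqP; rewrite oner_eq0.
  have g_e1 : exists z, g *m vec3 1 0 0 = z *: vec3 1 0 0.
    apply: torus_meets_once_y0.
    - by rewrite mulmx_eq0.
    - exact: (cs_inv cs).
    - rewrite mulmxA gy -scalemxAl row3_mul (_ : _ + _ = 0) ?scal0' ?scaler0//; ring.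
  have g_e2 : exists z, g *m vec3 0 1 0 = z *: vec3 0 1 0.
    apply: torus_meets_once_x0.
    - by rewrite mulmx_eq0.
    - exact: (cs_inv cs).
    - rewrite mulmxA gx -scalemxAl row3_mul (_ : _ + _ = 0) ?scal0' ?scaler0//; ring.
  have [z1 e1] := g_e1; have [z2 e2] := g_e2.
  have c1 i : g i 0 = z1 * (vec3 1 0 0 : 'cV[C]_3) i 0.
    by move/matrixP/(_ i 0): e1; rewrite mul3E [RHS]mxE !vec3E mulr1 !mulr0 !addr0.
  have c2 i : g i 1 = z2 * (vec3 0 1 0 : 'cV[C]_3) i 0.
    by move/matrixP/(_ i 0): e2; rewrite mul3E [RHS]mxE !vec3E mulr1 !mulr0 addr0 add0r.
  have r1 : g 0 (inord 2) = 0.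
    move/matrixP/(_ 0 (inord 2)): gx; rewrite mul3E [RHS]mxE !row3E !mul0r mul1r mulr0.
    by rewrite !addr0.
  have r2 : g 1 (inord 2) = 0.
    move/matrixP/(_ 0 (inord 2)): gy; rewrite mul3E [RHS]mxE !row3E !mul0r mul1r mulr0.
    by rewrite addr0 add0r.
  exists z1, z2, (g (inord 2) (inord 2)).
  by apply: matrix3P; apply: ord3P; split; rewrite !cols3E !vec3E ?c1 ?c2 ?r1 ?r2 ?vec3E; ring.
exists D; split => //.
- by move=> g [].
- move=> g h /Ddiag[x [y [z ->]]] /Ddiag[x' [y' [z' ->]]].
  by apply: matrix3P; apply: ord3P; split; rewrite !mul3E !cols3E !vec3E; ring.
apply: (stabl_index (s := [:: row3 1 0 0; row3 0 1 0])) => // g Gg.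
have [[k gk]|[k gk]] := torus_meets_once notconic (cs_meets_once cs once1 Gg).
  by exists (row3 1 0 0); [rewrite !inE eqxx|exists k].
by exists (row3 0 1 0); [rewrite !inE eqxx orbT|exists k].
Qed.

End TorusCurve.
End Torus.

(** * Polynomial relations between n and nu^n *)

Section ExpPoly.
Variable C : numClosedFieldType.

Lemma size_shift_sub (p : {poly C}) e : (size p <= e.+1)%N ->
  (size (p \Po ('X + 1%:P) - p)%R <= e)%N.
Proof.
move=> pe; set q := p \Po _; have sq : size q = size p by rewrite size_comp_poly2// size_XaddC.
apply/leq_sizeP => j; rewrite leq_eqVlt coefB => /orP[/eqP <-|ej]; last first.
  by rewrite !nth_default ?subrr ?sq// (leq_trans pe).
have [pe'|ep] := leqP (size p) e; first by rewrite !nth_default ?subrr ?sq.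
have pE : size p = e.+1 by apply/eqP; rewrite eqn_leq pe.
have : lead_coef q = lead_coef p.
  rewrite lead_coef_comp ?size_XaddC// lead_coefXaddC expr1n mulr1//.
by rewrite !lead_coefE sq pE => ->; rewrite subrr.
Qed.

(* Induction on the degree in the exponential and then on the size of its
   coefficient, which the difference operator H(n+1) - nu^k H(n) decreases. *)
Lemma exp_poly_eq0 (nu : C) (H : {poly {poly C}}) : nu != 0 ->
  (forall n, (0 < n)%N -> nu ^+ n != 1) ->
  (forall n : nat, H.[(nu ^+ n)%:P].[n%:R] = 0) -> H = 0.
Proof.
move=> nu0 nuN1.
pose Claim k e := forall H : {poly {poly C}}, (size H <= k.+1)%N ->
    (size (H`_k)%R <= e)%N ->
    (forall n : nat, H.[(nu ^+ n)%:P].[n%:R] = 0) -> H = 0.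
suff main k e : Claim k e by move=> ?; apply: (main (size H) (size H`_(size H))).
have hornerE2 (P : {poly {poly C}}) n m : (size P <= n.+1)%N ->
    P.[(nu ^+ m)%:P].[m%:R] = \sum_(j < n.+1) (P`_j).[m%:R] * nu ^+ (m * j).
  move=> sP; rewrite (horner_coef_wide _ sP) horner_sum; apply: eq_bigr => j _.
  by rewrite hornerM horner_exp hornerC exprM.
have step k' e' : Claim k' e' -> Claim k' e'.+1.
  move=> IHe {}H sH sHk Hn.
  pose S j := nu ^+ j *: (H`_j \Po ('X + 1%:P)) - nu ^+ k' *: H`_j.
  have H'0 : \poly_(j < k'.+1) S j = 0.
    apply: IHe; first exact: size_poly.
      rewrite coef_poly ltnSn /S -scalerBr.
      by rewrite (leq_trans (size_scale_leq _ _))// size_shift_sub.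
    move=> n; rewrite (@hornerE2 _ k') ?size_poly//.
    transitivity (H.[(nu ^+ n.+1)%:P].[n.+1%:R] - nu ^+ k' * H.[(nu ^+ n)%:P].[n%:R]).
      rewrite !(hornerE2 _ k')// mulr_sumr -sumrB; apply: eq_bigr => j _.
      rewrite coef_poly ltn_ord /S !hornerE horner_comp !hornerE -natr1.
      by rewrite mulSn exprD /=; ring.
    by rewrite !Hn mulr0 subrr.
  have S0 j : (j <= k')%N -> S j = 0.
    by move=> jk; have := congr1 (fun q : {poly {poly C}} => q`_j) H'0;
       rewrite coef_poly ltnS jk coef0.
  (* S j = 0 compares leading coefficients: nu^j = nu^k' unless the coefficient of degree j is 0. *)
  have Hj j : (j < k')%N -> H`_j = 0.
    move=> jk; apply: contrapT => /eqP Hj0; have := S0 j (ltnW jk).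
    move=> /eqP; rewrite subr_eq0 => /eqP/(congr1 lead_coef).
    rewrite !lead_coefZ lead_coef_comp ?size_XaddC// lead_coefXaddC expr1n mulr1.
    rewrite -(subnKC (ltnW jk)) exprD -mulrA => /(mulfI (expf_neq0 j nu0)) /eqP.
    rewrite -[X in X == _]mul1r -subr_eq0 -mulrBl mulf_eq0 lead_coef_eq0 (negPf Hj0) orbF.
    by rewrite subr_eq0 eq_sym; apply/negP; apply: nuN1; rewrite subn_gt0.
  have Hk : H`_k' = 0.
    apply: (@poly_inj_eq0 _ (fun n => n%:R)); first exact: (mulrIn (oner_neq0 C)).
    move=> n; have := Hn n; rewrite (hornerE2 _ k')// big_ord_recr big1 /=; last first.
      by move=> j _; rewrite Hj// horner0 mul0r.
    by move=> /eqP; rewrite add0r mulf_eq0 expf_eq0 (negPf nu0) andbF orbF => /eqP.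
  apply/polyP => j; rewrite coef0; have [/Hj//|] := ltnP j k'.
  rewrite leq_eqVlt => /orP[/eqP<-//|kj].
  by rewrite nth_default// (leq_trans sH).
elim: k e => [|k IHk]; elim=> [|e IHe]; try exact: step.
  move=> {}H sH; rewrite leqn0 size_poly_eq0 => /eqP H0 _; apply/polyP => -[|j].
    by rewrite H0 coef0.
  by rewrite nth_default ?coef0// (leq_trans sH).
move=> {}H sH; rewrite leqn0 size_poly_eq0 => /eqP H0 Hn.
apply: (IHk (size (H`_k)%R)) => //; apply/leq_sizeP => j.
rewrite leq_eqVlt => /orP[/eqP<-//|kj].
by rewrite nth_default// (leq_trans sH).
Qed.

End ExpPoly.

(** * Elements of infinite order *)

Section Eigen.
Variable C : numClosedFieldType.
Implicit Types (F : {mpoly C[3]}) (G D : set 'M[C]_3) (g h P : 'M[C]_3) (v : 'cV[C]_3).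

Lemma char_poly_roots g : exists l : seq C, size l = 3 /\
  char_poly g = \prod_(z <- l) ('X - z%:P).
Proof.
have [r rE] := closed_field_poly_normal (char_poly g).
have /monicP lc := char_poly_monic g; rewrite lc scale1r in rE.
exists r; split => //; have := size_char_poly g.
by rewrite rE size_prod_XsubC => -[].
Qed.

(** [eigenvalue] refers to row vectors; transposing the singular matrix g - z yields a column. *)
Lemma char_root_eigenvector g z : root (char_poly g) z ->
  exists2 v : 'cV[C]_3, v != 0 & g *m v = z *: v.
Proof.
rewrite -eigenvalue_root_char => /eigenvalueP[u ug u0].
pose A : 'M[C]_3 := (g - z%:M)^T.
have /det0P[w w0] : \det A == 0.
  by rewrite det_tr; apply/det0P; exists u; rewrite // mulmxBr ug mul_mx_scalar subrr.
rewrite /A.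
move=> /(congr1 trmx); rewrite trmx_mul trmxK trmx0 mulmxBl mul_scalar_mx => /eqP.
rewrite subr_eq0 => /eqP gw; exists w^T => //.
by apply: contra w0 => /eqP/(congr1 trmx); rewrite trmxK trmx0 => ->.
Qed.

Definition annihilates g (l : seq C) := \prod_(z <- l) (g - z%:M) = 0.

Lemma eigen_data g : exists l : seq C, [/\ size l = 3, annihilates g l,
  (forall z, z \in l -> exists2 v : 'cV[C]_3, v != 0 & g *m v = z *: v) &
  \tr g = \sum_(z <- l) z].
Proof.
have [l [sl gl]] := char_poly_roots g; exists l; split => //.
- rewrite /annihilates -(Cayley_Hamilton g) gl rmorph_prod.
  by apply: eq_bigr => z _; rewrite rmorphB /= horner_mx_X horner_mx_C.
- by move=> z zl; apply: char_root_eigenvector; rewrite gl root_prod_XsubC.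
- apply: oppr_inj; have := char_poly_trace g (isT : (0 < 3)%N); rewrite gl => <-.
  by rewrite -coefPn_prod_XsubC sl.
Qed.

Lemma eigen_pow g v z n : g *m v = z *: v -> g ^+ n *m v = z ^+ n *: v.
Proof.
move=> gv; elim: n => [|n IH]; first by rewrite !expr0 mul1mx scale1r.
by rewrite exprS -mulmxE -mulmxA IH -scalemxAr gv scalerA mulrC exprS.
Qed.

(** X - z divides X^n - z^n, so the annihilating product for g divides the one for g^n. *)
Lemma annihilates_pow g l n : annihilates g l -> annihilates (g ^+ n) [seq z ^+ n | z <- l].
Proof.
rewrite /annihilates big_map => gl.
pose hm := horner_mx g.
have lin z : hm ('X - z%:P) = g - z%:M by rewrite /hm rmorphB /= horner_mx_X horner_mx_C.
have pow z : hm ('X^n - (z ^+ n)%:P) = g ^+ n - (z ^+ n)%:M.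
  by rewrite /hm rmorphB rmorphXn /= horner_mx_X horner_mx_C.
have div (z : C) : exists q, 'X^n - (z ^+ n)%:P = ('X - z%:P) * q.
  by rewrite polyC_exp subrXX; eexists.
have := gl; rewrite (eq_bigr _ (fun z _ => esym (lin z))) -rmorph_prod /= => {}gl.
rewrite (eq_bigr _ (fun z _ => esym (pow z))) -rmorph_prod /=.
suff [q ->] : exists q, \prod_(z <- l) ('X^n - (z ^+ n)%:P) = (\prod_(z <- l) ('X - z%:P)) * q.
  by rewrite rmorphM /= gl mul0r.
elim: (l) => [|z s [q qE]]; first by exists 1; rewrite !big_nil mulr1.
have [q' q'E] := div z; exists (q' * q).
by rewrite !big_cons qE q'E mulrACA.
Qed.

Definition unrelated (x y : C) := forall n, (0 < n)%N -> x ^+ n <> y ^+ n.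

(** N is the product, over all pairs, of one positive exponent that makes the two powers equal, or
    of 1 if there is none. *)
Lemma common_power (l : seq C) : exists2 N, (0 < N)%N &
  forall x y, x \in l -> y \in l -> x ^+ N = y ^+ N \/ unrelated (x ^+ N) (y ^+ N).
Proof.
pose f (p : C * C) : nat :=
  if pselect (exists2 n, (0 < n)%N & p.1 ^+ n = p.2 ^+ n) is left e
  then projT1 (cid2 e) else 1%N.
have f0 p : (0 < f p)%N by rewrite /f; case: pselect => // e; case: cid2.
pose N := (\prod_(p <- [seq (x, y) | x <- l, y <- l]) f p)%N.
have N0 : (0 < N)%N by rewrite /N; elim/big_ind: _ => // m n; rewrite muln_gt0 => -> ->.
exists N => // x y xl yl.
have [e|h] := pselect (unrelated (x ^+ N) (y ^+ N)); first by right.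
left; move: h => /existsNP[n /not_implyP[n0 /contrapT]]; rewrite -!exprM => e.
have fN : (f (x, y) %| N)%N.
  rewrite /N (big_rem (x, y)) ?dvdn_mulr//=.
  by apply/allpairsP; exists (x, y).
have [m ->] := dvdnP fN; rewrite mulnC !exprM; congr (_ ^+ m).
rewrite /f; case: pselect => [e'|[]]; last by exists (N * n)%N; rewrite ?muln_gt0 ?N0.
by case: cid2.
Qed.

Lemma unit_of_inj P : (forall v, P *m v = 0 -> v = 0) -> P \in unitmx.
Proof.
move=> Pinj; rewrite unitmxE unitfE -det_tr; apply/negP => /det0P[w w0].
move=> /(congr1 trmx); rewrite trmx_mul trmxK trmx0 => /Pinj.
by move=> /(congr1 trmx)/eqP; rewrite trmxK trmx0 (negPf w0).
Qed.

Section InfiniteOrder.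
Variables (d : nat) (F : {mpoly C[3]}) (G : set 'M[C]_3).
Hypothesis cs : curve_stabilizer d F G.

Lemma cs_pow g n : G g -> G (g ^+ n).
Proof.
have [G1 mG _ _] := cs_group cs; move=> Gg; elim: n => [|n IH]; first by rewrite expr0.
by rewrite exprS; exact: mG.
Qed.

Lemma cs_orbit g v n : G g -> v != 0 -> ev F v = 0 -> ev F (g ^+ n *m v) = 0.
Proof. by move=> Gg; apply: (cs_inv cs); exact: cs_pow. Qed.

(** A matrix that kills v has all its rows killing v, so one nonzero row of each matrix serves as a
    line to avoid. *)
Lemma cs_row (A : seq 'M[C]_3) : (forall a, a \in A -> a != 0) ->
  exists v, [/\ v != 0, ev F v = 0 & forall a, a \in A -> a *m v != 0].
Proof.
move=> A0.
have nzrow (a : 'M[C]_3) : a != 0 -> exists i, row i a != 0.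
  move=> a0; apply: contrapT => h; case/eqP: a0; apply/row_matrixP => i; rewrite row0.
  by apply: contrapT => /eqP ?; apply: h; exists i.
pose f (a : 'M[C]_3) : 'rV[C]_3 := if pselect (exists i, row i a != 0) is left e
  then row (projT1 (cid e)) a else 0.
have [l|v [v0 Fv lv]] := avoid_lines (ls := [seq f a | a <- A])
  (cs_deg cs) (cs_homog cs) (cs_neq0 cs) (cs_noline cs).
  move=> /mapP[a /A0/nzrow ai ->]; rewrite /f; case: pselect => // e.
  by case: cid.
exists v; split => // a aA; have := lv _ (map_f f aA); rewrite /f.
case: pselect => [e|]; last by rewrite mul0mx eqxx.
case: cid => i /= _; apply: contra => /eqP av.
by rewrite -row_mul av; apply/eqP/rowP => j; rewrite !mxE.
Qed.

(** The factor is the exponential of X, truncated because X^3 v = 0, so g^n acts on v as l^n exp(n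
    X). *)
Lemma unipotent_pow g X l v n : g = l *: (1%:M + X + 2^-1 *: (X *m X)) ->
  X *m (X *m (X *m v)) = 0 -> g ^+ n *m v =
    l ^+ n *: (v + n%:R *: (X *m v) + (n%:R ^+ 2 / 2) *: (X *m (X *m v))).
Proof.
move=> gE X3; elim: n => [|n IH].
  by rewrite !expr0 mul1mx scale1r scale0r expr0n mul0r scale0r !addr0.
have gv u : g *m u = l *: (u + X *m u + 2^-1 *: (X *m (X *m u))).
  by rewrite gE -scalemxAl !mulmxDl mul1mx -scalemxAl mulmxA.
rewrite exprS -mulmxE -mulmxA IH -scalemxAr gv !mulmxDr -!scalemxAr X3 ?mulmx0.
rewrite !scaler0 !addr0.
move: (X *m v) (X *m (X *m v)) => w u.
by apply/colP => i; rewrite !mxE -(natr1 n) (exprS l); field.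
Qed.

(** F vanishes at exp(n X) v for all n, hence at exp(t X) v for all t. If X^2 = 0 these orbits are
    lines, which is impossible; otherwise X^2 v0, X v0, v0 is a basis in which [unipotent_curve]
    applies. *)
Lemma unipotent_case g l : G g -> l != 0 -> g != l%:M ->
  (g - l%:M) *m (g - l%:M) *m (g - l%:M) = 0 -> mxvabelian G \/ conic_form F.
Proof.
move=> Gg l0 gl; set A := g - l%:M => A3.
have [N gN N3] : exists2 N, g = l *: (1%:M + N) & N *m N *m N = 0.
  exists (l^-1 *: A); last by rewrite -!scalemxAl -!scalemxAr -scalemxAl A3 !scaler0.
  by rewrite scalerDr scalerA mulfV// scale1r scale_scalar_mx mulr1 addrC subrK.
(* The logarithm of 1 + N. *)
have [X XE] : exists X, X = N - 2^-1 *: (N *m N) by eexists.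
have XX : X *m X = N *m N.
  rewrite XE mulmxBl !mulmxBr -!scalemxAl -!scalemxAr !mulmxA N3 mul0mx.
  by rewrite !scaler0 !subr0.
have X3 : X *m (X *m X) = 0.
  by rewrite XX XE mulmxBl -scalemxAl mulmxA N3 mulmxA N3 mul0mx scaler0 subr0.
have gE : g = l *: (1%:M + X + 2^-1 *: (X *m X)).
  by rewrite XX XE addrA subrK.
have orb v t : v != 0 -> ev F v = 0 ->
    ev F (v + t *: (X *m v) + (t ^+ 2 / 2) *: (X *m (X *m v))) = 0.
  move=> v0 Fv; pose q : 'cV[{poly C}]_3 := \col_i ((v i 0)%:P + (X *m v) i 0 *: 'X
    + ((X *m (X *m v)) i 0 / 2) *: 'X^2).
  have qE s : (curve F q).[s] = ev F (v + s *: (X *m v) + (s ^+ 2 / 2) *: (X *m (X *m v))).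
    rewrite curveE /q; move: (X *m v) (X *m (X *m v)) => w u.
    by congr ev; apply/colP => i; rewrite !mxE !hornerE /=; field.
  rewrite -qE (_ : curve F q = 0) ?horner0//.
  apply: (@poly_inj_eq0 _ (fun n => n%:R)); first exact: (mulrIn (oner_neq0 C)).
  move=> n; rewrite qE; have := cs_orbit n Gg v0 Fv.
  rewrite (unipotent_pow n gE); last by rewrite mulmxA mulmxA -[X *m X *m X]mulmxA X3 mul0mx.
  rewrite (ev_scale _ _ (cs_homog cs)) => /eqP; rewrite mulf_eq0 expf_eq0 expf_eq0.
  by rewrite (negPf l0) !andbF /= => /eqP.
have [X2|X2] := eqVneq (X *m X) 0.
  have X0 : X != 0.
    apply: contra gl => /eqP X0; apply/eqP; rewrite gE X2 X0 scaler0 !addr0.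
    by rewrite scale_scalar_mx mulr1.
  have [|v [v0 Fv Xv]] := cs_row (A := [:: X]).
    by move=> a; rewrite inE => /eqP->.
  have {}Xv := Xv _ (mem_head _ _).
  have [t||[k vE]] := cs_noline cs (u := v) (w := X *m v).
  - by rewrite -(orb v t)// mulmxA X2 mul0mx scaler0 addr0.
  - by move/eqP; rewrite (negPf Xv).
  - by case/eqP: Xv; rewrite vE -scalemxAr mulmxA X2 mul0mx scaler0.
have [v0 Xv0] : exists v, X *m X *m v != 0.
  apply: contrapT => h; case/eqP: X2; apply/matrixP => i j.
  have : X *m X *m delta_mx j (0 : 'I_1) = 0.
    by apply: contrapT => /eqP ?; apply: h; exists (delta_mx j 0).
  by rewrite -colE => /colP/(_ i); rewrite [LHS]mxE => ->; rewrite !mxE.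
rewrite -mulmxA in Xv0.
pose P := cols3 (X *m (X *m v0)) (X *m v0) v0.
have XP x y z : X *m (P *m vec3 x y z) = P *m vec3 y z 0.
  rewrite !cols3_mul !mulmxDr -!scalemxAr scale0r addr0.
  by rewrite [X *m (X *m (X *m v0))]mulmxA [_ *m (X *m v0)]mulmxA -[X *m X *m X]mulmxA X3 mul0mx scaler0 add0r.
have Pu : P \in unitmx.
  apply: unit_of_inj => v; rewrite (vec3K v).
  move: (v 0 0) (v 1 0) (v (inord 2) 0) => x y z Pv.
  have := congr1 (mulmx X) Pv; rewrite XP mulmx0 => XPv.
  have := congr1 (mulmx X) XPv; rewrite XP mulmx0 => XXPv.
  have Pz w : P *m vec3 w 0 0 = 0 -> w = 0.
    rewrite cols3_mul !scale0r !addr0 => /eqP; rewrite scalemx_eq0 (negPf Xv0) orbF.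
    by move/eqP.
  have z0 := Pz _ XXPv; rewrite z0 in XPv Pv; have y0 := Pz _ XPv.
  rewrite y0 in Pv; rewrite z0 y0 (Pz _ Pv).
  by apply/colP; apply: ord3P; rewrite vec3E mxE.
have [|vG|cF] := unipotent_curve (cs_conj Pu cs).
- move=> x y z t v0n; rewrite !ev_lin_subst => Fv.
  have := orb _ t _ Fv; rewrite mulmx_eq0// => /(_ v0n).
  rewrite !XP !scalemxAr -!mulmxDr !scale_vec3 !add_vec3 !mulr0 !addr0.
  by [].
- by left; apply: mxconj_vabelian Pu (cs_group cs) vG.
- by right; apply: conic_form_subst Pu cF.
Qed.

(** As nu = m / l is not a root of unity, [exp_poly_eq0] lets n and nu^n vary independently.
    Splitting v = w1 + w2 along the generalized eigenspaces, F vanishes at all w1 + s A w1 + t w2,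
    and thus on a line. *)
Lemma two_eigenvalues_case g l m : G g -> l != 0 -> m != 0 -> unrelated l m ->
  g != l%:M -> g != m%:M ->
  (g - l%:M) *m (g - l%:M) *m (g - m%:M) = 0 -> False.
Proof.
move=> Gg l0 m0 lm gl gm H3.
have c0 : m - l != 0.
  by rewrite subr_eq0; apply/eqP => ml; apply: (lm 1%N); rewrite // ml.
set c := m - l in c0; set A := g - l%:M in H3.
have A0 : A != 0 by rewrite subr_eq0.
have gm0 : g - m%:M != 0 by rewrite subr_eq0.
have gmE : g - m%:M = A - c%:M.
  by rewrite /A /c; apply/matrixP => i j; rewrite !mxE mulrnBl; ring.
have A3 : A *m A *m A = c *: (A *m A).
  by move: H3; rewrite gmE mulmxBr mul_mx_scalar => /eqP; rewrite subr_eq0 => /eqP.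
have gv u : g *m u = l *: u + A *m u.
  by rewrite /A mulmxBl mul_scalar_mx addrC subrK.
have A3v u : A *m (A *m (A *m u)) = c *: (A *m (A *m u)).
  by rewrite mulmxA mulmxA A3 -scalemxAl mulmxA.
have [|v [v0 Fv Av]] := cs_row (A := [:: A; g - m%:M]).
  by move=> a; rewrite !inE => /orP[] /eqP ->.
have {Av} [Av gmv] : A *m v != 0 /\ (g - m%:M) *m v != 0.
  by split; apply: Av; rewrite !inE eqxx ?orbT.
(* A^2 / c^2 projects onto the eigenspace of m, because A^3 = c A^2. *)
have [w2 w2E] : exists w2, w2 = c ^- 2 *: (A *m (A *m v)) by eexists.
have Aw2 : A *m w2 = c *: w2 by rewrite w2E -scalemxAr A3v !scalerA mulrC.
have [w1 w1E] : exists w1, w1 = v - w2 by eexists.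
have AAw1 : A *m (A *m w1) = 0.
  rewrite w1E !mulmxBr Aw2 -scalemxAr Aw2 w2E !scalerA.
  by rewrite -expr2 mulfV ?expf_neq0// scale1r subrr.
have vE : v = w1 + w2 by rewrite w1E subrK.
have gw2 n : g ^+ n *m w2 = m ^+ n *: w2.
  by apply: eigen_pow; rewrite gv Aw2 -scalerDl /c addrC subrK.
have gw1 n : g ^+ n *m w1 = l ^+ n *: (w1 + (n%:R / l) *: (A *m w1)).
  elim: n => [|n IH]; first by rewrite !expr0 mul1mx scale1r mul0r scale0r addr0.
  rewrite exprS -mulmxE -mulmxA IH -scalemxAr mulmxDr -scalemxAr !gv AAw1 addr0.
  move: (A *m w1) => u; apply/colP => i; rewrite !mxE -(natr1 n) (exprS l).
  by field.
pose nu := m / l; have nu0 : nu != 0 by rewrite mulf_neq0 ?invr_eq0.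
have nuN1 n : (0 < n)%N -> nu ^+ n != 1.
  move=> n0; apply/eqP => /(congr1 (fun x => x * l ^+ n)).
  rewrite expr_div_n divfK ?expf_neq0// mul1r => ml; exact: lm n0 (esym ml).
pose h i : {poly {poly C}} := ((w1 i 0)%:P + ((A *m w1) i 0 / l) *: 'X)%:P
  + (w2 i 0)%:P *: 'X.
pose H := mmap (polyC \o polyC) h F.
have HE t s : H.[t%:P].[s] = ev F (w1 + (s / l) *: (A *m w1) + t *: w2).
  rewrite -[LHS]/((horner_eval s \o horner_eval t%:P) H) rmorph_mmap.
    move: (A *m w1) @h @H => u h _; apply: meval_eq => i.
    by rewrite /= /horner_eval /h !hornerE !mxE /=; field.
  by move=> x; rewrite /= /horner_eval !hornerC.
have H0 : H = 0.
  apply: (exp_poly_eq0 nu0 nuN1) => n; rewrite HE; have := cs_orbit n Gg v0 Fv.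
  have -> : g ^+ n *m v = l ^+ n *: (w1 + (n%:R / l) *: (A *m w1) + nu ^+ n *: w2).
    rewrite vE mulmxDr gw1 gw2 [RHS]scalerDr; congr (_ + _).
    by rewrite scalerA expr_div_n mulrC divfK ?expf_neq0.
  rewrite (ev_scale _ _ (cs_homog cs)) => /eqP; rewrite mulf_eq0 expf_eq0 expf_eq0.
  by rewrite (negPf l0) !andbF /= => /eqP.
have {}H0 t s : ev F (w1 + (s / l) *: (A *m w1) + t *: w2) = 0.
  by rewrite -HE H0 !horner0.
have [t||[k vk]] := cs_noline cs (u := v) (w := A *m w1).
- by rewrite -(H0 1 (t * l)) scale1r mulfK// vE addrAC.
- move=> Aw1; have [t||[k w1k]] := cs_noline cs (u := w1) (w := w2).
  + by rewrite -(H0 t 0) mul0r scale0r addr0.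
  + by move=> w20; case/eqP: Av; rewrite vE w20 addr0.
  + case/eqP: gmv; rewrite gmE mulmxBl mul_scalar_mx vE mulmxDr Aw1 add0r Aw2.
    suff -> : w1 = 0 by rewrite add0r subrr.
    have := congr1 (mulmx A) w1k; rewrite Aw1 -scalemxAr Aw2 scalerA => /esym/eqP.
    rewrite scalemx_eq0 mulf_eq0 (negPf c0) orbF => /orP[]/eqP e; rewrite w1k e.
      by rewrite scale0r.
    by rewrite scaler0.
- by case/eqP: Av; rewrite vk -scalemxAr AAw1 scaler0.
Qed.

(** With e = gcd(p, q), p = a e and q = b e, [coprime_param] gives s such that g^e = k diag(s^(a +
    b), 1, s^a) in the eigenbasis. Since s is not a root of unity, vanishing at all its powers
    extends to every t. *)
Lemma torus_case g p q e1 e2 e3 l1 l2 l3 : G g ->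
  g *m e1 = l1 *: e1 -> g *m e2 = l2 *: e2 -> g *m e3 = l3 *: e3 ->
  cols3 e1 e2 e3 \in unitmx -> l1 != 0 -> l2 != 0 -> l3 != 0 -> unrelated l1 l3 ->
  (0 < p)%N -> (0 < q)%N -> l1 ^+ p * l2 ^+ q = l3 ^+ (p + q) ->
  mxvabelian G \/ conic_form F.
Proof.
move=> Gg g1 g2 g3 Pu l10 l20 l30 un p0 q0 lpq.
pose e := gcdn p q; have e0 : (0 < e)%N by rewrite gcdn_gt0 p0.
have [a pE] := dvdnP (dvdn_gcdl p q); have [b qE] := dvdnP (dvdn_gcdr p q).
rewrite -/e in pE qE.
have a0 : (0 < a)%N by case: (a) pE p0 => // ->.
have b0 : (0 < b)%N by case: (b) qE q0 => // ->.
have cab : coprime a b.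
  by rewrite /coprime -(eqn_pmul2r e0) muln_gcdl -pE -qE mul1n.
have [||| s s0 [sb sa]] := coprime_param (X := (l1 / l3) ^+ e) (Y := (l2 / l3) ^+ e) a0 cab.
- by rewrite expf_neq0// mulf_neq0 ?invr_eq0.
- by rewrite expf_neq0// mulf_neq0 ?invr_eq0.
- rewrite -!exprM [(e * a)%N]mulnC [(e * b)%N]mulnC -pE -qE !expr_div_n mulf_div.
  by rewrite lpq -exprD mulfV// expf_neq0.
have s_inj : injective (fun n => s ^+ n).
  have lt m n : (m < n)%N -> s ^+ m = s ^+ n -> False.
    move=> mn; rewrite -(subnKC (ltnW mn)) exprD -[LHS]mulr1.
    move=> /(mulfI (expf_neq0 m s0)) /esym sn.
    apply: (un (e * (n - m))%N); first by rewrite muln_gt0 e0 subn_gt0.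
    have := congr1 (fun x => x ^+ b) sn; rewrite expr1n -exprM mulnC exprM sb.
    rewrite -exprM expr_div_n => /(congr1 (fun x => x * l3 ^+ (e * (n - m)))).
    by rewrite divfK ?expf_neq0// mul1r.
  by move=> m n mn; case: (ltngtP m n) => // h; [case: (lt _ _ h mn)|case: (lt _ _ h (esym mn))].
pose P := cols3 e1 e2 e3; pose k := l3 ^+ e / s ^+ a.
have k0 : k != 0 by rewrite mulf_neq0 ?invr_eq0 ?expf_neq0.
have l1e : l1 ^+ e = k * s ^+ (a + b).
  rewrite /k exprD mulrA divfK ?expf_neq0// sb expr_div_n mulrC divfK//.
  by rewrite expf_neq0.
have l2e : l2 ^+ e = k.
  by rewrite /k sa invrK expr_div_n mulrC divfK// expf_neq0.
have l3e : l3 ^+ e = k * s ^+ a by rewrite /k divfK// expf_neq0.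
have [|vG|cF] := torus_curve a0 b0 cab (cs_conj Pu cs).
- move=> x y z t t0 v0; rewrite !ev_lin_subst => Fv.
  pose w (r : C) := P *m vec3 (r ^+ (a + b) * x) y (r ^+ a * z).
  pose c : {poly C} := curve (lin_subst F P) (\col_i [:: x *: 'X^(a + b); y%:P; z *: 'X^a]`_i).
  have cE r : c.[r] = ev F (w r).
    rewrite curveE ev_lin_subst; congr (ev F (P *m _)).
    by apply/colP; apply: ord3P; rewrite !mxE ?inordK//= !hornerE// mulrC.
  rewrite -/(w t) -cE (_ : c = 0) ?horner0//.
  apply: (poly_inj_eq0 s_inj) => n; rewrite cE.
  have vn0 : P *m vec3 x y z != 0 by rewrite mulmx_eq0.
  have := cs_orbit (e * n) Gg vn0 Fv; have -> : g ^+ (e * n) *m (P *m vec3 x y z) =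
      k ^+ n *: w (s ^+ n).
    rewrite /w /P !cols3_mul !mulmxDr -!scalemxAr (eigen_pow _ g1) (eigen_pow _ g2).
    rewrite (eigen_pow _ g3) !exprM l1e l2e l3e !exprMn.
    apply/colP => i; rewrite !mxE -!exprM ![(n * _)%N]mulnC !exprM.
    by ring.
  rewrite (ev_scale _ _ (cs_homog cs)) => /eqP; rewrite mulf_eq0 expf_eq0 expf_eq0.
  by rewrite (negPf k0) !andbF /= => /eqP.
- by left; apply: mxconj_vabelian Pu (cs_group cs) vG.
- by right; apply: conic_form_subst Pu cF.
Qed.

Lemma unrelated_sym x y : unrelated x y -> unrelated y x.
Proof. by move=> xy n n0 /esym; exact: xy. Qed.

Lemma cols3_cycle_unit u v w : cols3 u v w \in unitmx ->
  cols3 u w v \in unitmx /\ cols3 v w u \in unitmx.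
Proof.
rewrite !unitmxE !unitfE !det3E !cols3E => h; split; apply: contra h => /eqP h; apply/eqP.
  by rewrite -[RHS]oppr0 -h; ring.
by rewrite -h; ring.
Qed.

(** Cancelling common factors leaves the relation of [torus_case]; if an exponent on the left drops
    out, two eigenvalues would be related. *)
Lemma monomial_relation_case g e1 e2 e3 l1 l2 l3 i j k i' j' k' : G g ->
  g *m e1 = l1 *: e1 -> g *m e2 = l2 *: e2 -> g *m e3 = l3 *: e3 ->
  cols3 e1 e2 e3 \in unitmx -> l1 != 0 -> l2 != 0 -> l3 != 0 ->
  unrelated l1 l3 -> unrelated l2 l3 ->
  (i' <= i)%N -> (j' <= j)%N -> (i + j + k = i' + j' + k')%N ->
  ~ (i = i' /\ j = j') ->
  l1 ^+ i * l2 ^+ j * l3 ^+ k = l1 ^+ i' * l2 ^+ j' * l3 ^+ k' ->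
  mxvabelian G \/ conic_form F.
Proof.
move=> Gg g1 g2 g3 Pu l10 l20 l30 u13 u23 ii jj s ne e.
have kk : k' = (i - i' + (j - j') + k)%N by move: ii jj s; clear; lia.
have {}e : l1 ^+ (i - i') * l2 ^+ (j - j') = l3 ^+ (i - i' + (j - j')).
  apply: (mulIf (expf_neq0 k l30)); rewrite -exprD -kk.
  apply: (mulfI (expf_neq0 i' l10)); apply: (mulfI (expf_neq0 j' l20)).
  rewrite mulrCA [RHS]mulrCA [RHS]mulrA -e -{2}(subnK ii) -{2}(subnK jj) !exprD.
  by ring.
have [i0|ip] := posnP (i - i')%N.
  have [j0|jp] := posnP (j - j')%N.
    by case: ne; move: i0 j0 ii jj; clear; lia.
  by move: e; rewrite i0 expr0 mul1r add0n => /(u23 _ jp).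
have [j0|jp] := posnP (j - j')%N.
  by move: e; rewrite j0 expr0 mulr1 addn0 => /(u13 _ ip).
exact: torus_case Gg g1 g2 g3 Pu l10 l20 l30 u13 ip jp e.
Qed.

(** If the monomials of F in the eigenbasis took distinct values at the eigenvalues, vanishing along
    the powers of g would isolate each of them. So two values agree. The degrees being equal, two of
    the three exponent differences have the same sign, and a permutation of the eigenvalues leads to
    [monomial_relation_case]. *)
Lemma distinct_eigenvalues_case g e1 e2 e3 l1 l2 l3 : G g ->
  g *m e1 = l1 *: e1 -> g *m e2 = l2 *: e2 -> g *m e3 = l3 *: e3 ->
  cols3 e1 e2 e3 \in unitmx -> l1 != 0 -> l2 != 0 -> l3 != 0 ->
  unrelated l1 l2 -> unrelated l1 l3 -> unrelated l2 l3 ->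
  mxvabelian G \/ conic_form F.
Proof.
move=> Gg g1 g2 g3 Pu l10 l20 l30 u12 u13 u23.
pose P := cols3 e1 e2 e3; pose F' := lin_subst F P; have csP := cs_conj Pu cs.
have [u32 u21] : unrelated l3 l2 /\ unrelated l2 l1 by split; exact: unrelated_sym.
have u31 := unrelated_sym u13.
have [P' P''] := cols3_cycle_unit Pu.
pose la i : C := [:: l1; l2; l3]`_(i : 'I_3).
have la0 i : la i != 0.
  by move: i; apply: ord3P; rewrite /la ?inordK.
pose ex (m : 'X_{1..3}) : C := \prod_i la i ^+ m i.
have [m [m' [mF [m'F [mm' exm]]]]] : exists m m',
    m \in msupp F' /\ m' \in msupp F' /\ m != m' /\ ex m = ex m'.
  pose r3 : seq 'rV[C]_3 := [:: row3 1 0 0; row3 0 1 0; row3 0 0 1].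
  have [l|v [v0 Fv lv]] := avoid_lines (ls := r3) (cs_deg csP) (cs_homog csP)
      (cs_neq0 csP) (cs_noline csP).
    rewrite !inE => /or3P[]/eqP ->; apply/eqP => /matrixP e.
    - by have /eqP := e 0 0; rewrite row3E mxE oner_eq0.
    - by have /eqP := e 0 1; rewrite row3E mxE oner_eq0.
    - by have /eqP := e 0 (inord 2); rewrite row3E mxE oner_eq0.
  have v_neq0 i : v i 0 != 0.
    have nz (w : C) : w%:M != 0 :> 'M_1 -> w != 0.
      by apply: contra => /eqP ->; apply/eqP/matrixP => ? ?; rewrite !mxE mul0rn.
    have rv a b c : row3 a b c *m v = (a * v 0 0 + b * v 1 0 + c * v (inord 2) 0)%:M.
      by rewrite {1}(vec3K v) row3_mul.
    move: i; apply: ord3P; apply: nz.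
    - by have := lv (row3 1 0 0); rewrite rv !inE eqxx !mul0r !addr0 mul1r; apply.
    - by have := lv (row3 0 1 0); rewrite rv !inE eqxx !mul0r add0r addr0 mul1r orbT; apply.
    - by have := lv (row3 0 0 1); rewrite rv !inE eqxx !mul0r !add0r mul1r !orbT; apply.
  apply: contrapT => h; pose vm (m : 'X_{1..3}) : C := \prod_i v i 0 ^+ m i.
  have sum0 n : \sum_(m <- msupp F') F'@_m * vm m * ex m ^+ n = 0.
    have Pv0 : P *m v != 0 by rewrite mulmx_eq0.
    have Fv' : ev F (P *m v) = 0 by rewrite -ev_lin_subst.
    transitivity (ev F (g ^+ n *m (P *m v))); last exact: cs_orbit.
    have -> : g ^+ n *m (P *m v) = P *m (\col_i (la i ^+ n * v i 0)).
      rewrite (vec3K v) (vec3K (\col_i _)) /P !cols3_mul !mulmxDr -!scalemxAr.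
      rewrite (eigen_pow _ g1) (eigen_pow _ g2) (eigen_pow _ g3).
      rewrite !mxE !scalerA /la ?inordK//=.
      by congr (_ *: _ + _ *: _ + _ *: _); rewrite mulrC.
    rewrite -ev_lin_subst -/F' /ev mevalE. apply: eq_bigr => k _; rewrite -mulrA.
    congr (_ * _); rewrite /vm /ex.
    transitivity (\prod_(i < 3) (v i 0 ^+ k i * (la i ^+ k i) ^+ n)).
      by rewrite big_split prodrXl.
    by apply: eq_bigr => i _; rewrite mxE exprMn mulrC -!exprM mulnC.
  have sump (q : {poly C}) : \sum_(m <- msupp F') F'@_m * vm m * q.[ex m] = 0.
    under eq_bigr do rewrite horner_coef mulr_sumr.
    rewrite exchange_big big1 //= => j _.
    under eq_bigr do rewrite mulrCA.
    by rewrite -mulr_sumr sum0 mulr0.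
  have [m0 m0F] : exists m, m \in msupp F'.
    apply: contrapT => hF; case/eqP: (cs_neq0 csP); apply/mpolyP => m; rewrite mcoeff0.
    by apply: contrapT => /eqP; rewrite -mcoeff_msupp => mF; apply: hF; exists m.
  (* An interpolation polynomial: it kills every term of the sum but that of m0. *)
  pose q := \prod_(m <- msupp F' | m != m0) ('X - (ex m)%:P).
  have := sump q; rewrite (bigD1_seq m0)//= big1_seq => [|m /andP[mm0 mF]]; last first.
    suff /rootP -> : root q (ex m) by rewrite mulr0.
    rewrite /q (big_rem m)//= mm0 rootM root_XsubC eqxx.
    by [].
  move/eqP; rewrite addr0 mulf_eq0 mulf_eq0 -[F'@_m0 == 0]negbK -mcoeff_msupp m0F /=.
  rewrite (_ : vm m0 == 0 = false); last first.
    by apply/negbTE; rewrite /vm prodf_seq_neq0; apply/allP => i _; rewrite expf_neq0.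
  rewrite /q horner_prod prodf_seq_eq0 => /hasP[m mF /andP[mm0]].
  rewrite hornerXsubC subr_eq0 => /eqP em; apply: h; exists m, m0.
  by split => //; split => //; split => //.
have deg3 (k : 'X_{1..3}) : mdeg k = (k 0%R + k 1%R + k (inord 2))%N.
  rewrite mdegE !big_ord_recl big_ord0 addn0 addnA.
  by congr (k _ + k _ + k _)%N; apply: val_inj; rewrite /= ?inordK.
have ex3 (k : 'X_{1..3}) : ex k = l1 ^+ k 0 * l2 ^+ k 1 * l3 ^+ k (inord 2).
  rewrite /ex !big_ord_recl big_ord0 mulr1 mulrA /la /=.
  by congr (_ ^+ k _ * _ ^+ k _ * _ ^+ k _); apply: val_inj; rewrite /= ?inordK.
have hF : {in msupp F', forall m, mdeg m = d} by apply/dhomogP; exact: cs_homog csP.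
have e12 := hF _ mF; rewrite -(hF _ m'F) !deg3 in e12; rewrite !ex3 in exm.
have mm : ~ (m 0 = m' 0 /\ m 1 = m' 1 /\ m (inord 2) = m' (inord 2)).
  by move=> [h0 [h1 h2]]; case/eqP: mm'; apply/mnmP; apply: ord3P.
move: (m 0) (m 1) (m (inord 2)) (m' 0) (m' 1) (m' (inord 2)) mm e12 exm => {m mF m' m'F mm'}.
move=> i j k i' j' k' ne s e.
have [ii|ii] := leqP i' i; have [jj|jj] := leqP j' j.
- apply: (monomial_relation_case Gg g1 g2 g3 Pu _ _ _ _ _ ii jj s _ e) => //.
  by move: ne s; clear; lia.
- have [kk|kk] := leqP k' k.
    apply: (monomial_relation_case (k := j) (k' := j') Gg g1 g3 g2 P') ii kk _ _ _ => //.
    + by move: s; clear; lia.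
    + by move: ne s; clear; lia.
    + by rewrite mulrAC e mulrAC.
  apply: (monomial_relation_case (k := i') (k' := i) Gg g2 g3 g1 P'') (ltnW jj) (ltnW kk) _ _ _ => //.
  + by move: s; clear; lia.
  + by move: ne s; clear; lia.
  + by rewrite mulrC mulrA -e [RHS]mulrC mulrA.
- have [kk|kk] := leqP k' k.
    apply: (monomial_relation_case (k := i) (k' := i') Gg g2 g3 g1 P'') jj kk _ _ _ => //.
    + by move: s; clear; lia.
    + by move: ne s; clear; lia.
    + by rewrite mulrC mulrA e [RHS]mulrC mulrA.
  apply: (monomial_relation_case (k := j') (k' := j) Gg g1 g3 g2 P') (ltnW ii) (ltnW kk) _ _ _ => //.
  + by move: s; clear; lia.
  + by move: ne s; clear; lia.
  + by rewrite mulrAC -e mulrAC.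
- apply: (monomial_relation_case (k := k') (k' := k) Gg g1 g2 g3 Pu) (ltnW ii) (ltnW jj) _ _ _ => //.
  by move: ne s; clear; lia.
Qed.

Lemma sub_scalar_comm (g : 'M[C]_3) x y :
  (g - x%:M) *m (g - y%:M) = (g - y%:M) *m (g - x%:M).
Proof.
rewrite !mulmxBl !mulmxBr !mul_scalar_mx !mul_mx_scalar !scale_scalar_mx [y * x]mulrC.
move: (g *m g) (x *: g) (y *: g) => a b c.
by apply/matrixP => i j; rewrite !mxE; ring.
Qed.

Lemma eigenvectors_unit g e1 e2 e3 x y z :
  e1 != 0 -> e2 != 0 -> e3 != 0 ->
  g *m e1 = x *: e1 -> g *m e2 = y *: e2 -> g *m e3 = z *: e3 ->
  x != y -> x != z -> y != z -> cols3 e1 e2 e3 \in unitmx.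
Proof.
move=> n1 n2 n3 g1 g2 g3 xy xz yz; apply: unit_of_inj => v; rewrite (vec3K v).
move: (v 0 0) (v 1 0) (v (inord 2) 0) => a b c Pv.
have gw w r s t : cols3 e1 e2 e3 *m vec3 r s t = 0 ->
    cols3 e1 e2 e3 *m vec3 ((x - w) * r) ((y - w) * s) ((z - w) * t) = 0.
  move=> /(congr1 (mulmx (g - w%:M))); rewrite mulmx0 => <-.
  rewrite !cols3_mul !mulmxDr -!scalemxAr !mulmxBl !mul_scalar_mx g1 g2 g3.
  by rewrite -!scalerBl !scalerA ![_ * (_ - w)]mulrC.
have one e r : e != 0 -> r *: e = 0 :> 'cV[C]_3 -> r = 0.
  by move=> e0 /eqP; rewrite scalemx_eq0 (negPf e0) orbF => /eqP.
have h1 := gw z _ _ _ (gw y _ _ _ Pv); have h2 := gw z _ _ _ (gw x _ _ _ Pv).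
have h3 := gw y _ _ _ (gw x _ _ _ Pv).
move: h1 h2 h3; rewrite !cols3_mul !subrr !mul0r !mulr0 !scale0r !addr0 !add0r.
move=> /(one _ _ n1)/eqP + /(one _ _ n2)/eqP + /(one _ _ n3)/eqP.
rewrite !mulf_eq0 !subr_eq0 (negPf xy) (negPf xz) (negPf yz).
rewrite ![_ == y]eq_sym ![z == _]eq_sym (negPf xz) (negPf yz) (eq_sym y) (negPf xy).
move=> /= /eqP-> /eqP-> /eqP->.
by apply/colP; apply: ord3P; rewrite vec3E mxE.
Qed.

Lemma infinite_order_case g : G g ->
  (forall n k, (0 < n)%N -> g ^+ n <> k%:M) -> mxvabelian G \/ conic_form F.
Proof.
move=> Gg inf; have [l [sl ann eig _]] := eigen_data g.
have [N N0 NP] := common_power l.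
have l0 z : z \in l -> z != 0.
  by move=> /eig[v v0 gv]; exact: stabv_neq0 (cs_group cs) v0 Gg gv.
have Gh := cs_pow N Gg; have annh := annihilates_pow N ann.
have hns k : g ^+ N != k%:M by apply/eqP; exact: inf.
move: l sl eig NP l0 annh {ann} => [|a [|b [|c [|? ?]]]]//= _ eig NP l0.
rewrite /annihilates !big_cons big_nil mulr1 -!mulmxE mulmxA.
have [e1 e10 g1] := eig a (mem_head _ _).
have [|e2 e20 g2] := eig b; first by rewrite !inE eqxx orbT.
have [|e3 e30 g3] := eig c; first by rewrite !inE eqxx !orbT.
have [a0 [b0 c0]] : a != 0 /\ b != 0 /\ c != 0.
  by split; [|split]; apply: l0; rewrite !inE eqxx ?orbT.
have := NP a b; have := NP a c; have := NP b c; rewrite !inE !eqxx !orbT.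
move=> /(_ isT isT) bc /(_ isT isT) ac /(_ isT isT) ab.
move: (expf_neq0 N a0) (expf_neq0 N b0) (expf_neq0 N c0) ab ac bc.
have h1 := eigen_pow N g1; have h2 := eigen_pow N g2; have h3 := eigen_pow N g3.
move: h1 h2 h3; move: (a ^+ N) (b ^+ N) (c ^+ N) => x y z h1 h2 h3 x0 y0 z0.
move=> ab ac bc ann.
have un p q : p = q \/ unrelated p q -> p != q -> unrelated p q.
  by move=> [->|//]; rewrite eqxx.
have [xy|xy] := eqVneq x y.
  subst y; have [xz|xz] := eqVneq x z; first by subst z; exact: unipotent_case Gh x0 _ ann.
  by case: (two_eigenvalues_case Gh x0 z0 (un _ _ ac xz) _ _ ann).
have [xz|xz] := eqVneq x z.
  subst z; rewrite -mulmxA (sub_scalar_comm _ y x) mulmxA in ann.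
  by case: (two_eigenvalues_case Gh x0 y0 (un _ _ ab xy) _ _ ann).
have [yz|yz] := eqVneq y z.
  subst z; rewrite (sub_scalar_comm _ x y) -mulmxA (sub_scalar_comm _ x y) mulmxA in ann.
  by case: (two_eigenvalues_case Gh y0 x0 (unrelated_sym (un _ _ ab xy)) _ _ ann).
have Pu := eigenvectors_unit e10 e20 e30 h1 h2 h3 xy xz yz.
exact: distinct_eigenvalues_case Gh h1 h2 h3 Pu x0 y0 z0 (un _ _ ab xy) (un _ _ ac xz) (un _ _ bc yz).
Qed.

End InfiniteOrder.
End Eigen.

(** * Limits along ultrafilters *)

Section UltraLimits.
Variable R : realType.
Local Notation C := (CC R).

(** Compactness of real segments, applied to the real and the imaginary part; along an ultrafilter a
    cluster point is a limit. *)
Lemma ultra_bounded_cvg (T : Type) (U : set_system T) (f : T -> C) (M : C) :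
  UltraFilter U -> U [set x | `|f x| <= M] -> exists l : C, f @ U --> l.
Proof.
move=> UU UM; pose m : R := complex.Re (M : R[i]).
have part (p : C -> R) : (forall z : C, (`|p z|%:C)%C <= `|z| :> R[i]) ->
    exists r : R, p \o f @ U --> r.
  move=> pz.
  have h : U ((p \o f) @^-1` `[(- m), m]%classic).
    apply: filterS UM => x /= fM.
    have : (`|p (f x)|%:C)%C <= M :> R[i] by exact: le_trans (pz _) fM.
    by rewrite lecE /= => /andP[_]; rewrite in_itv /= ler_norml.
  have [r [_ clr]] := @segment_compact R (- m) m ((p \o f) @ U) _ h.
  exists r => B Br.
  have [//|nB] := in_ultra_setVsetC ((p \o f) @^-1` B) UU.
  by have [y []] := clr (~` B) B nB Br.
have [|r fr] := part (@complex.Re R); first exact: normc_ge_Re.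
have [|s fs] := part (@complex.Im R).
  move=> z; rewrite normc_def lecR -(sqrtr_sqr (complex.Im z)).
  by rewrite ler_wsqrtr// lerDr sqr_ge0.
exists ((r +i* s)%C : R[i]); apply/cvgrPdist_lt => e e0.
pose er : R := complex.Re (e : R[i]).
have eE : e = (er%:C)%C :> R[i] by rewrite RRe_real// gtr0_real.
have er0 : 0 < er by move: e0; rewrite eE ltcR.
have er2 : 0 < er / 2 by rewrite divr_gt0.
move/cvgrPdist_lt: fr => /(_ _ er2); move/cvgrPdist_lt: fs => /(_ _ er2) + fr.
apply: filterS2 fr => x /= hr hs; rewrite eE.
case: (f x : R[i]) hr hs => a b /= hr hs.
change ((`|((r - a) +i* (s - b))%C : R[i]| < (er%:C)%C :> R[i])).
rewrite normc_def ltcR /= (le_lt_trans _ (_ : `|r - a| + `|s - b| < er))//; last first.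
  by rewrite [er]splitr ltrD.
rewrite -[leRHS]ger0_norm ?addr_ge0// -sqrtr_sqr ler_wsqrtr// [leRHS]sqrrD !real_normK ?num_real//.
by rewrite -addrA lerD2l lerDr mulrn_wge0// mulr_ge0.
Qed.

End UltraLimits.

(** * Rescaled limits of unbounded families of matrices *)

Section Escape.
Variable R : realType.
Local Notation C := (CC R).
Implicit Types (F : {mpoly C[3]}) (G D : set 'M[C]_3) (g h P : 'M[C]_3) (v : 'cV[C]_3).

(** Unboundedness is stated by a negation because M ranges over C, whose order is partial; this is
    what the failure of a bound provides. *)
Lemma ultra_unbounded (T : Type) (G : set T) (N : T -> C) :
  (forall x, 0 <= N x) -> (forall M, exists2 x, G x & ~ N x <= M) ->
  exists U : set_system T, [/\ UltraFilter U, U G,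
    forall M, 0 <= M -> U [set x | M < N x] & (fun x => (N x)^-1) @ U --> (0 : C)].
Proof.
move=> N0 unb; pose B (M : C) := [set x | G x /\ ~ N x <= M].
pose FB : set_system T := filter_from [set M : C | 0 <= M] B.
have FF : ProperFilter FB.
  apply: filter_from_proper.
    apply: filter_from_filter; first by exists 0 => /=.
    move=> M1 M2 /= M10 M20; exists (M1 + M2); first exact: addr_ge0.
    move=> x [Gx nM]; split; split => // le; apply: nM; apply: (le_trans le).
      by rewrite lerDl.
    by rewrite lerDr.
  by move=> M _; have [x Gx nM] := unb M; exists x.
have [U [UU sub]] := ultraFilterLemma FF; exists U.
have UN M : 0 <= M -> U [set x | M < N x].
  move=> M0; apply: sub; exists M => // x [_ nM] /=.
  by rewrite real_ltNge ?ger0_real//; apply/negP.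
split => //; first by apply: sub; exists 0 => [|x []] //; exact: lexx.
apply/cvgrPdist_lt => e e0; have e10 : 0 <= e^-1 by rewrite invr_ge0 ltW.
apply: filterS (UN _ e10) => x /= nM; rewrite sub0r normrN normfV ger0_norm//.
rewrite -[ltRHS]invrK ltf_pV2// posrE ?invr_gt0//.
by rewrite (lt_trans _ nM)// invr_gt0.
Qed.

Definition mnorm m n (a : 'M[C]_(m, n)) : C := \sum_i \sum_j `|a i j|.

Lemma mnorm_ge0 m n (a : 'M[C]_(m, n)) : 0 <= mnorm a.
Proof. by rewrite sumr_ge0// => i _; rewrite sumr_ge0. Qed.

Lemma le_mnorm m n (a : 'M[C]_(m, n)) i j : `|a i j| <= mnorm a.
Proof.
rewrite /mnorm (bigD1 i)//= (bigD1 j)//= -addrA lerDl addr_ge0// sumr_ge0// => *.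
by rewrite sumr_ge0.
Qed.

Lemma mnormZ m n (k : C) (a : 'M[C]_(m, n)) : mnorm (k *: a) = `|k| * mnorm a.
Proof.
rewrite /mnorm mulr_sumr; apply: eq_bigr => i _; rewrite mulr_sumr.
by apply: eq_bigr => j _; rewrite mxE normrM.
Qed.

Definition mxcvg (T : Type) (U : set_system T) m n (f : T -> 'M[C]_(m, n)) (a : 'M[C]_(m, n)) :=
  forall i j, (fun x => f x i j) @ U --> a i j.

Lemma cvg_bigsum (T : Type) (U : set_system T) {FU : Filter U} (I : Type) (s : seq I)
    (f : I -> T -> C) (a : I -> C) : (forall i, f i @ U --> a i) ->
  (fun x => \sum_(i <- s) f i x) @ U --> \sum_(i <- s) a i.
Proof.
move=> fa; elim: s => [|i s IH].
  rewrite big_nil; under eq_fun do rewrite big_nil; exact: cvg_cst.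
by rewrite big_cons; under eq_fun do rewrite big_cons; apply: cvgD; [exact: fa|exact: IH].
Qed.

Lemma mxcvg_mul (T : Type) (U : set_system T) {FU : Filter U} m n p
    (f : T -> 'M[C]_(m, n)) (g : T -> 'M[C]_(n, p)) a b : mxcvg U f a -> mxcvg U g b ->
  mxcvg U (fun x => f x *m g x) (a *m b).
Proof.
move=> fa gb i j; rewrite mxE; under eq_fun do rewrite mxE.
by apply: cvg_bigsum => k; apply: cvgM; [exact: fa|exact: gb].
Qed.

Lemma mxcvg_mulr (T : Type) (U : set_system T) {FU : Filter U} m n p
    (f : T -> 'M[C]_(m, n)) a (b : 'M[C]_(n, p)) : mxcvg U f a ->
  mxcvg U (fun x => f x *m b) (a *m b).
Proof. by move=> fa; apply: mxcvg_mul => // i j; exact: cvg_cst. Qed.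

Lemma mxcvg_trace (T : Type) (U : set_system T) {FU : Filter U} n
    (f : T -> 'M[C]_n) a : mxcvg U f a -> (fun x => \tr (f x)) @ U --> \tr a.
Proof. by move=> fa; apply: cvg_bigsum => k; exact: fa. Qed.

Lemma mxcvg_mnorm (T : Type) (U : set_system T) {FU : Filter U} m n
    (f : T -> 'M[C]_(m, n)) a : mxcvg U f a -> (fun x => mnorm (f x)) @ U --> mnorm a.
Proof.
by move=> fa; apply: cvg_bigsum => i; apply: cvg_bigsum => j; apply: cvg_norm; exact: fa.
Qed.

Lemma mxcvg_det3 (T : Type) (U : set_system T) {FU : Filter U}
    (f : T -> 'M[C]_3) a : mxcvg U f a -> (fun x => \det (f x)) @ U --> \det a.
Proof.
move=> fa; rewrite det3E; under eq_fun do rewrite det3E.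
have m2 i j i' j' k l k' l' : (fun x => f x i j * f x i' j' - f x k l * f x k' l') @ U -->
    a i j * a i' j' - a k l * a k' l'.
  by apply: cvgB; apply: cvgM; apply: fa.
apply: cvgD; last by apply: cvgM; [exact: fa|exact: m2].
by apply: cvgB; apply: cvgM; [exact: fa|exact: m2|exact: fa|exact: m2].
Qed.

Lemma mxcvg_bounded (T : Type) (U : set_system T) m n (f : T -> 'M[C]_(m, n)) (M : C) :
  UltraFilter U -> (forall i j, U [set x | `|f x i j| <= M]) ->
  exists a, mxcvg U f a.
Proof.
move=> UU fM.
have lim i j : exists l : C, (fun x => f x i j) @ U --> l by exact: ultra_bounded_cvg (fM i j).
by exists (\matrix_(i, j) projT1 (cid (lim i j))) => i j; rewrite mxE; case: cid.
Qed.

Lemma cvg_unique_C (T : Type) (U : set_system T) {FU : ProperFilter U} (f : T -> C) (a b : C) :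
  f @ U --> a -> f @ U --> b -> a = b.
Proof. by move=> fa fb; apply: (cvg_unique _ fa fb); exact: norm_hausdorff. Qed.

(** The rescaled matrices have norm 1 along U, so their limit has norm 1 and is not 0. *)
Lemma escape_limit (T : Type) (G : set T) m n (f : T -> 'M[C]_(m, n)) :
  (forall M, exists2 x, G x & ~ mnorm (f x) <= M) ->
  exists (U : set_system T) (a : 'M[C]_(m, n)), [/\ UltraFilter U, U G,
    (fun x => (mnorm (f x))^-1) @ U --> (0 : C),
    mxcvg U (fun x => (mnorm (f x))^-1 *: f x) a & a != 0].
Proof.
move=> unb; have [|U [UU UG UN N0]] := ultra_unbounded (N := fun x => mnorm (f x)) _ unb.
  by move=> x; exact: mnorm_ge0.
have [|a fa] := @mxcvg_bounded _ U _ _ (fun x => (mnorm (f x))^-1 *: f x) 1 UU.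
  move=> i j; apply: filterS filterT => x _ /=.
  rewrite mxE normrM normfV (ger0_norm (mnorm_ge0 _)).
  have [->|fn0] := eqVneq (mnorm (f x)) 0; first by rewrite invr0 mul0r ler01.
  by rewrite mulrC ler_pdivrMr ?mul1r ?le_mnorm// lt_neqAle eq_sym fn0 mnorm_ge0.
exists U, a; split => //; apply/eqP => a0.
have h1 : (fun x => mnorm ((mnorm (f x))^-1 *: f x)) @ U --> (1 : C).
  apply/cvgrPdist_lt => e e0; apply: filterS (UN 0 (lexx 0)) => x /= N_gt0.
  by rewrite mnormZ normfV (gtr0_norm N_gt0) mulVf ?gt_eqF// subrr normr0.
have : mnorm a = 1 by exact: cvg_unique_C (mxcvg_mnorm fa) h1.
move/eqP; rewrite a0 /mnorm big1 => [|i _]; first by rewrite eq_sym oner_eq0.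
by rewrite big1 => // j _; rewrite mxE normr0.
Qed.

Lemma cvg_scale_bounded (T : Type) (U : set_system T) {FU : Filter U}
    (k f : T -> C) (M : C) : k @ U --> (0 : C) -> U [set x | `|f x| <= M] ->
  (fun x => k x * f x) @ U --> (0 : C).
Proof.
move=> k0 fM; apply/cvgrPdist_lt => e e0.
have M1 : 0 < `|M| + 1 by rewrite ltr_wpDl.
have [e' e'0 eE] : exists2 e', 0 < e' & e' * (`|M| + 1) = e.
  by exists (e / (`|M| + 1)); rewrite ?divr_gt0// divfK// gt_eqF.
move/cvgrPdist_lt: k0 => /(_ _ e'0); apply: filterS2 fM => x /= fM.
rewrite !sub0r !normrN normrM -eE => ke.
apply: (@le_lt_trans _ _ (`|k x| * (`|M| + 1))); last by rewrite ltr_pM2r.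
rewrite ler_wpM2l// (le_trans fM)// (le_trans (real_ler_norm _)) ?lerDl//.
by rewrite ger0_real// (le_trans _ fM).
Qed.

End Escape.

(** * Torsion groups *)

Section Torsion.
Variable R : realType.
Local Notation C := (CC R).
Implicit Types (F : {mpoly C[3]}) (G D : set 'M[C]_3) (g h P : 'M[C]_3) (v : 'cV[C]_3).

(** If T had rank 2, its image would be a line, with finitely many points of the curve. Their
    preimages are lines through the kernel, and a point of the curve off these lines gives a
    contradiction. *)
Lemma rank_one_limit d F (T : 'M[C]_3) : (0 < d)%N -> F \is d.-homog -> F != 0 ->
  noline F -> \det T = 0 -> (forall v, v != 0 -> ev F v = 0 -> ev F (T *m v) = 0) ->
  exists (a : 'cV[C]_3) (p : 'rV[C]_3), T = a *m p.
Proof.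
move=> d0 homF F0 nl /eqP; rewrite -det_tr => /det0P[kt kt0 Tk] FT.
pose k := kt^T; have k0 : k != 0 by rewrite trmx_eq0.
have {}Tk : T *m k = 0.
  by have := congr1 trmx Tk; rewrite trmx_mul trmxK trmx0.
have [u [w Pu]] := complete_basis k0; set P := cols3 k u w in Pu.
have TP x y z : T *m (P *m vec3 x y z) = y *: (T *m u) + z *: (T *m w).
  by rewrite cols3_mul !mulmxDr -!scalemxAr Tk scaler0 add0r.
have coordE v : exists x y z, v = P *m vec3 x y z /\
    [/\ x%:M = row 0 (invmx P) *m v, y%:M = row 1 (invmx P) *m v
      & z%:M = row (inord 2) (invmx P) *m v].
  pose c := invmx P *m v; exists (c 0 0), (c 1 0), (c (inord 2) 0).
  rewrite -vec3K mulKVmx//; split => //.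
  by split; apply/matrixP => i j; rewrite !ord1 -row_mul !mxE.
have rank1 y' z' (a : 'cV[C]_3) : T *m u = y' *: a -> T *m w = z' *: a ->
    exists (a : 'cV[C]_3) (p : 'rV[C]_3), T = a *m p.
  move=> Tu Tw; exists a, (y' *: row 1 (invmx P) + z' *: row (inord 2) (invmx P)).
  apply/matrixP => i j; pose v : 'cV[C]_3 := delta_mx j 0.
  have Tv : T *m v = (a *m (y' *: row 1 (invmx P) + z' *: row (inord 2) (invmx P))) *m v.
    have [x [y [z [vE [_ yE zE]]]]] := coordE v.
    rewrite -mulmxA mulmxDl -!scalemxAl -yE -zE {1}vE TP Tu Tw !scalerA.
    rewrite !scale_scalar_mx -raddfD mul_mx_scalar -scalerDl.
    by congr (_ *: _); ring.
  by move/matrixP/(_ i 0): Tv; rewrite -!colE !mxE.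
have [Tu0|Tu0] := eqVneq (T *m u) 0.
  by apply: (rank1 0 1 (T *m w)); rewrite ?scale1r// Tu0 scale0r.
have [[c Tw]|ind] := pselect (exists c, T *m w = c *: (T *m u)).
  by apply: (rank1 1 c (T *m u)); rewrite ?scale1r.
have {}ind c : T *m w <> c *: (T *m u) by move=> e; apply: ind; exists c.
have [s s0 sP] := finite_zeros homF nl Tu0 ind.
have Qu : invmx P \in unitmx by rewrite unitmx_inv.
have lin_neq0 (b c : C) : (b, c) != 0 ->
    b *: row 1 (invmx P) + c *: row (inord 2) (invmx P) != 0.
  apply: contra => /eqP e; have := congr1 (mulmx^~ P) e.
  rewrite mul0mx mulmxDl -!scalemxAl -!row_mul mulVmx// => /matrixP h.
  have := h 0 1; have := h 0 (inord 2); rewrite !mxE -!val_eqE /= !inordK//=.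
  by rewrite !mulr0 !mulr1 add0r addr0 => -> ->.
(* Avoiding the first line keeps T v away from 0; each other line is the preimage of a point listed
   in s. *)
pose ls := row 1 (invmx P) ::
  [seq c.1 *: row 1 (invmx P) + (- c.2) *: row (inord 2) (invmx P) | c <- s].
have [l|v [v0 Fv lv]] := avoid_lines (ls := ls) d0 homF F0 nl.
  rewrite inE => /orP[/eqP ->|/mapP[c /s0 c0 ->]].
    have := lin_neq0 1 0; rewrite scale1r scale0r addr0; apply.
    by rewrite xpair_eqE oner_eq0.
  apply: lin_neq0; apply: contra c0; rewrite !xpair_eqE oppr_eq0.
  by case: (c).
have [x [y [z [vE [_ yE zE]]]]] := coordE v.
have yz0 : (z, y) != 0.
  apply/eqP => -[_ y0]; have := lv _ (mem_head _ _); rewrite -yE y0.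
  by move/eqP; apply; apply/matrixP => i j; rewrite !mxE mul0rn.
have := FT v v0 Fv; rewrite {1}vE TP addrC => /(sP _ _ yz0)[c cs e].
have /lv : c.1 *: row 1 (invmx P) + (- c.2) *: row (inord 2) (invmx P) \in ls.
  by rewrite inE (map_f _ cs) orbT.
rewrite mulmxDl -!scalemxAl -yE -zE !scale_scalar_mx -raddfD /=.
rewrite mulNr [c.2 * z]mulrC e mulrC subrr => /eqP[].
by apply/matrixP => i j; rewrite !mxE mul0rn.
Qed.

(* A limit T of rescaled elements maps the curve to itself and is singular, so it
   is a rank one map a p; bounded traces give p (h a) = 0 for all h, and the line
   of p meets the curve in finitely many points. *)
Lemma bounded_trace_fixed_point d F G : curve_stabilizer d F G -> ~ mxfinite G ->
  (exists M : C, forall g, G g -> `|\tr g| <= M) ->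
  exists2 a : 'cV[C]_3, a != 0 & mxindex G (stabv a G).
Proof.
move=> cs ninf [M trM]; have [d0 homF F0 nl] := And4 (cs_deg cs) (cs_homog cs) (cs_neq0 cs) (cs_noline cs).
have [G1 mG iG detG] := cs_group cs.
have [B|U [T [UU UG N0 fT T0]]] := @escape_limit R _ G _ _ id.
  apply: contrapT => h; apply: ninf; have [s sP] := cs_discrete cs B; exists s => a Ga.
  apply: sP; split => // i j; apply: (le_trans (le_mnorm _ _ _)).
  by apply: contrapT => nB; apply: h; exists a.
pose f (g : 'M[C]_3) := (mnorm g)^-1 *: g.
have detT : \det T = 0.
  apply: cvg_unique_C (mxcvg_det3 fT) _.
  under eq_fun do rewrite detZ.
  apply: (cvg_scale_bounded (M := 1)).
    have <- : (0 : C) ^+ 3 = 0 by rewrite expr0n.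
    exact: cvg_exp.
  by apply: filterS UG => g /detG /= ->; rewrite normr1.
have FT v : v != 0 -> ev F v = 0 -> ev F (T *m v) = 0.
  move=> v0 Fv.
  have h : mxcvg U (fun g : 'M[C]_3 => (mnorm g)^-1 *: g *m v) (T *m v).
    exact: mxcvg_mulr.
  have h1 : (fun g : 'M[C]_3 => ev F ((mnorm g)^-1 *: g *m v)) @ U --> ev F (T *m v).
    by apply: cvg_ev => i; exact: (h i 0).
  apply: cvg_unique_C h1 _; apply/cvgrPdist_lt => e e0; apply: filterS UG => g Gg /=.
  by rewrite -scalemxAl (ev_scale _ _ homF) (cs_inv cs Gg v0 Fv) mulr0 subrr normr0.
have [a [p Tap]] := rank_one_limit d0 homF F0 nl detT FT.
have a0 : a != 0 by apply: contra T0 => /eqP a0; rewrite Tap a0 mul0mx.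
have p0 : p != 0 by apply: contra T0 => /eqP p0; rewrite Tap p0 mulmx0.
exists a => //.
(* The trace of g h stays bounded and is divided by the norm of g, which tends to infinity. *)
have trT h : G h -> \tr (T *m h) = 0.
  move=> Gh; apply: cvg_unique_C (mxcvg_trace (mxcvg_mulr (b := h) fT)) _.
  under eq_fun do rewrite -scalemxAl mxtraceZ.
  apply: (cvg_scale_bounded (M := M)) => //.
  by apply: filterS UG => g Gg /=; apply: trM; exact: mG.
have pa h : G h -> p *m (h *m a) = 0.
  move=> /trT; rewrite Tap -mulmxA mxtrace_mulC /mxtrace big_ord1 => e.
  by apply/matrixP => i j; rewrite !ord1 mulmxA [RHS]mxE; exact: e.
(* T maps a point of the curve off the line of p to a nonzero multiple of a. *)
have Fa : ev F a = 0.
  have [|v [v0 Fv lv]] := avoid_lines (ls := [:: p]) d0 homF F0 nl.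
    by move=> l; rewrite inE => /eqP ->.
  have := lv _ (mem_head _ _); rewrite (mx11_scalar (p *m v)) => pv.
  have := FT v v0 Fv; rewrite Tap -mulmxA (mx11_scalar (p *m v)) mul_mx_scalar.
  rewrite (ev_scale _ _ homF) => /eqP; rewrite mulf_eq0 expf_eq0 => /orP[/andP[_ /eqP z]|/eqP//].
  by case/eqP: pv; rewrite z; apply/matrixP => i j; rewrite !mxE mul0rn.
have [s _ sP] := line_zeros homF nl p0.
apply: (stabv_index (s := s) (cs_group cs) a0) => h Gh.
have ha0 : h *m a != 0 by rewrite mulmx_eq0 ?(mxgroup_unit (cs_group cs)).
have [x xs [k _ e]] := sP _ ha0 (pa _ Gh) (cs_inv cs Gh a0 Fa).
by exists x => //; exists k.
Qed.

Lemma roots_bounded (q : {poly C}) : q != 0 ->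
  exists2 M : C, 0 <= M & forall r, q.[r] = 0 -> `|r| <= M.
Proof.
move=> q0; have [s qs] := closed_field_poly_normal q.
exists (\sum_(z <- s) `|z|); first exact: sumr_ge0.
move=> r qr; have rs : r \in s.
  rewrite -root_prod_XsubC -(rootZ _ _ (_ : lead_coef q != 0)) ?lead_coef_eq0//.
  by rewrite -qs; apply/rootP.
by rewrite (big_rem r)//= lerDl sumr_ge0.
Qed.

Lemma cvg_neq0_large (T : Type) (U : set_system T) {PU : ProperFilter U}
    (N : T -> C) (s : T -> C) (a M : C) : (forall x, 0 <= N x) -> 0 <= M ->
  (fun x => (N x)^-1) @ U --> (0 : C) -> (fun x => (N x)^-1 * s x) @ U --> a -> a != 0 ->
  U [set x | M < `|s x|].
Proof.
move=> N0 M0 Ni sa a0.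
have h : (fun x => `|(N x)^-1 * s x| - (N x)^-1 * M) @ U --> `|a| - 0 * M.
  by apply: cvgB; [apply: cvg_norm; exact: sa|apply: cvgM; [exact: Ni|exact: cvg_cst]].
have {h} : (fun x => `|(N x)^-1 * s x| - (N x)^-1 * M) @ U --> `|a| by rewrite mul0r subr0 in h.
have a1 : 0 < `|a| by rewrite normr_gt0.
move/cvgrPdist_lt => /(_ _ a1); apply: filterS => x /=.
have Ni0 : 0 <= (N x)^-1 by rewrite invr_ge0.
rewrite normrM (ger0_norm Ni0) -mulrBr => hx.
have : 0 < (N x)^-1 * (`|s x| - M).
  have r1 : (N x)^-1 * (`|s x| - M) \is Num.real.
    by rewrite realM ?realB ?normr_real// ger0_real.
  have r2 : `|a| - (N x)^-1 * (`|s x| - M) \is Num.real by rewrite realB// normr_real.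
  have := le_lt_trans (real_ler_norm r2) hx.
  by rewrite ltrBlDr ltrDl.
move=> pos; have Nip : 0 < (N x)^-1.
  by rewrite lt_neqAle Ni0 andbT; apply: contraTneq pos => <-; rewrite mul0r ltxx.
by move: pos; rewrite pmulr_rgt0// subr_gt0.
Qed.

(* The elements permute the lines through e1 and translate the roots of F on these
   lines by an unbounded amount, so F cannot tend to 0 near a point of its curve. *)
Lemma bounded_block_absurd d F G : curve_stabilizer d F G -> ~ mxfinite G ->
  (forall h, G h -> exists2 k : C, `|k| = 1 & h *m vec3 1 0 0 = k *: vec3 1 0 0) ->
  (exists M : C, forall h, G h -> [/\ `|h 1 1| <= M, `|h 1 (inord 2)| <= M,
     `|h (inord 2) 1| <= M & `|h (inord 2) (inord 2)| <= M]) -> False.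
Proof.
move=> cs ninf fix1 [M0 bM0]; have homF := cs_homog cs; have nl := cs_noline cs.
have [G1 mG iG detG] := cs_group cs.
pose M := M0 + 1; have M00 : 0 <= M0 by have [/(le_trans (normr_ge0 _))] := bM0 _ G1.
have M_ge1 : 1 <= M by rewrite /M lerDr.
have bM h : G h -> [/\ `|h 1 1| <= M, `|h 1 (inord 2)| <= M,
     `|h (inord 2) 1| <= M & `|h (inord 2) (inord 2)| <= M].
  by move=> /bM0[? ? ? ?]; split; rewrite (@le_trans _ _ M0)// lerDl.
pose e1 : 'cV[C]_3 := vec3 1 0 0.
have col1 h : G h -> [/\ `|h 0 0| = 1, h 1 0 = 0 & h (inord 2) 0 = 0].
  move=> /fix1[k k1]; rewrite scale_vec3 => /matrixP he.
  have h0 := he 0 0; have h1 := he 1 0; have h2 := he (inord 2) 0; move: h0 h1 h2.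
  rewrite !mul3E !vec3E !mulr0 !mulr1 !addr0 => -> -> ->.
  by split.
(* All other entries of h are bounded, so this part of the first row is unbounded, G being infinite
   and discrete. *)
pose f (h : 'M[C]_3) : 'rV[C]_3 := row3 0 (h 0 1) (h 0 (inord 2)).
have fE h : mnorm (f h) = `|h 0 1| + `|h 0 (inord 2)|.
  by rewrite /mnorm big_ord1 sum3E !row3E normr0 add0r.
have [B|U [p [UU UG N0 fp p0]]] := @escape_limit R _ G _ _ f.
  apply: contrapT => hn; apply: ninf.
  have [s sP] := cs_discrete cs (M + `|B|); exists s => a Ga; apply: sP; split => //.
  have M0M : 0 <= M by rewrite (le_trans ler01).
  have [c0 c1 c2] := col1 _ Ga; have [b1 b2 b3 b4] := bM _ Ga.
  have fB : mnorm (f a) <= B by apply: contrapT => nB; apply: hn; exists a.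
  have fB' : mnorm (f a) <= `|B|.
    by rewrite (le_trans fB)// real_ler_norm// ger0_real// (le_trans (mnorm_ge0 _) fB).
  rewrite fE in fB'.
  apply: ord3P; apply: ord3P; rewrite ?c0 ?c1 ?c2 ?normr0 ?addr_ge0//.
  - by rewrite (le_trans M_ge1)// lerDl.
  - by rewrite (le_trans (_ : _ <= `|B|)) ?lerDr// (le_trans _ fB')// lerDl.
  - by rewrite (le_trans (_ : _ <= `|B|)) ?lerDr// (le_trans _ fB')// lerDr.
  - by rewrite (le_trans b1)// lerDl.
  - by rewrite (le_trans b2)// lerDl.
  - by rewrite (le_trans b3)// lerDl.
  - by rewrite (le_trans b4)// lerDl.
have PU : ProperFilter U by exact: ultra_proper.
pose Bl (h : 'M[C]_3) : 'M[C]_3 := cols3 e1 (vec3 0 (h 1 1) (h (inord 2) 1))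
  (vec3 0 (h 1 (inord 2)) (h (inord 2) (inord 2))).
have [|Bi Bcvg] := @mxcvg_bounded R _ U _ _ Bl M UU.
  move=> i j; apply: filterS UG => h /bM[b1 b2 b3 b4] /=.
  have M0M : 0 <= M by rewrite (le_trans ler01).
  move: i j; apply: ord3P; apply: ord3P; rewrite !cols3E !vec3E ?normr0 ?normr1//.
(* The blocks have determinant of absolute value 1, because \det h = 1 and |h 0 0| = 1. *)
have Biu : Bi \in unitmx.
  rewrite unitmxE unitfE -normr_eq0.
  suff -> : `|\det Bi| = 1 by rewrite oner_eq0.
  have dB : (fun h => `|\det (Bl h)|) @ U --> `|\det Bi|.
    by apply: cvg_norm; exact: mxcvg_det3.
  apply: cvg_unique_C dB _; apply/cvgrPdist_lt => e e0; apply: filterS UG => h Gh /=.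
  suff -> : `|\det (Bl h)| = 1 by rewrite subrr normr0.
  have [c0 c1 c2] := col1 _ Gh; have := congr1 Num.norm (detG _ Gh).
  have -> : \det h = h 0 0 * \det (Bl h) by rewrite !det3E c1 c2 !cols3E !vec3E; ring.
  by rewrite normrM c0 mul1r normr1.
have p00 : p 0 0 = 0.
  apply: cvg_unique_C (fp 0 0) _; under eq_fun do rewrite mxE row3E mulr0.
  exact: cvg_cst.
have l0 : p *m invmx Bi != 0.
  apply: contra p0 => /eqP e; apply/eqP; rewrite -(mulmxKV Biu p) e.
  by rewrite mul0mx.
(* The choice of v makes p w <> 0 for w = Bi^-1 v, so the amount of translation s h = f h w tends to
   infinity. *)
have [|v [v0 Fv lv]] := avoid_lines (ls := [:: p *m invmx Bi]) (cs_deg cs) homF (cs_neq0 cs) nl.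
  by move=> l; rewrite inE => /eqP ->.
pose w := invmx Bi *m v; have {lv} pw : p *m w != 0.
  by rewrite mulmxA; exact: lv (mem_head _ _).
have vE : v = Bi *m w by rewrite mulKVmx.
pose s (h : 'M[C]_3) : C := h 0 1 * w 1 0 + h 0 (inord 2) * w (inord 2) 0.
have sE h : (f h *m w) 0 0 = s h.
  by rewrite mul3E !row3E mul0r add0r.
have w12 : vec3 0 (w 1 0) (w (inord 2) 0) != 0.
  apply: contra pw => /eqP/vec3_eq0[_ w1 w2]; apply/eqP/matrixP => i j.
  by rewrite !ord1 mul3E p00 w1 w2 !mulr0 mul0r !addr0 mxE.
have nz1 (x y : C) : vec3 0 x y != 0 -> exists t, ev F (vec3 0 x y + t *: e1) != 0.
  move=> xy0; apply: contrapT => hn; have [t||[k]] := nl (vec3 0 x y) e1.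
  - by apply: contrapT => /eqP ?; apply: hn; exists t.
  - by move=> /vec3_eq0[/eqP]; rewrite oner_eq0.
  - rewrite /e1 scale_vec3 !mulr0 => /vec3_inj[_ x0 y0]; move: xy0.
    rewrite x0 y0; apply/negP/negPn/eqP/colP; apply: ord3P; by rewrite vec3E mxE.
have e1v t x y : vec3 0 x y + t *: e1 = vec3 t x y.
  by rewrite /e1 scale_vec3 add_vec3 mulr1 !mulr0 !addr0 add0r.
pose q := linep F (vec3 0 (w 1 0) (w (inord 2) 0)) e1.
have q0 : q != 0.
  have [t Ft] := nz1 _ _ w12; apply: contra Ft => /eqP q0.
  by rewrite -linepE -/q q0 horner0.
have [Mw Mw0 qMw] := roots_bounded q0.
pose bh (h : 'M[C]_3) : 'cV[C]_3 := vec3 0 ((Bl h *m w) 1 0) ((Bl h *m w) (inord 2) 0).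
have v12 : vec3 0 (v 1 0) (v (inord 2) 0) != 0.
  apply: contra pw => /eqP/vec3_eq0[_ v1 v2].
  have Bie1 : Bi *m e1 = e1.
    apply/colP => i; rewrite mul3E !vec3E !mulr0 !mulr1 !addr0.
    apply: cvg_unique_C (Bcvg i 0) _; under eq_fun do rewrite cols3E.
    exact: cvg_cst.
  have -> : w = v 0 0 *: e1.
    rewrite /w (vec3K v) v1 v2 vec3E /e1 scale_vec3 !mulr0 mulr1.
    apply: (canLR (mulKmx Biu)); have -> : vec3 (v 0 0) 0 0 = v 0 0 *: e1.
      by rewrite /e1 scale_vec3 !mulr0 mulr1.
    by rewrite -scalemxAr Bie1.
  apply/eqP/matrixP => i j; rewrite !ord1 -scalemxAr mxE mul3E p00 !vec3E.
  by rewrite mxE; ring.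
have [x0 Fx0] := nz1 _ _ v12.
pose K := (1 + `|x0 - v 0 0| / 1) ^+ (msize F).+1.
have K1 : 1 <= 1 + `|x0 - v 0 0| / 1 by rewrite lerDl divr1.
have bcvg x : (fun h => ev F (bh h + x *: e1)) @ U --> ev F (vec3 0 (v 1 0) (v (inord 2) 0) + x *: e1).
  have Bw : mxcvg U (fun h => Bl h *m w) (Bi *m w) by exact: mxcvg_mulr.
  rewrite -vE in Bw; apply: cvg_ev; rewrite e1v.
  apply: ord3P; rewrite vec3E; under eq_fun do rewrite e1v vec3E.
  - exact: cvg_cst.
  - exact: (Bw 1 0).
  - exact: (Bw (inord 2) 0).
have sU : U [set h | Mw + `|v 0 0| + 1 < `|s h|].
  have h1 : mxcvg U (fun h => (mnorm (f h))^-1 *: f h *m w) (p *m w) by exact: mxcvg_mulr.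
  have {}h1 : (fun h => (mnorm (f h))^-1 * s h) @ U --> (p *m w) 0 0.
    by have := h1 0 0; under eq_fun do rewrite -scalemxAl mxE sE.
  have pw0 : (p *m w) 0 0 != 0.
    by apply: contra pw => /eqP e; apply/eqP/matrixP => i j; rewrite !ord1 e mxE.
  have ge0 : 0 <= Mw + `|v 0 0| + 1 by rewrite !addr_ge0.
  exact: (@cvg_neq0_large _ U PU (fun h => mnorm (f h)) s _ _ (fun h => mnorm_ge0 (f h)) ge0 N0 h1 pw0).
(* h^-1 carries the line through e1 and [bh h] to the fixed line through e1 and w, shifting roots by
   s h. On the latter they are bounded by Mw, so on the former they are far from v 0 0. *)
have far h : G h -> Mw + `|v 0 0| + 1 < `|s h| -> forall r,
    root (linep F (bh h) e1) r -> 1 <= `|v 0 0 - r|.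
  move=> Gh sh r /rootP; rewrite linepE => Fr; have [c0 c1 c2] := col1 _ Gh.
  have h0 : h 0 0 != 0 by rewrite -normr_eq0 c0 oner_eq0.
  pose y := vec3 ((r - s h) / h 0 0) (w 1 0) (w (inord 2) 0).
  have hy : h *m y = bh h + r *: e1.
    rewrite e1v; apply/colP; apply: ord3P; rewrite mul3E !vec3E ?c1 ?c2.
    - by rewrite mulrC divfK// /s; ring.
    - by rewrite [in RHS]mul3E !cols3E !vec3E; ring.
    - by rewrite [in RHS]mul3E !cols3E !vec3E; ring.
  have y0 : y != 0.
    by apply: contra w12 => /eqP/vec3_eq0[_ -> ->]; apply/eqP/colP; apply: ord3P; rewrite vec3E mxE.
  have Fy : ev F y = 0.
    have hu := mxgroup_unit (cs_group cs) Gh.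
    rewrite -(mulKmx hu y); apply: (cs_inv cs); first exact: iG.
      by rewrite mulmx_eq0.
    by rewrite hy.
  have : `|(r - s h) / h 0 0| <= Mw by apply: qMw; rewrite linepE e1v.
  rewrite normrM normfV c0 invr1 mulr1 => rs.
  have tri : `|s h| <= `|r - s h| + (`|v 0 0 - r| + `|v 0 0|).
    have {1}-> : s h = - (r - s h) + (- (v 0 0 - r) + v 0 0) by ring.
    rewrite (le_trans (ler_normD _ _))// normrN lerD2l.
    by rewrite (le_trans (ler_normD _ _))// normrN.
  have := lt_le_trans sh (le_trans tri (lerD rs (lexx _))).
  rewrite -addrA ltrD2l addrC ltrD2r => /ltW.
  by [].
have KF : (fun h => K * `|ev F (bh h + v 0 0 *: e1)| - `|ev F (bh h + x0 *: e1)|) @ U -->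
    K * 0 - `|ev F (vec3 0 (v 1 0) (v (inord 2) 0) + x0 *: e1)|.
  apply: cvgB; last by apply: cvg_norm; exact: bcvg.
  apply: cvgM; first exact: cvg_cst.
  have h1 : (fun h => `|ev F (bh h + v 0 0 *: e1)|) @ U -->
      `|ev F (vec3 0 (v 1 0) (v (inord 2) 0) + v 0 0 *: e1)|.
    by apply: cvg_norm; exact: bcvg.
  by rewrite e1v -vec3K Fv normr0 in h1.
set c := `|_| in KF; have c0 : 0 < c by rewrite normr_gt0.
move/cvgrPdist_lt: KF => /(_ _ c0) KF.
have [h [[Gh sh] /=]] := filter_ex (filterI (filterI UG sU) KF).
apply/negP; rewrite mulr0 sub0r -opprD normrN.
have roots := far _ Gh sh; have := roots_away x0 ltr01 roots; rewrite !linepE => ineq.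
have ge0 : 0 <= K * `|ev F (bh h + v 0 0 *: e1)| - `|ev F (bh h + x0 *: e1)|.
  rewrite subr_ge0; apply: (le_trans ineq); apply: ler_wpM2r; first exact: normr_ge0.
  by apply: ler_weXn2l => //; exact: size_linep.
move: ge0; set y := _ - _ => ge0; clearbody c y.
have cy : 0 <= c + y by apply: addr_ge0 => //; exact: ltW.
by rewrite (ger0_norm cy) -real_leNgt ?lerDl ?ger0_real// ltW.
Qed.

(** The rescaled lower blocks tend to a singular nonzero block, a multiple of some b p. Bounded
    traces give p h b = 0 for all h. Among rows with first entry 0, those annihilating b are
    proportional, so p h is a multiple of p. *)
Lemma unbounded_block_line G (M : C) : mxgroup G ->
  (forall h, G h -> exists2 k : C, `|k| = 1 & h *m vec3 1 0 0 = k *: vec3 1 0 0) ->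
  (forall h, G h -> `|\tr h| <= M) ->
  (forall B, exists2 h, G h & ~ mnorm (cols3 0 (vec3 0 1 0) (vec3 0 0 1) *m h) <= B) ->
  exists p1 p2 : C, row3 0 p1 p2 != 0 /\
    forall h, G h -> exists k, row3 0 p1 p2 *m h = k *: row3 0 p1 p2.
Proof.
move=> gG fix1 trM /escape_limit[U [T [UU UG N0 fT T0]]].
have [G1 mG iG detG] := gG; have PU : ProperFilter U by exact: ultra_proper.
pose Pr : 'M[C]_3 := cols3 0 (vec3 0 1 0) (vec3 0 0 1).
have col1 h : G h -> [/\ `|h 0 0| = 1, h 1 0 = 0 & h (inord 2) 0 = 0].
  move=> /fix1[k k1]; rewrite scale_vec3 => /matrixP he.
  have h0 := he 0 0; have h1 := he 1 0; have h2 := he (inord 2) 0; move: h0 h1 h2.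
  rewrite !mul3E !vec3E !mulr0 !mulr1 !addr0 => -> -> ->.
  by split.
have PrE h j : ((Pr *m h) 0 j = 0) * ((Pr *m h) 1 j = h 1 j) *
    ((Pr *m h) (inord 2) j = h (inord 2) j).
  by rewrite !mul3E !cols3E !vec3E !mxE !mul0r !mul1r !addr0 !add0r.
have Tr j : T 0 j = 0.
  apply: cvg_unique_C (fT 0 j) _; under eq_fun do rewrite mxE PrE mulr0.
  exact: cvg_cst.
have zero_lim (f : 'M[C]_3 -> C) a : f @ U --> a -> (forall h, G h -> f h = 0) -> a = 0.
  move=> fa f0; apply: cvg_unique_C fa _; apply/cvgrPdist_lt => e e0.
  by apply: filterS UG => h /f0 /= ->; rewrite subrr normr0.
have Tc j : T j 0 = 0.
  apply: zero_lim (fT j 0) _ => h Gh; rewrite mxE; have [_ h1 h2] := col1 _ Gh.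
  by move: j; apply: ord3P; rewrite PrE ?h1 ?h2 mulr0.
have Td : T 1 1 * T (inord 2) (inord 2) - T 1 (inord 2) * T (inord 2) 1 = 0.
  pose fh (h : 'M[C]_3) := (mnorm (Pr *m h))^-1 *: (Pr *m h).
  have h1 : (fun h => fh h 1 1 * fh h (inord 2) (inord 2) - fh h 1 (inord 2) * fh h (inord 2) 1)
     @ U --> T 1 1 * T (inord 2) (inord 2) - T 1 (inord 2) * T (inord 2) 1.
    by apply: cvgB; apply: cvgM; apply: fT.
  apply: cvg_unique_C h1 _.
  have h2 : (fun h => (mnorm (Pr *m h))^-1 ^+ 2 * (h 1 1 * h (inord 2) (inord 2) - h 1 (inord 2) * h (inord 2) 1)) @ U --> (0 : C).
    apply: (cvg_scale_bounded (M := 1)).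
      have <- : (0 : C) ^+ 2 = 0 by rewrite expr0n.
      exact: cvg_exp.
    apply: filterS UG => h Gh /=; have [h0 h1' h2] := col1 _ Gh.
    have := congr1 Num.norm (detG _ Gh); rewrite det3E h1' h2 !mulr0 !mul0r !subrr !mulr0 subr0 addr0.
    by rewrite normrM h0 mul1r normr1 => ->.
  apply: cvg_trans h2; apply: near_eq_cvg; near=> h; rewrite /fh.
  have E c (A : 'M[C]_3) i j : (c *: A) i j = c * A i j by rewrite mxE.
  by rewrite !E !PrE -/Pr; ring.
have Tm i j k l : T k j * T i l = T i j * T k l.
  have Td' : T 1 1 * T (inord 2) (inord 2) = T 1 (inord 2) * T (inord 2) 1.
    by apply/eqP; rewrite -subr_eq0 Td.
  by move: i j k l; do 4 apply: ord3P; rewrite ?Tr ?Tc ?mulr0 ?mul0r//;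
    first [exact: mulrC|rewrite Td' mulrC|rewrite -Td' mulrC|rewrite mulrC Td'|rewrite mulrC -Td'].
have [i [j Tij]] : exists i j, T i j != 0.
  apply: contrapT => hn; case/eqP: T0; apply/matrixP => i j; rewrite [RHS]mxE.
  by apply/eqP; apply: contrapT => /negP ?; apply: hn; exists i, j.
have TE : T = (T i j)^-1 *: (col j T *m row i T).
  apply/matrixP => k l; rewrite !mxE big_ord1 !mxE Tm mulrA mulVf// mul1r.
  by [].
have trT h : G h -> \tr (T *m h) = 0.
  move=> Gh; apply: cvg_unique_C (mxcvg_trace (mxcvg_mulr (b := h) fT)) _.
  under eq_fun do rewrite -scalemxAl mxtraceZ.
  (* [Pr] only removes the entry (0, 0) of g h from the trace; its absolute value is 1, whence M +
     1. *)
  apply: (cvg_scale_bounded (M := M + 1)) => //.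
  apply: filterS UG => g Gg /=; have Ggh := mG _ _ Gg Gh.
  rewrite -mulmxA; have [c0 c1 c2] := col1 _ Ggh.
  have -> : \tr (Pr *m (g *m h)) = \tr (g *m h) - (g *m h) 0 0.
    rewrite /mxtrace !sum3E !PrE.
    ring.
  by rewrite (le_trans (ler_normB _ _))// c0 lerD2r; exact: trM.
pose p := row i T; pose b := col j T.
have phb h : G h -> p *m h *m b = 0.
  move=> /trT; rewrite TE -scalemxAl mxtraceZ => /eqP; rewrite mulf_eq0 invr_eq0 (negPf Tij)/=.
  rewrite -mulmxA mxtrace_mulC /mxtrace big_ord1 => /eqP e.
  by apply/matrixP => ? ?; rewrite !ord1 [RHS]mxE; exact: e.
have p00 : p 0 0 = 0 by rewrite mxE.
have b00 : b 0 0 = 0 by rewrite mxE.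
have p0 : p != 0 by apply: contra Tij => /eqP/rowP/(_ j); rewrite !mxE => ->.
have b0 : b != 0 by apply: contra Tij => /eqP/colP/(_ i); rewrite !mxE => ->.
clearbody p b.
have pE : p = row3 0 (p 0 1) (p 0 (inord 2)) by rewrite {1}(row3K p) p00.
have bE : b = vec3 0 (b 1 0) (b (inord 2) 0) by rewrite {1}(vec3K b) b00.
exists (p 0 1), (p 0 (inord 2)); rewrite -pE; split => // h Gh.
have q0 : (p *m h) 0 0 = 0.
  have [_ h1 h2] := col1 _ Gh; by rewrite mul3E p00 h1 h2 mul0r !mulr0 !addr0.
have pb : p 0 1 * b 1 0 + p 0 (inord 2) * b (inord 2) 0 = 0.
  have := phb _ G1; rewrite mulmx1 => /matrixP/(_ 0 0).
  by rewrite mul3E p00 mul0r add0r mxE.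
have qb : (p *m h) 0 1 * b 1 0 + (p *m h) 0 (inord 2) * b (inord 2) 0 = 0.
  have := phb _ Gh => /matrixP/(_ 0 0).
  by rewrite [LHS]mul3E b00 mulr0 add0r [RHS]mxE.
move: q0 qb; set q := p *m h => q0 qb; clearbody q.
have [p1|p1] := eqVneq (p 0 1) 0.
  have p2 : p 0 (inord 2) != 0.
    by apply: contra p0 => /eqP p2; apply/eqP/rowP; apply: ord3P; rewrite ?p00 ?p1 ?p2 mxE.
  have b2 : b (inord 2) 0 = 0.
    by move/eqP: pb; rewrite p1 mul0r add0r mulf_eq0 (negPf p2) => /eqP.
  have b1 : b 1 0 != 0.
    by apply: contra b0 => /eqP b1; apply/eqP/colP; apply: ord3P; rewrite ?b00 ?b1 ?b2 mxE.
  have q1 : q 0 1 = 0.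
    by move/eqP: qb; rewrite b2 mulr0 addr0 mulf_eq0 (negPf b1) orbF => /eqP.
  exists (q 0 (inord 2) / p 0 (inord 2)); apply/rowP; apply: ord3P; rewrite mxE.
  - by rewrite q0 p00 mulr0.
  - by rewrite q1 p1 mulr0.
  - by rewrite divfK.
have b2 : b (inord 2) 0 != 0.
  apply: contra b0 => /eqP b2; apply/eqP/colP; apply: ord3P; rewrite ?b00 ?b2 mxE//.
  by move/eqP: pb; rewrite b2 mulr0 addr0 mulf_eq0 (negPf p1) => /eqP.
exists (q 0 1 / p 0 1); apply/rowP; apply: ord3P; rewrite mxE.
- by rewrite q0 p00 mulr0.
- by rewrite divfK.
- apply: (mulIf b2).
  have -> : q 0 (inord 2) * b (inord 2) 0 = - (q 0 1 * b 1 0).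
    by apply/eqP; rewrite -addr_eq0 addrC qb.
  have -> : q 0 1 / p 0 1 * p 0 (inord 2) * b (inord 2) 0 =
     q 0 1 / p 0 1 * (p 0 (inord 2) * b (inord 2) 0) by ring.
  have -> : p 0 (inord 2) * b (inord 2) 0 = - (p 0 1 * b 1 0).
    by apply/eqP; rewrite -addr_eq0 addrC pb.
  by field.
Unshelve. all: by end_near.
Qed.

(** The entries of g^n next to the diagonal are n x and n z, and once x = 0 the corner is n y; all
    vanish in a scalar matrix. *)
Lemma unipotent_torsion g n c : (0 < n)%N -> g 0 0 = 1 -> g 1 1 = 1 ->
  g (inord 2) (inord 2) = 1 -> g 1 0 = 0 -> g (inord 2) 0 = 0 -> g (inord 2) 1 = 0 ->
  g ^+ n = c%:M -> g = 1%:M.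
Proof.
move=> n0 g00 g11 g22 g10 g20 g21 gn; set x := g 0 1; set z := g 1 (inord 2).
set y := g 0 (inord 2).
have gE : g = cols3 (vec3 1 0 0) (vec3 x 1 0) (vec3 y z 1).
  by apply/matrixP; do 2 apply: ord3P; rewrite cols3E vec3E.
have pw m : exists w, g ^+ m = cols3 (vec3 1 0 0) (vec3 (m%:R * x) 1 0) (vec3 w (m%:R * z) 1) /\
    (x = 0 -> w = m%:R * y).
  elim: m => [|m [w [IH IHw]]].
    by exists 0; rewrite expr0 !mul0r; split => //; exact: one3E.
  exists (y + x * (m%:R * z) + w); split; last first.
    by move=> x0; rewrite (IHw x0) x0 mul0r addr0 -natr1; ring.
  have -> : g ^+ m.+1 = g *m g ^+ m by rewrite exprS.
  rewrite IH {1}gE; apply/matrixP; do 2 apply: ord3P;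
    by rewrite mul3E !cols3E !vec3E -?natr1; ring.
have [w [gnE wE]] := pw n; rewrite gn in gnE; have n0' : n%:R != 0 :> C by rewrite pnatr_eq0 -lt0n.
have nd i j : i != j -> (c%:M : 'M[C]_3) i j = 0 by move=> ij; rewrite mxE (negPf ij).
have x0 : x = 0.
  have := nd 0 1 isT; rewrite gnE cols3E vec3E => /eqP.
  by rewrite mulf_eq0 (negPf n0') => /eqP.
have d12 : (1 : 'I_3) != inord 2 by rewrite -val_eqE /= inordK.
have d02 : (0 : 'I_3) != inord 2 by rewrite -val_eqE /= inordK.
have z0 : z = 0.
  have := nd _ _ d12; rewrite gnE cols3E vec3E => /eqP.
  by rewrite mulf_eq0 (negPf n0') => /eqP.
have y0 : y = 0.
  have := nd _ _ d02; rewrite gnE cols3E vec3E (wE x0) => /eqP.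
  by rewrite mulf_eq0 (negPf n0') => /eqP.
by rewrite gE x0 y0 z0 one3E.
Qed.

(** Finite order is meant modulo scalars, as in PSL(3, C). *)
Definition torsion G := forall h, G h -> exists n k, (0 < n)%N /\ h ^+ n = k%:M.

Lemma triangular_torsion_vabelian G : mxgroup G -> torsion G ->
  (forall h, G h -> [/\ h 1 0 = 0, h (inord 2) 0 = 0 & h (inord 2) 1 = 0]) -> mxvabelian G.
Proof.
move=> gG tG tri; have [G1 mG iG detG] := gG.
exists G; split => //; last first.
  exists [:: 1%:M] => a Ga; exists 1%:M; first exact: mem_head.
  by split => //; apply: mG => //; exact: iG.
move=> a b Ga Gb; have Gab := mG _ _ Ga Gb; have Gba := mG _ _ Gb Ga.
pose u := a *m b *m invmx (b *m a); have Gu : G u by apply: mG => //; exact: iG.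
have ub : u *m (b *m a) = a *m b by rewrite mulmxKV// (mxgroup_unit gG).
suff u1 : u = 1%:M by rewrite -ub u1 mul1mx.
have [n [k [n0 un]]] := tG _ Gu.
have [u10 u20 u21] := tri _ Gu.
have [a10 a20 a21] := tri _ Ga; have [b10 b20 b21] := tri _ Gb.
have [c10 c20 c21] := tri _ Gba.
have dn : (b *m a) 0 0 != 0 /\ (b *m a) 1 1 != 0 /\ (b *m a) (inord 2) (inord 2) != 0.
  have := detG _ Gba; rewrite det3E c10 c20 c21 !mulr0 !mul0r !subrr !mulr0 !subr0 addr0 => e.
  by have := oner_neq0 C; rewrite -e !mulf_eq0 !negb_or => /and3P[? ? ?].
have [d0 [d1 d2]] := dn.
apply: (unipotent_torsion n0 _ _ _ u10 u20 u21 un).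
- apply: (mulIf d0); move/matrixP: ub => /(_ 0 0); rewrite [LHS]mul3E c10 c20 !mulr0 !addr0 mul1r => ->.
  by rewrite !mul3E a10 a20 b10 b20; ring.
- apply: (mulIf d1); move/matrixP: ub => /(_ 1 1); rewrite [LHS]mul3E u10 c21 mulr0 mul0r addr0 add0r mul1r => ->.
  by rewrite !mul3E a10 a21 b10 b21; ring.
- apply: (mulIf d2); move/matrixP: ub => /(_ (inord 2) (inord 2)); rewrite [LHS]mul3E u20 u21 !mul0r !add0r mul1r => ->.
  by rewrite !mul3E a20 a21 b20 b21; ring.
Qed.

Lemma mxconj_pow P a n : P \in unitmx -> P *m a ^+ n *m invmx P = (P *m a *m invmx P) ^+ n.
Proof.
move=> Pu; elim: n => [|n IH]; first by rewrite !expr0 mulmx1 mulmxV.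
have e g : g ^+ n.+1 = g *m g ^+ n by rewrite exprS.
by rewrite !e mxconjM// IH.
Qed.

Lemma mxconj_torsion P G : P \in unitmx -> torsion G -> torsion (mxconj P G).
Proof.
move=> Pu tG h /tG[n [k [n0 e]]]; exists n, k; split => //.
rewrite -mxconj_pow// in e; rewrite -[LHS](mxconjVK _ Pu) e.
by rewrite mul_mx_scalar -scalemxAl mulVmx// scalemx1.
Qed.

Lemma mxconj_finite P G : P \in unitmx -> mxfinite (mxconj P G) -> mxfinite G.
Proof.
move=> Pu [s sP]; exists [seq P *m a *m invmx P | a <- s] => a Ga.
apply/mapP; exists (invmx P *m a *m P); last by rewrite mxconjK.
by apply: sP; rewrite /mxconj /= mxconjK.
Qed.

(** The basis e1, f2, f3 is adapted to the flag of the fixed point and the fixed line through it,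
    which makes the group triangular. *)
Lemma flag_torsion_vabelian G (p1 p2 : C) : mxgroup G -> torsion G ->
  (forall h, G h -> exists k, h *m vec3 1 0 0 = k *: vec3 1 0 0) ->
  row3 0 p1 p2 != 0 -> 
  (forall h, G h -> exists k, row3 0 p1 p2 *m h = k *: row3 0 p1 p2) -> mxvabelian G.
Proof.
move=> gG tG fix1 l0 fixl.
have [f2 [f3 [Pu lf2 [c c0 lf3]]]] : exists f2 f3, [/\ cols3 (vec3 1 0 0) f2 f3 \in unitmx,
    row3 0 p1 p2 *m f2 = 0 & exists2 c, c != 0 & row3 0 p1 p2 *m f3 = c%:M].
  have [p20|p20] := eqVneq p2 0.
    have p10 : p1 != 0.
      apply: contra l0 => /eqP p1z; apply/eqP/rowP; apply: ord3P; by rewrite row3E ?p1z ?p20 mxE.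
    exists (vec3 0 0 1), (vec3 0 1 0); split.
    - rewrite unitmxE unitfE det3E !cols3E !vec3E.
      by rewrite !(mul0r,mulr0,mulr1,mul1r,subr0,sub0r,addr0,add0r,mulrN,oppr_eq0) oner_eq0.
    - by rewrite row3_mul p20; apply/matrixP => i j; rewrite !mxE; ring.
    - by exists p1 => //; rewrite row3_mul; congr _%:M; ring.
  exists (vec3 0 p2 (- p1)), (vec3 0 0 1); split.
  - rewrite unitmxE unitfE det3E !cols3E !vec3E.
    by rewrite !(mul0r,mulr0,mulr1,mul1r,subr0,sub0r,addr0,add0r).
  - rewrite row3_mul (_ : _ + _ = 0) ?scalemx0; last by ring.
    by apply/matrixP => i j; rewrite !mxE mul0rn.
  - by exists p2 => //; rewrite row3_mul; congr _%:M; ring.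
set P := cols3 _ _ _ in Pu.
apply: (mxconj_vabelian Pu gG).
apply: triangular_torsion_vabelian; [exact: mxconj_group|exact: mxconj_torsion|].
move=> X GX; set h := P *m X *m invmx P in GX.
have PX : P *m X = h *m P by rewrite /h mulmxKV.
have Pe1 : P *m vec3 1 0 0 = vec3 1 0 0.
  by rewrite cols3_mul scale1r !scale0r !addr0.
have Xe1 : exists k, X *m vec3 1 0 0 = k *: vec3 1 0 0.
  have [k hk] := fix1 _ GX; exists k; apply: (can_inj (mulKmx Pu)).
  by rewrite mulmxA PX -mulmxA Pe1 hk -scalemxAr Pe1.
have [X10 X20] : X 1 0 = 0 /\ X (inord 2) 0 = 0.
  have [k] := Xe1; rewrite scale_vec3 => /matrixP e; have := (e 1 0, e (inord 2) 0).
  rewrite !mul3E !vec3E !mulr0 !mulr1 !addr0; by case.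
split => //.
have [k lh] := fixl _ GX.
have lP : row3 0 p1 p2 *m P = row3 0 0 c.
  apply/rowP => j.
  have colE u v w : col 0 (cols3 u v w) = u /\ col 1 (cols3 u v w) = v /\ col (inord 2) (cols3 u v w) = w.
    by split; [|split]; apply/colP => i; rewrite mxE cols3E.
  have [e0 [e1 e2]] := colE (vec3 1 0 0) f2 f3.
  have cE i : (row3 0 p1 p2 *m P) 0 i = (row3 0 p1 p2 *m col i P) 0 0.
    by rewrite !mul3E !mxE.
  move: j; apply: ord3P; rewrite cE row3E ?e0 ?e1 ?e2.
  - by rewrite row3_mul mxE; ring.
  - by rewrite lf2 mxE.
  - by rewrite lf3 mxE.
have := congr1 (mulmx (row3 0 p1 p2)) PX; rewrite mulmxA [RHS]mulmxA lP lh -scalemxAl lP.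
move/matrixP => /(_ 0 1); rewrite mul3E !row3E mxE row3E !mul0r !add0r mulr0 => /eqP.
by rewrite mulf_eq0 (negPf c0) => /eqP.
Qed.

(** Here z^n = k, and the determinant gives k^3 = 1. *)
Lemma torsion_eigenvalue G h v z : mxgroup G -> torsion G -> G h -> v != 0 ->
  h *m v = z *: v -> `|z| = 1.
Proof.
move=> gG tG Gh v0 hv; have [n [k [n0 hn]]] := tG _ Gh; have [_ _ _ detG] := gG.
have zk : z ^+ n = k.
  have := eigen_pow n hv; rewrite hn mul_scalar_mx => e.
  apply/eqP; rewrite -subr_eq0; have /eqP := e; rewrite -subr_eq0 -scalerBl.
  by rewrite scalemx_eq0 (negPf v0) orbF -oppr_eq0 opprB.
have k3 : k ^+ 3 = 1.
  have hd m : \det (h ^+ m) = 1.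
    elim: m => [|m IH]; first by rewrite expr0 det1.
    have -> : h ^+ m.+1 = h *m h ^+ m by rewrite exprS.
    by rewrite det_mulmx IH detG// mulr1.
  by rewrite -(hd n) hn det_scalar.
have : `|z| ^+ (n * 3) = 1 by rewrite -normrX exprM zk k3 normr1.
by move/eqP; rewrite pexpr_eq1 ?muln_gt0 ?n0// => /eqP.
Qed.

Lemma torsion_trace G h : mxgroup G -> torsion G -> G h -> `|\tr h| <= 3.
Proof.
move=> gG tG Gh; have [l [sl _ lv ->]] := eigen_data h.
rewrite (le_trans (ler_norm_sum _ _ _))// big_seq (eq_bigr (fun=> 1)).
  by rewrite -big_seq big_const_seq count_predT sl iter_addr_0.
by move=> z /lv[v v0 hv]; exact: (torsion_eigenvalue gG tG Gh v0 hv).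
Qed.

Lemma torsion_case d F G : curve_stabilizer d F G -> torsion G -> mxvabelian G.
Proof.
move=> cs tG; have gG := cs_group cs.
have [fG|ninf] := pselect (mxfinite G); first exact: mxfinite_vabelian.
have [|a a0 iD] := bounded_trace_fixed_point cs ninf.
  by exists 3 => h; exact: torsion_trace.
have gD := stabv_group a0 gG.
have DG : stabv a G `<=` G by move=> ? [].
apply: (mxvabelian_index gG DG iD); set D := stabv a G in iD gD DG *.
have [fD|ninfD] := pselect (mxfinite D); first exact: mxfinite_vabelian.
have [u [w Pu]] := complete_basis a0; set P := cols3 _ _ _ in Pu.
apply: (mxconj_vabelian Pu gD).
have csD := cs_conj Pu (cs_sub gD DG cs); have gE := cs_group csD.
have tE : torsion (mxconj P D) by apply: mxconj_torsion => // h /DG/tG.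
have fix1 h : mxconj P D h -> exists2 k : C, `|k| = 1 & h *m vec3 1 0 0 = k *: vec3 1 0 0.
  move=> Eh; have [_ [k hk]] := Eh.
  have e : h *m vec3 1 0 0 = k *: vec3 1 0 0.
    have Pe1 : P *m vec3 1 0 0 = a by rewrite cols3_mul scale1r !scale0r !addr0.
    apply: (can_inj (mulKmx Pu)); rewrite -scalemxAr Pe1 -hk -!mulmxA -Pe1.
    by rewrite mulKmx.
  exists k => //; apply: (torsion_eigenvalue gE tE Eh _ e).
  by apply/eqP => /vec3_eq0[/eqP]; rewrite oner_eq0.
(* Unbounded lower rows yield an invariant line through e1; bounded ones are absurd. *)
have [|B] := pselect (forall B, exists2 h, mxconj P D h &
    ~ mnorm (cols3 0 (vec3 0 1 0) (vec3 0 0 1) *m h) <= B).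
  move/(unbounded_block_line gE fix1 (fun h Eh => torsion_trace gE tE Eh)).
  move=> [p1 [p2 [p0 pE]]]; apply: flag_torsion_vabelian p0 pE => //.
  by move=> h /fix1[k _ e]; exists k.
exfalso; apply: (bounded_block_absurd csD _ fix1); first by move/(mxconj_finite Pu).
apply: contrapT => hn; apply: B => B; apply: contrapT => hB; apply: hn; exists B => h Eh.
have hb : mnorm (cols3 0 (vec3 0 1 0) (vec3 0 0 1) *m h) <= B.
  by apply: contrapT => nB; apply: hB; exists h.
have b1 j : `|h 1 j| <= B.
  apply: le_trans hb; rewrite (le_trans _ (le_mnorm _ 1 j))//.
  by rewrite mul3E !cols3E !vec3E !mxE !mul0r mul1r addr0 add0r.
have b2 j : `|h (inord 2) j| <= B.
  apply: le_trans hb; rewrite (le_trans _ (le_mnorm _ (inord 2) j))//.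
  by rewrite mul3E !cols3E !vec3E !mxE !mul0r mul1r !add0r.
by split.
Qed.

End Torsion.

(** * Invariant lines *)

Section Lines.
Variable C : numClosedFieldType.
Implicit Types (F : {mpoly C[3]}) (G D : set 'M[C]_3) (g h P : 'M[C]_3) (v : 'cV[C]_3) (l m : 'rV[C]_3).

Lemma line_meets_curve d F l : (0 < d)%N -> F \is d.-homog -> l != 0 ->
  exists p, [/\ p != 0, ev F p = 0 & l *m p = 0].
Proof.
move=> d0 homF l0; have [A Au lA] := row_basis l0.
have lz y z : l *m (A *m vec3 0 y z) = 0.
  rewrite mulmxA lA row3_mul !mul0r mulr0 !addr0.
  by apply/matrixP => i j; rewrite !mxE mul0rn.
have nz y z : (y, z) != 0 -> A *m vec3 0 y z != 0.
  rewrite mulmx_eq0// => yz; apply: contra yz => /eqP/vec3_eq0[_ -> ->].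
  exact: eqxx.
have [Fe|Fe] := eqVneq (ev F (A *m vec3 0 1 0)) 0.
  by exists (A *m vec3 0 1 0); split => //; apply: nz; rewrite -pair_eqE /pair_eq /= oner_eq0.
have [x Fx] := line_root (A *m vec3 0 0 1) d0 homF Fe.
exists (A *m vec3 0 x 1).
have e : A *m vec3 0 x 1 = A *m vec3 0 0 1 + x *: (A *m vec3 0 1 0).
  by rewrite scalemxAr -mulmxDr scale_vec3 add_vec3 !mulr0 mulr1 !addr0 add0r.
split => //; last by rewrite e.
by apply: nz; rewrite -pair_eqE /pair_eq /= oner_eq0 andbF.
Qed.

(** Off e1, the matrix exchanges x and z, which preserves the conic, and then applies [aff 1 t]; so
    it sends e1 to the point of parameter t. *)
Lemma conic_move (p : 'cV[C]_3) : p != 0 -> conicq p = 0 ->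
  exists Q, [/\ Q \in unitmx, forall v, conicq (Q *m v) = conicq v &
    exists k, p = k *: (Q *m vec3 1 0 0)].
Proof.
rewrite {1 2}(vec3K p); set x := p 0 0; set y := p 1 0; set z := p (inord 2) 0.
rewrite /conicq !vec3E => p0 q0.
have [z0|z0] := eqVneq z 0.
  have y0 : y = 0.
    by move/eqP: q0; rewrite z0 mulr0 sub0r oppr_eq0 sqrf_eq0 => /eqP.
  exists 1%:M; split; [exact: unitmx1|by move=> v; rewrite mul1mx|].
  by exists x; rewrite mul1mx scale_vec3 !mulr0 mulr1 (vec3K p) -/x -/y -/z y0 z0.
pose t := y / z.
exists (cols3 (vec3 (t ^+ 2 / 2) t 1) (vec3 t 1 0) (vec3 1 0 0)); split.
- rewrite unitmxE unitfE det3E !cols3E !vec3E.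
  by rewrite [X in X != 0](_ : _ = -1); [rewrite oppr_eq0 oner_eq0|field].
- move=> v; rewrite /conicq !mul3E !cols3E !vec3E.
  by field.
- exists z; rewrite cols3_mul scale1r !scale0r !addr0 scale_vec3 {1}(vec3K p) -/x -/y -/z.
  have -> : x = y ^+ 2 / z / 2.
    apply: (mulIf z0); have -> : x * z = (2 * x * z) / 2 by field.
    by move/eqP: q0; rewrite subr_eq0 => /eqP ->; field.
  by congr vec3; rewrite /t; field.
Qed.

Lemma conic_line_vabelian d F G (ls : seq 'rV[C]_3) l : curve_stabilizer d F G -> conic_form F ->
  l != 0 -> (forall a, G a -> exists2 x, x \in ls & exists k, l *m a = k *: x) ->
  mxvabelian G.
Proof.
move=> cs [P Pu PF] l0 lG; have gG := cs_group cs.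
have DG : stabl l G `<=` G by move=> ? [].
apply: (mxvabelian_index gG DG (stabl_index gG l0 lG)).
have gD := stabl_group l0 gG; set D := stabl l G in DG gD *.
have csD := cs_sub gD DG cs.
have [p [p0 Fp lp]] := line_meets_curve (cs_deg cs) (cs_homog cs) l0.
have [s _ sP] := line_zeros (cs_homog cs) (cs_noline cs) l0.
have ED : stabv p D `<=` D by move=> ? [].
have iE : mxindex D (stabv p D).
  apply: (stabv_index (s := s) gD p0) => h Dh; have [Gh [k lh]] := Dh.
  have hp0 : h *m p != 0 by rewrite mulmx_eq0 ?(mxgroup_unit gD).
  have [||x xs [c _ e]] := sP _ hp0.
  - by rewrite mulmxA lh -scalemxAl lp scaler0.
  - exact: (cs_inv csD Dh p0 Fp).
  - by exists x => //; exists c.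
apply: (mxvabelian_index gD ED iE).
have gE := stabv_group p0 gD; set E := stabv p D in ED gE iE *.
pose q := invmx P *m p.
have q0 : q != 0 by rewrite mulmx_eq0 ?unitmx_inv.
have Pq : P *m q = p by rewrite mulKVmx.
have qq : conicq q = 0 by apply/(PF _ q0); rewrite Pq.
have [Q [Qu Qc [k qk]]] := conic_move q0 qq.
have PQu : P *m Q \in unitmx by rewrite unitmx_mul Pu Qu.
apply: (mxconj_vabelian PQu gE).
have csE := cs_sub gE ED csD.
have k0 : k != 0.
  by apply: contra q0 => /eqP k0; rewrite qk k0 scale0r.
have e : P *m Q *m vec3 1 0 0 = k^-1 *: p.
  by rewrite -Pq qk -scalemxAr scalerA mulVf// scale1r mulmxA.
apply: parabolic_conic_vabelian.
- exact: mxconj_group.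
- by apply: mxconj_discrete => //; exact: cs_discrete csE.
- move=> a [_ [c ac]]; exists c; apply: (can_inj (mulKmx PQu)).
  rewrite mulmxA -scalemxAr e.
  have -> : P *m Q *m a = P *m Q *m a *m invmx (P *m Q) *m (P *m Q) by rewrite mulmxKV.
  by rewrite -mulmxA e -scalemxAr ac scalerA mulrC -scalerA.
- move=> a v Ea cv; have [->|v0] := eqVneq v 0.
    by rewrite mulmx0 /conicq !mxE mulr0 expr0n subr0.
  have au : a \in unitmx := mxgroup_unit (mxconj_group PQu gE) Ea.
  have av0 : a *m v != 0 by rewrite mulmx_eq0.
  rewrite -Qc; have Qav0 : Q *m (a *m v) != 0 by rewrite mulmx_eq0.
  apply/(PF _ Qav0).
  have Qv0 : Q *m v != 0 by rewrite mulmx_eq0.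
  have PQv0 : P *m (Q *m v) != 0 by rewrite mulmx_eq0.
  have Fv : ev F (P *m (Q *m v)) = 0 by apply/(PF _ Qv0); rewrite Qc.
  have := cs_inv csE Ea PQv0 Fv.
  by rewrite !mulmxA -(mulmxA _ P Q) mulmxKV// -!mulmxA.
Qed.

Lemma mxfinite_index G D : mxgroup G -> mxindex G D -> mxfinite D -> mxfinite G.
Proof.
move=> gG [s sP] [t tP]; exists [seq b *m c | b <- s, c <- t] => a Ga.
have [b bs [Gb Dc]] := sP _ Ga; apply/allpairsP; exists (b, invmx b *m a).
by split => //=; [exact: tP|rewrite mulKVmx// (mxgroup_unit gG)].
Qed.

Lemma cube_roots : exists s : seq C, forall z : C, z ^+ 3 = 1 -> z \in s.
Proof.
have [s ps] := closed_field_poly_normal ('X^3 - 1 : {poly C}).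
exists s => z z3; rewrite -root_prod_XsubC -[X in root X]scale1r.
rewrite (_ : 1 = lead_coef ('X^3 - 1)) -?ps.
  by rewrite rootE !hornerE z3 subrr.
by apply/esym; rewrite lead_coefDl ?lead_coefXn// size_polyXn size_polyN size_poly1.
Qed.

(** In the coordinates given by three of the lines the common stabilizer is diagonal; the fourth
    line has only nonzero coordinates there, so the diagonal entries agree. The resulting scalar is
    a cube root of unity. *)
Lemma four_lines_finite G (ls : seq 'rV[C]_3) (m : 'I_4 -> 'rV[C]_3) : mxgroup G ->
  (forall i, m i != 0) ->
  (forall i a, G a -> exists2 x, x \in ls & exists k, m i *m a = k *: x) ->
  (forall i j k v, i != j -> i != k -> j != k -> m i *m v = 0 -> m j *m v = 0 ->
     m k *m v = 0 -> v = 0) -> mxfinite G.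
Proof.
move=> gG m0 mG gp.
(* Stabilizing the lines one after the other keeps each index finite, so finiteness may be proved
   for the common stabilizer. *)
pose st (s : seq 'I_4) := foldr (fun i D => stabl (m i) D) G s.
have st_sub s : mxgroup (st s) /\ st s `<=` G.
  elim: s => [|i s [gs sG]]; first by split.
  by split; [exact: stabl_group|move=> a [/sG]].
have st_fin s : mxfinite (st s) -> mxfinite G.
  elim: s => [|i s IH]//= fs; apply: IH; have [gs sG] := st_sub s.
  by apply: mxfinite_index fs => //; apply: (stabl_index (s := ls)) => // a /sG; exact: mG.
have st_mem s a i : st s a -> i \in s -> exists k, m i *m a = k *: m i.
  elim: s => //= j s IH [sa mj]; rewrite inE => /orP[/eqP -> //|]; exact: IH.
apply: (st_fin (enum 'I_4)); have [gE _] := st_sub (enum 'I_4).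
have st1 a i : st (enum 'I_4) a -> exists k, m i *m a = k *: m i.
  by move=> sa; apply: st_mem sa _; rewrite mem_enum.
move: (st _) gE st1 => E gE st1 {st st_sub st_fin st_mem mG}; have [_ _ _ detE] := gE.
pose w (i : 'I_3) : 'I_4 := widen_ord (leqnSn 3) i.
have winj i j : i != j -> w i != w j by rewrite -!val_eqE.
have wmax i : w i != ord_max by rewrite -val_eqE /= neq_ltn ltn_ord.
pose L : 'M[C]_3 := \matrix_(i < 3, j < 3) m (w i) 0 j.
have rL n (A : 'M[C]_(3, n)) i j : (L *m A) i j = (m (w i) *m A) 0 j.
  by rewrite !mxE; apply: eq_bigr => ? _; rewrite mxE.
have d01 : (0 : 'I_3) != 1 by [].
have d12 : (1 : 'I_3) != inord 2 by rewrite -val_eqE /= inordK.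
have d02 : (0 : 'I_3) != inord 2 by rewrite -val_eqE /= inordK.
have Lv v i : (L *m v) i 0 = 0 -> m (w i) *m v = 0.
  by rewrite rL => e; apply/matrixP => ? ?; rewrite !ord1 e mxE.
have Lu : L \in unitmx.
  apply: unit_of_inj => v /colP e; apply: (gp (w 0) (w 1) (w (inord 2))); try exact: winj;
  by apply: Lv; rewrite e mxE.
pose c : 'rV[C]_3 := m ord_max *m invmx L.
have cL : c *m L = m ord_max by rewrite mulmxKV.
have other (i : 'I_3) : exists j k : 'I_3, [/\ j != k, j != i & k != i].
  move: i; apply: ord3P.
  - by exists 1, (inord 2); rewrite d12 [inord 2 == _]eq_sym d02.
  - by exists 0, (inord 2); rewrite d02 [inord 2 == _]eq_sym d12.
  - by exists 0, 1.
have c0 i : c 0 i != 0.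
  pose v := invmx L *m delta_mx i (0 : 'I_1).
  have v0 : v != 0.
    rewrite mulmx_eq0 ?unitmx_inv//; apply/eqP => /matrixP/(_ i 0).
    by rewrite !mxE !eqxx => /eqP; rewrite oner_eq0.
  have wv j : j != i -> m (w j) *m v = 0.
    by move=> ji; apply: Lv; rewrite mulKVmx// !mxE (negPf ji).
  have cv : m ord_max *m v = (c 0 i)%:M.
    rewrite mulmxA -/c; apply/matrixP => a b; rewrite !ord1 !mxE (bigD1 i)//= big1.
      by rewrite !mxE !eqxx mulr1 addr0.
    by move=> j ji; rewrite !mxE (negPf ji) mulr0.
  apply: contra v0 => /eqP ci; apply/eqP.
  have cv0 : m ord_max *m v = 0 by rewrite cv ci; apply/matrixP => ? ?; rewrite !mxE mul0rn.
  have [j [k [jk ji ki]]] := other i.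
  exact: (gp (w j) (w k) ord_max v (winj _ _ jk) (wmax _) (wmax _) (wv _ ji) (wv _ ki) cv0).
clearbody c.
have [s sP] := cube_roots.
exists [seq z%:M | z <- s] => a Ea.
have [k hk] := st1 _ ord_max Ea.
have [f fE] := choice (P := fun (i : 'I_3) k => m (w i) *m a = k *: m (w i)) (fun i => st1 a (w i) Ea).
have La : L *m a = diag_mx (\row_i f i) *m L.
  by rewrite mul_diag_mx; apply/matrixP => i j; rewrite rL fE !mxE.
have fk i : f i = k.
  have : c *m (L *m a) = k *: (c *m L) by rewrite mulmxA cL hk.
  rewrite La mulmxA scalemxAl => /(can_inj (mulmxK Lu))/rowP/(_ i).
  by rewrite mul_mx_diag !mxE mulrC => /(mulIf (c0 i)).
have {}La : L *m a = k *: L.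
  by rewrite La mul_diag_mx; apply/matrixP => i j; rewrite !mxE fk.
have ak : a = k%:M.
  by apply: (can_inj (mulKmx Lu)); rewrite La mul_mx_scalar.
have := detE _ Ea; rewrite ak det_scalar => k3.
by apply/mapP; exists k => //; exact: sP.
Qed.

(** Restricted to the line of m, the product of the linear forms and of F2 is the zero polynomial,
    so one factor is zero; it is not F2, which vanishes on no line. *)
Lemma line_component d F F2 (ls : seq 'rV[C]_3) m : (0 < d)%N -> F \is d.-homog ->
  noline F2 -> (forall v, ev F v = \prod_(l <- ls) (l *m v) 0 0 * ev F2 v) ->
  (forall l, l \in ls -> l != 0) -> m != 0 ->
  (forall v, v != 0 -> m *m v = 0 -> ev F v = 0) ->
  exists2 l, l \in ls & exists k, m = k *: l.
Proof.
move=> d0 homF nl FE ls0 m0 mF; have [A Au mA] := row_basis m0.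
have mz v : m *m v = 0 -> ev F v = 0.
  by move=> mv; have [->|/mF] := eqVneq v 0; [exact: ev0 homF|exact].
pose u := A *m vec3 0 1 0; pose w := A *m vec3 0 0 1.
have lz y z : m *m (A *m vec3 0 y z) = 0.
  rewrite mulmxA mA row3_mul !mul0r mulr0 !addr0.
  by apply/matrixP => i j; rewrite !mxE mul0rn.
have : \prod_(l <- ls) (((l *m u) 0 0)%:P + (l *m w) 0 0 *: 'X) * linep F2 u w = 0.
  apply: poly_eq0 => t; rewrite hornerM linepE horner_prod.
  have -> : \prod_(l <- ls) (((l *m u) 0 0)%:P + (l *m w) 0 0 *: 'X).[t] =
    \prod_(l <- ls) (l *m (u + t *: w)) 0 0.
    apply: eq_bigr => l _; rewrite !hornerE mulmxDr -scalemxAr [RHS]mxE; congr (_ + _).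
    by rewrite [RHS]mxE mulrC.
  rewrite -FE; apply: mz; rewrite mulmxDr -scalemxAr !lz scaler0 addr0.
  by [].
move/eqP; rewrite mulf_eq0 => /orP[|/eqP p0]; last first.
  have [t||[k]] := nl u w.
  - by rewrite -linepE p0 horner0.
  - move/eqP; rewrite mulmx_eq0// => /eqP/vec3_eq0[_ _ /eqP]; by rewrite oner_eq0.
  - rewrite /u /w scalemxAr => /(can_inj (mulKmx Au)); rewrite scale_vec3 => /vec3_inj[_ /eqP].
    by rewrite mulr0 oner_eq0.
rewrite prodf_seq_eq0 => /hasP[l lls /= /eqP e].
have lu : (l *m u) 0 0 = 0.
  by have := congr1 (fun p : {poly C} => p.[0]) e; rewrite !hornerE ?mulr0 ?addr0.
have lw : (l *m w) 0 0 = 0.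
  by have := congr1 (fun p : {poly C} => p.[1]) e; rewrite !hornerE lu ?add0r ?mulr1.
exists l => //.
have lA : l *m A = (l *m A) 0 0 *: (m *m A).
  have lA1 : (l *m A) 0 1 = 0.
    by rewrite -lu /u mulmxA [RHS]mul3E !vec3E !mulr0 mulr1 addr0 add0r.
  have lA2 : (l *m A) 0 (inord 2) = 0.
    by rewrite -lw /w mulmxA [RHS]mul3E !vec3E !mulr0 mulr1 !add0r.
  apply/rowP; apply: ord3P; rewrite [RHS]mxE mA row3E ?mulr0 ?mulr1//.
have lm : l = (l *m A) 0 0 *: m.
  by apply: (can_inj (mulmxK Au)); rewrite -scalemxAl.
set c := (l *m A) 0 0 in lm; have c0 : c != 0.
  by apply: contra (ls0 _ lls) => /eqP c0; rewrite lm c0 scale0r.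
by exists c^-1; rewrite lm scalerA mulVf// scale1r.
Qed.

(* Where no linear factor vanishes at h v, invariance of F gives it for F2; the
   remaining points are reached by density. *)
Lemma noline_part_invariant e F F2 (ls : seq 'rV[C]_3) h : h \in unitmx ->
  F2 \is e.-homog -> F2 != 0 -> noline F2 ->
  (forall v, ev F v = \prod_(l <- ls) (l *m v) 0 0 * ev F2 v) ->
  (forall l, l \in ls -> l != 0) ->
  (forall v, v != 0 -> ev F v = 0 -> ev F (h *m v) = 0) ->
  forall v, v != 0 -> ev F2 v = 0 -> ev F2 (h *m v) = 0.
Proof.
move=> hu hom2 F20 nl FE ls0 Fh v v0 F2v.
rewrite -ev_lin_subst; apply: (vanish_on_cone (ls := [seq l *m h | l <- ls]) hom2 F20 nl) v0 F2v.
  move=> _ /mapP[l lls ->]; apply: contra (ls0 _ lls) => /eqP lh.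
  by rewrite -(mulmxK hu l) lh mul0mx.
move=> u u0 F2u off; rewrite ev_lin_subst.
have : ev F (h *m u) = 0 by apply: Fh => //; rewrite FE F2u mulr0.
rewrite FE => /eqP; rewrite mulf_eq0 => /orP[|/eqP//].
rewrite prodf_seq_eq0 => /hasP[l lls /= /eqP e0].
have := off _ (map_f _ lls); rewrite -mulmxA => /eqP[].
by apply/matrixP => ? ?; rewrite !ord1 e0 mxE.
Qed.

End Lines.

(** * Invariant curves of matrix groups *)

Section MatrixMain.
Variable R : realType.
Local Notation C := (CC R).
Implicit Types (F : {mpoly C[3]}) (G D : set 'M[C]_3) (g h P : 'M[C]_3) (v : 'cV[C]_3) (l m : 'rV[C]_3).

Lemma curve_dichotomy d F G : curve_stabilizer d F G -> mxvabelian G \/ conic_form F.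
Proof.
move=> cs; have [tG|nt] := pselect (torsion G); first by left; exact: (torsion_case cs tG).
have [g [Gg gn]] : exists g, G g /\ forall n k, (0 < n)%N -> g ^+ n <> k%:M.
  apply: contrapT => hn; apply: nt => g Gg; apply: contrapT => hg; apply: hn; exists g.
  by split => // n k n0 e; apply: hg; exists n, k.
exact: (infinite_order_case cs Gg gn).
Qed.

Lemma invariant_curve_forms d F G : (0 < d)%N -> F \is d.-homog -> F != 0 ->
  mxgroup G -> mxdiscrete G -> ~ mxvabelian G ->
  (forall h v, G h -> v != 0 -> ev F v = 0 -> ev F (h *m v) = 0) ->
  ((exists2 ls : seq 'rV[C]_3, (forall l, l \in ls -> l != 0) &
     forall v, v != 0 -> (ev F v = 0 <-> exists2 l, l \in ls & l *m v = 0)) \/ conic_form F) /\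
  ((exists m : 'I_4 -> 'rV[C]_3, [/\ forall i, m i != 0,
     forall i v, v != 0 -> m i *m v = 0 -> ev F v = 0 &
     forall i j k v, i != j -> i != k -> j != k -> m i *m v = 0 -> m j *m v = 0 ->
     m k *m v = 0 -> v = 0]) -> mxfinite G).
Proof.
move=> d0 homF F0 gG dG nv inv.
have [ls [e [F2 [ls0 F20 hom2 nl FE]]]] := extract_lines F0 homF.
have comp m : m != 0 -> (forall v, v != 0 -> m *m v = 0 -> ev F v = 0) ->
    forall a, G a -> exists2 x, x \in ls & exists k, m *m a = k *: x.
  move=> m0 mF a Ga; have au := mxgroup_unit gG Ga.
  apply: (line_component d0 homF nl FE ls0).
    by apply: contra m0 => /eqP ma; rewrite -(mulmxK au m) ma mul0mx.
  move=> v v0 mav; have av0 : a *m v != 0 by rewrite mulmx_eq0.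
  have Fav : ev F (a *m v) = 0 by apply: mF => //; rewrite mulmxA.
  have [_ _ iG _] := gG; rewrite -(mulKmx au v); exact: inv (iG _ Ga) av0 Fav.
split; last first.
  move=> [m [m0 mF gp]]; apply: (four_lines_finite (ls := ls) gG m0 _ gp) => i a Ga.
  exact: comp (m0 i) (mF i) a Ga.
have Fl l : l \in ls -> forall v, v != 0 -> l *m v = 0 -> ev F v = 0.
  move=> lls v _ lv; rewrite FE (big_rem l)//= lv mxE !mul0r.
  by [].
(* In degree 0 the factor F2 is a nonzero constant, and only lines are left. *)
have [e0|] := posnP e; last move=> e0.
  left; exists ls => // v v0; split.
    have [u F2u] : exists u, ev F2 u != 0.
      apply: contrapT => hn; case/eqP: F20; apply: ev_poly_eq0 => u; apply/eqP.
      by apply: contrapT => /negP ?; apply: hn; exists u.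
    have F2v : ev F2 v != 0.
      have h x : ev F2 0 = ev F2 x.
        by have := ev_scale 0 x hom2; rewrite scale0r e0 expr0 mul1r.
      by rewrite -h (h u).
    rewrite FE => /eqP; rewrite mulf_eq0 (negPf F2v) orbF prodf_seq_eq0 => /hasP[l lls /= /eqP lv].
    by exists l => //; apply/matrixP => ? ?; rewrite !ord1 lv mxE.
  by move=> [l lls]; exact: Fl.
right; have cs : curve_stabilizer e F2 G.
  split => // h v Gh; apply: (noline_part_invariant _ hom2 F20 nl FE ls0).
    exact: mxgroup_unit gG Gh.
  by move=> u; exact: inv.
have [//|cf] := curve_dichotomy cs.
case: ls ls0 FE comp Fl => [|l ls] ls0 FE comp Fl.
  case: cf => P Pu PF; exists P => // v v0; rewrite -PF// FE big_nil mul1r.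
  by [].
case: nv; apply: (conic_line_vabelian (ls := l :: ls) (l := l) cs cf).
  exact/ls0/mem_head.
apply: comp; first exact/ls0/mem_head.
exact/Fl/mem_head.
Qed.

End MatrixMain.

(** * From an isolated identity to finite bounded subsets *)

Section Discrete.
Variable R : realType.
Local Notation C := (CC R).
Implicit Types (G D : set 'M[C]_3).

Lemma cofinite_ultra (T : eqType) (B : set T) : (forall s : seq T, exists2 x, B x & x \notin s) ->
  exists U : set_system T, [/\ UltraFilter U, U B & forall s : seq T, U [set x | x \notin s]].
Proof.
move=> infB; pose FB : set_system T :=
  filter_from [set: seq T] (fun s => [set x | B x /\ x \notin s]).
have FF : ProperFilter FB.
  apply: filter_from_proper.
    apply: filter_from_filter; first by exists [::].
    move=> s1 s2 _ _; exists (s1 ++ s2) => // x [Bx].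
    by rewrite mem_cat negb_or => /andP[x1 x2].
  by move=> s _; have [x Bx xs] := infB s; exists x.
have [U [UU sub]] := ultraFilterLemma FF; exists U; split => //.
  by apply: sub; exists [::] => // x [].
by move=> s; apply: sub; exists s => // x [].
Qed.

Lemma det_bounded n (A : 'M[C]_n) (M : C) : (forall i j, `|A i j| <= M) ->
  `|\det A| <= #|{: {perm 'I_n}}|%:R * M ^+ n.
Proof.
move=> AM; rewrite /determinant (le_trans (ler_norm_sum _ _ _))//.
rewrite -sum1_card natr_sum mulr_suml; apply: ler_sum => s _.
rewrite normrM normrX normrN1 expr1n !mul1r normr_prod.
rewrite -[leRHS]mulr1 -[in leRHS](card_ord n) -prodr_const mulr1.
by apply: ler_prod => i _; rewrite normr_ge0 AM.
Qed.

(** An infinite bounded subset would carry a nonprincipal ultrafilter along which a tends to a0 and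
    a^-1 to the inverse of a0. Then b^-1 a is close to 1 for a suitable b and most a, so these a are
    among the finitely many products of b with a cube root of unity. *)
Lemma isolated_identity_discrete G (e : C) : mxgroup G -> 0 < e ->
  (forall a, G a -> (forall i j, `|a i j - 1%:M i j| < e) -> exists2 w, w ^+ 3 = 1 & a = w%:M) ->
  mxdiscrete G.
Proof.
move=> gG e0 near1 M; have [G1 mG iG detG] := gG.
apply: contrapT => ninf; have [|U [UU UB Us]] := @cofinite_ultra _ [set a | G a /\ forall i j, `|a i j| <= M].
  move=> s; apply: contrapT => hn; apply: ninf; exists s => a Ba.
  by apply: contrapT => /negP ?; apply: hn; exists a.
have PU : ProperFilter U by exact: ultra_proper.
have UG : U G by apply: filterS UB => a [].
have [|a0 aa0] := @mxcvg_bounded R _ U _ _ (id : 'M[C]_3 -> 'M[C]_3) M UU.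
  by move=> i j; apply: filterS UB => a [_ aM]; exact: aM.
(* For determinant 1 the entries of the inverse are cofactors, that is, signed 2 x 2 determinants of
   entries bounded by M. *)
have [|c0 cc0] := @mxcvg_bounded R _ U _ _ (invmx : 'M[C]_3 -> 'M[C]_3) (#|{: {perm 'I_2}}|%:R * M ^+ 2) UU.
  move=> i j; apply: filterS UB => a [Ga aM] /=.
  rewrite /invmx (mxgroup_unit gG Ga) (detG _ Ga) invr1 scale1r mxE /cofactor.
  rewrite normrM normrX normrN1 expr1n mul1r; apply: det_bounded => k l.
  by rewrite !mxE; exact: aM.
have ca : c0 *m a0 = 1%:M.
  apply/matrixP => i j.
  have h1 : (fun a => (invmx a *m a) i j) @ U --> (c0 *m a0) i j.
    by have := mxcvg_mul cc0 aa0; exact.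
  apply: cvg_unique_C h1 _.
  apply/cvgrPdist_lt => d d0; apply: filterS UG => a Ga /=.
  by rewrite mulVmx ?(mxgroup_unit gG)// subrr normr0.
have all_near (f : 'M[C]_3 -> 'M[C]_3) l : mxcvg U f l -> U [set a | forall i j, `|f a i j - l i j| < e / 2].
  move=> fl; have e20 : 0 < e / 2 by rewrite divr_gt0.
  have h i j : U [set a | `|f a i j - l i j| < e / 2].
    by move/cvgrPdist_lt: (fl i j) => /(_ _ e20); apply: filterS => a /=; rewrite distrC.
  have h2 i : U [set a | forall j, `|f a i j - l i j| < e / 2].
    by apply: filter_forall => j; exact: h.
  by apply: filter_forall => i; exact: h2.
have near_b : U [set b | forall i j, `|(invmx b *m a0) i j - 1%:M i j| < e / 2].
  by rewrite -ca; apply: all_near; exact: mxcvg_mulr.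
have [b [Gb nb]] := filter_ex (filterI UG near_b).
have near_a : U [set a | forall i j, `|(invmx b *m a) i j - (invmx b *m a0) i j| < e / 2].
  apply: (all_near (fun a => invmx b *m a)).
  have cb : mxcvg U (fun=> invmx b) (invmx b) by move=> i j; exact: cvg_cst.
  exact: (mxcvg_mul cb aa0).
have [s sP] := cube_roots C.
have [a [[Ga na] nas]] := filter_ex (filterI (filterI UG near_a) (Us [seq b *m z%:M | z <- s])).
case/negP: nas.
have [|i j|w w3 baw] := near1 (invmx b *m a); first by apply: mG => //; exact: iG.
  rewrite [ltRHS](splitr e) (le_lt_trans _ (ltrD (na i j) (nb i j)))//.
  by rewrite (le_trans _ (ler_normD _ _))// addrA subrK.
by apply/mapP; exists w; [exact: sP|rewrite -baw mulKVmx// (mxgroup_unit gG)].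
Qed.

End Discrete.

(** * From matrices to projective transformations *)

Section Lift.
Local Open Scope quotient_scope.
Variable R : realType.
Local Notation C := (CC R).
Local Notation P2 := (CP R 2).
Implicit Types (G : set (PSL3 R)) (x y : SL3 R) (F : {mpoly C[3]}).

(** The full preimage in SL(3, C). For a subgroup it contains the scalar cube roots of unity, whence
    the scalars in [isolated_identity_discrete]. *)
Definition mxlift G : set 'M[C]_3 := [set a | exists2 x : SL3 R, val x = a & G (\pi_(PSL3 R) x)].

Lemma subgroup_pi G : subgroup G -> [/\ G (\pi_(PSL3 R) (SL3_one R)),
  (forall x y, G (\pi_(PSL3 R) x) -> G (\pi_(PSL3 R) y) -> G (\pi_(PSL3 R) (SL3_mul x y))) &
  (forall x, G (\pi_(PSL3 R) x) -> G (\pi_(PSL3 R) (SL3_inv x)))].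
Proof.
move=> sG; have [G1 _] := sG; split; first by apply/set_mem; exact: G1.
- move=> x y Gx Gy; rewrite -PSL3_mul_pi; apply/set_mem.
  by apply: (group_closedM sG); exact: mem_set.
- move=> x Gx; rewrite -PSL3_inv_pi; apply/set_mem.
  by apply: (group_closedV sG); exact: mem_set.
Qed.

Lemma mxlift_group G : subgroup G -> mxgroup (mxlift G).
Proof.
move=> /subgroup_pi[G1 GM GV]; split.
- by exists (SL3_one R); rewrite ?val_SL3_one.
- move=> _ _ [x <- Gx] [y <- Gy]; exists (SL3_mul x y); first exact: val_SL3_mul.
  exact: GM.
- move=> _ [x <- Gx]; exists (SL3_inv x); first exact: val_SL3_inv.
  exact: GV.
- by move=> _ [x <- _]; exact: (eqP (valP x)).
Qed.

Lemma mxlift_discrete G : subgroup G -> discrete_subset G -> mxdiscrete (mxlift G).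
Proof.
move=> sG dG; have [G1 _ _] := subgroup_pi sG.
have [_ [V V1 VG]] := dG _ G1.
have V1' : nbhs (SL3_one R) (\pi_(PSL3 R) @^-1` V).
  exact: (@pi_continuous _ (PSL3 R) (SL3_one R)) V1.
have [e e0 eV] : exists2 e : C, 0 < e & forall x : SL3 R,
    (forall i j, `|val x i j - 1%:M i j| < e) -> V (\pi_(PSL3 R) x).
  move: V1'; rewrite nbhsE => -[_ [[W oW <-] W1] WV].
  have : nbhs (1%:M : 'M[C]_3) W.
    by apply: open_nbhs_nbhs; split => //; rewrite -val_SL3_one.
  move/nbhs_ballP => [e e0 eW]; exists e => // x xe; apply: WV; apply: eW; split => // i j.
  by rewrite /ball /= distrC; exact: xe.
apply: (isolated_identity_discrete (mxlift_group sG) e0) => _ [x <- Gx] xe.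
have : (V `&` G) (\pi_(PSL3 R) x) by split => //; exact: eV.
rewrite VG => /eqmodP/asboolP[w w3 xw]; exists w => //.
by rewrite xw val_SL3_one scalemx1.
Qed.

Lemma mxlift_vabelian G : subgroup G -> mxvabelian (mxlift G) -> virtually_commutative G.
Proof.
move=> sG [D [gD DG abD [s sP]]]; have [D1 mD iD _] := gD.
pose H : set (PSL3 R) := [set g | exists2 x, \pi_(PSL3 R) x = g & D (val x)].
have Hpi x : D (val x) -> H (\pi_(PSL3 R) x) by exists x.
have HM x y : D (val x) -> D (val y) -> H (PSL3_mul (\pi_(PSL3 R) x) (\pi_(PSL3 R) y)).
  by move=> Dx Dy; rewrite PSL3_mul_pi; apply: Hpi; rewrite val_SL3_mul; exact: mD.
exists H; split.
- split; first by apply: mem_set; apply: Hpi; rewrite val_SL3_one.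
  move=> _ _ /set_mem[x <- Dx] /set_mem[y <- Dy]; apply: mem_set.
  suff : H (PSL3_mul (\pi_(PSL3 R) x) (PSL3_inv (\pi_(PSL3 R) y))) by [].
  by rewrite PSL3_inv_pi; apply: HM => //; rewrite val_SL3_inv; exact: iD.
- move=> _ [x <- /DG[y yx Gy]]; by have <- : y = x by exact: val_inj.
- move=> _ _ /set_mem[x <- Dx] /set_mem[y <- Dy].
  suff : PSL3_mul (\pi_(PSL3 R) x) (\pi_(PSL3 R) y) = PSL3_mul (\pi_(PSL3 R) y) (\pi_(PSL3 R) x) by [].
  rewrite !PSL3_mul_pi; congr (\pi_(PSL3 R) _); apply: val_inj.
  by rewrite !val_SL3_mul; exact: abD.
(* The left coset of the image of b, or the empty set if b is not in SL(3, C); the list s thus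
   bounds the number of cosets. *)
pose phi (b : 'M[C]_3) : set (PSL3 R) := [set k | exists x h,
  [/\ val x = b, D (val h) & k = \pi_(PSL3 R) (SL3_mul x h)]].
apply: (@sub_finite_set _ _ (phi @` [set` s])); last by apply: finite_image; exact: finite_seq.
move=> _ [g Gg <-]; elim/PSL3W: g Gg => x Gx.
have [b bs [[y yb Gy] Dyx]] := sP (val x) (ex_intro2 _ _ x erefl Gx).
exists b => //; apply/seteqP; split=> [_ [z [h [zb Dh ->]]]|_ [_ [h <- Dh] <-]].
  have {}zb : z = y by apply: val_inj; rewrite zb.
  exists (\pi_(PSL3 R) (SL3_mul (SL3_inv x) (SL3_mul y h))); last first.
    suff : PSL3_mul (\pi_(PSL3 R) x) (\pi_(PSL3 R) (SL3_mul (SL3_inv x) (SL3_mul y h))) =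
      \pi_(PSL3 R) (SL3_mul z h) by [].
    by rewrite PSL3_mul_pi SL3_mulA SL3_mulrV SL3_mul1 zb.
  apply: Hpi; rewrite SL3_mulA val_SL3_mul; apply: mD => //.
  have := iD _ Dyx; rewrite -yb invmxM ?unitmx_inv ?SL3_unit// invmxK.
  by rewrite val_SL3_mul val_SL3_inv.
exists y, (SL3_mul (SL3_inv y) (SL3_mul x h)); split => //.
  rewrite SL3_mulA !val_SL3_mul val_SL3_inv yb; exact: mD.
suff : PSL3_mul (\pi_(PSL3 R) x) (\pi_(PSL3 R) h) =
  \pi_(PSL3 R) (SL3_mul y (SL3_mul (SL3_inv y) (SL3_mul x h))) by [].
by rewrite PSL3_mul_pi (SL3_mulA y) SL3_mulrV SL3_mul1.
Qed.

Lemma mxlift_finite G : mxfinite (mxlift G) -> finite_set G.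
Proof.
move=> [s sP]; pose psi (b : 'M[C]_3) : PSL3 R :=
  if insub b is Some x then \pi_(PSL3 R) x else PSL3_one R.
apply: (@sub_finite_set _ _ (psi @` [set` s])); last by apply: finite_image; exact: finite_seq.
elim/PSL3W => x Gx; exists (val x); first by apply: sP; exists x.
by rewrite /psi valK.
Qed.

Lemma mxlift_invariant d F G h v : F \is d.-homog -> invariant_set G (zero_locus F) ->
  mxlift G h -> v != 0 -> ev F v = 0 -> ev F (h *m v) = 0.
Proof.
move=> homF inv [x <- Gx] v0 Fv; pose w : nzvec R 2 := Sub v v0.
have wv : val w = v by exact: SubK.
have Sw : zero_locus F (\pi_(P2) w) by apply/(zero_locus_pi _ homF); rewrite wv.
have : zero_locus F (pact (\pi_(PSL3 R) x) (\pi_(P2) w)).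
  by rewrite -(inv _ Gx); exists (\pi_(P2) w).
rewrite pact_pi => /(zero_locus_pi _ homF).
by rewrite val_mulSL3 wv.
Qed.

Lemma conic_form_veronese d F : (0 < d)%N -> F \is d.-homog -> conic_form F ->
  exists g : PSL3 R, zero_locus F = pact g @` veronese_curve R.
Proof.
move=> d0 homF [P Pu PF].
(* The Veronese curve is y^2 = 4 x z, and doubling x carries it to the conic 2 x z = y^2. *)
pose Q := P *m cols3 (vec3 2 0 0) (vec3 0 1 0) (vec3 0 0 1).
have Qu : Q \in unitmx.
  rewrite unitmx_mul Pu unitmxE unitfE det3E !cols3E !vec3E.
  by rewrite !(mul0r,mulr0,mulr1,mul1r,subr0,sub0r,addr0,add0r) pnatr_eq0.
(* Rescaling by c brings the determinant to 1 without changing the projective map. *)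
pose c : C := 3.-root (\det Q)^-1.
have c3 : c ^+ 3 = (\det Q)^-1 by rewrite /c rootCK.
have dQ : \det Q != 0 by rewrite -unitfE -unitmxE.
have c0 : c != 0 by have := invr_neq0 dQ; rewrite -c3 expf_eq0.
have dA : \det (c *: Q) == 1 by rewrite detZ c3 mulVf.
clearbody c; pose A : SL3 R := Sub (c *: Q) dA.
have AE : val A = c *: Q by exact: SubK.
have vE (v : 'cV[C]_2) : veronese_vec v =
    vec3 (v 0 0 ^+ 2) (2 * v 0 0 * v ord_max 0) (v ord_max 0 ^+ 2).
  by apply/colP; apply: ord3P; rewrite [RHS]vec3E /veronese_vec mxE ?inordK.
have DE (x y z : C) : cols3 (vec3 2 0 0) (vec3 0 1 0) (vec3 0 0 1) *m vec3 x y z = vec3 (2 * x) y z.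
  by rewrite cols3_mul !scale_vec3 !add_vec3; congr vec3; ring.
exists (\pi_(PSL3 R) A); apply/seteqP; split.
  move=> p; rewrite -[p]reprK; set v := repr p => /(zero_locus_pi _ homF) Fv.
  have v0 : val v != 0 := valP v.
  pose u := invmx P *m val v.
  have Pu' : P *m u = val v by rewrite mulKVmx.
  have u0 : u != 0 by rewrite mulmx_eq0 ?unitmx_inv.
  have qu : conicq u = 0 by apply/(PF _ u0); rewrite Pu'.
  have [w [k w0 uE]] : exists w : 'cV[C]_2, exists2 k, w != 0 &
      u = k *: (cols3 (vec3 2 0 0) (vec3 0 1 0) (vec3 0 0 1) *m veronese_vec w).
    move: u0 qu; rewrite {1 3}(vec3K u) /conicq.
    set x := u 0 0; set y := u 1 0; set z := u (inord 2) 0 => u0 qu.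
    have [z0|z0] := eqVneq z 0.
      have y0 : y = 0.
        by move/eqP: qu; rewrite z0 mulr0 sub0r oppr_eq0 sqrf_eq0 => /eqP.
      exists (\col_i [:: 1; 0]`_i), (x / 2).
        by apply/eqP => /colP/(_ 0); rewrite !mxE /= => /eqP; rewrite oner_eq0.
      rewrite vE DE scale_vec3 !mxE /= y0 z0; congr vec3; by field.
    exists (\col_i [:: y / (2 * z); 1]`_i), z.
      by apply/eqP => /colP/(_ ord_max); rewrite !mxE /= => /eqP; rewrite oner_eq0.
    rewrite vE DE scale_vec3 !mxE /=; congr vec3; last by ring.
      have yz : y ^+ 2 = 2 * x * z by apply/eqP; rewrite eq_sym -subr_eq0 qu.
      rewrite exprMn yz; by field.
    by field.
  have k0 : k != 0 by apply: contra u0 => /eqP k0; rewrite uE k0 scale0r.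
  pose w' : nzvec R 1 := Sub w w0.
  have w'E : val w' = w by exact: SubK.
  have vkE : val v = (k / c) *: (c *: Q *m veronese_vec w).
    rewrite -Pu' uE -scalemxAl -scalemxAr scalerA (divfK c0) /Q mulmxA.
    reflexivity.
  exists (veronese (\pi_(CP R 1) w')); first by exists (\pi_(CP R 1) w').
  rewrite veronese_pi pact_pi; apply/esym; apply: (@CP_eq _ _ _ _ (k / c)).
    by rewrite mulf_neq0 ?invr_eq0.
  by rewrite val_mulSL3 SubK AE w'E vkE.
move=> _ [_ [p _ <-] <-]; rewrite -[p]reprK veronese_pi pact_pi; set w := repr p.
apply/(zero_locus_pi _ homF); rewrite val_mulSL3 SubK AE -/(ev F _).
set q := veronese_vec (val w); have q0 : q != 0 by exact: veronese_subproof.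
rewrite -scalemxAl (ev_scale _ _ homF) -mulmxA.
suff -> : ev F (P *m (cols3 (vec3 2 0 0) (vec3 0 1 0) (vec3 0 0 1) *m q)) = 0 by rewrite mulr0.
apply/PF.
  rewrite /q vE DE; apply: contra q0 => /eqP/vec3_eq0[x0 y0 z0].
  rewrite /q vE y0 z0; have /eqP := x0; rewrite mulf_eq0 pnatr_eq0 /= => /eqP ->.
  by apply/eqP/colP; apply: ord3P; rewrite vec3E mxE.
rewrite /q vE DE /conicq !vec3E; ring.
Qed.

End Lift.

Theorem theorem0p2 (R : realType) (G : set (PSL3 R)) (S : set (CP R 2)) :
  subgroup G -> infinite_set G -> discrete_subset G ->
  ~ virtually_commutative G ->
  algebraic_curve S -> invariant_set G S ->
  ((exists2 A : set (set (CP R 2)), finite_set A /\ A `<=` @cline R &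
      S = \bigcup_(L in A) L) \/
   (exists g : PSL3 R, S = pact g @` veronese_curve R)) /\
  ((exists L : 'I_4 -> set (CP R 2),
      injective L /\ forall i, cline (L i) /\ L i `<=` S) ->
   forall (n : nat) (L : 'I_n -> set (CP R 2)),
     (forall i, cline (L i) /\ L i `<=` S) -> general_position L -> (n <= 3)%N).
Proof.
move=> sG infG dG nvG [d [F [d0 F0 homF ->]]] inv.
have [|lines fin] := invariant_curve_forms d0 homF F0 (mxlift_group sG) (mxlift_discrete sG dG) _
  (fun h v => mxlift_invariant (h := h) (v := v) homF inv).
  by move/(mxlift_vabelian sG).
split.
  case: lines => [[ls ls0 lsF]|cf]; last by right; exact: (conic_form_veronese d0 homF cf).
  left; exists ((fun l : 'rV[CC R]_3 => [set p : CP R 2 | l *m val (repr p) = 0]) @` [set` ls]).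
    split; first by apply: finite_image; exact: finite_seq.
    by move=> _ [l lls <-]; exists l => //; exact: ls0.
  apply/seteqP; split=> p.
    move/(lsF _ (valP (repr p))) => [l lls lp].
    by exists [set p : CP R 2 | l *m val (repr p) = 0] => //; exists l.
  move=> [_ [l lls <-] lp]; apply/(lsF _ (valP (repr p))); by exists l.
(* If n were at least 4, the first four lines would make the group finite, against [infG]. *)
move=> _ n L LS [_ gp]; rewrite leqNgt; apply/negP => n4; apply: infG; apply: mxlift_finite.
apply: fin; pose w (i : 'I_4) : 'I_n := widen_ord n4 i.
have winj i j : i != j -> w i != w j by rewrite -!val_eqE.
have [m mP] := choice (P := fun i (l : 'rV[CC R]_3) => l != 0 /\
    L (w i) = [set p : CP R 2 | l *m val (repr p) = 0]) (fun i =>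
  let: ex_intro2 l l0 lE := (LS (w i)).1 in ex_intro _ l (conj l0 lE)).
have mem i (v : nzvec R 2) : m i *m val v = 0 -> L (w i) (\pi_(CP R 2)%qT v).
  by move=> mv; rewrite (mP i).2; apply/cline_pi.
exists m; split.
- by move=> i; exact: (mP i).1.
- move=> i v v0 mv; pose v' : nzvec R 2 := Sub v v0.
  have v'E : val v' = v by exact: SubK.
  have := (LS (w i)).2 (\pi_(CP R 2)%qT v'); rewrite (zero_locus_pi _ homF) v'E; apply.
  by apply: mem; rewrite v'E.
- move=> i j k v ij ik jk mi mj mk; apply: contrapT => /eqP v0.
  pose v' : nzvec R 2 := Sub v v0; have v'E : val v' = v by exact: SubK.
  have : (L (w i) `&` L (w j) `&` L (w k)) (\pi_(CP R 2)%qT v').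
    by split; [split|]; apply: mem; rewrite v'E.
  by rewrite (gp _ _ _ (winj _ _ ij) (winj _ _ ik) (winj _ _ jk)).
Qed.
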